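(* Let $c_p,c_\mu>0$, $\alpha\ge\frac12$ and $\gamma\in[\max\{2-\alpha,\alpha\},\alpha+1]$. Let $T^*\in(0,\infty]$ and let $(\rho,u)$, with $\rho>0$, be a sufficiently smooth solution on $[0,T^* )$ of $$\partial_t\rho+\partial_x(u\rho)=0,\qquad \partial_t(\rho u)+\partial_x(\rho u^2)=-\partial_x p(\rho)+\partial_x(\mu(\rho)\partial_x u)+\rho f,\qquad (\rho,u)|_{t=0}=(\rho_0,u_0)$$ on $\mathbb{T}$, with $p(\rho)=c_p\rho^\gamma$ and $\mu(\rho)=c_\mu\rho^\alpha$. Assume that $f=\partial_x g$ for some periodic function $g$ satisfying $$g,\ \partial_x g,\ \partial_t g\in L^\infty(0,T^*;L^\infty(\mathbb{T})).$$ Then for every $T\in(0,T^* )$, $$\frac1T\int_0^T\|\rho(\cdot,t)\|_{L^\infty(\mathbb{T})}\,dt\le C_1+\frac1T C_2,$$ where $C_1$ depends only on $c_\mu$, $c_p$, $\alpha$, $\gamma$, $\|\rho_0\|_{L^1}$, $\|\partial_x g\|_{L^\infty(0,T;L^\infty)}$ and $\|\partial_t g\|_{L^\infty(0,T;L^\infty)}$, and $C_2$ depends only on $c_\mu$, $c_p$, $\gamma$, $\alpha$, $\|\rho_0\|_{L^\infty}$, $\|\rho_0^{-1}\|_{L^\infty}$, $\|u_0\|_{L^2}$, $\|\partial_x\rho_0\|_{L^2}$ and $\|g\|_{L^\infty(0,T;L^\infty)}$. Consequently, if $T^*=\infty$, then $$\limsup_{T\to\infty}\frac1T\int_0^T\|\rho(\cdot,t)\|_{L^\infty(\mathbb{T})}\,dt\le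 C_3,$$ where $C_3$ depends only on $c_\mu$, $c_p$, $\alpha$, $\gamma$, $\|\rho_0\|_{L^1}$, $\|\partial_x g\|_{L^\infty(0,\infty;L^\infty)}$ and $\|\partial_t g\|_{L^\infty(0,\infty;L^\infty)}$.
   Context: $\mathbb{T}$ denotes the interval $(0,1]$ with periodic boundary conditions (the one-dimensional torus of length one). The unknowns are the density $\rho(x,t)$ and velocity $u(x,t)$; $f$ is the external force. ''Sufficiently smooth'' may be taken to mean the regularity class used for the a priori estimates: $\rho\in C(0,T;H^3(\mathbb{T}))$ and $u\in C(0,T;H^3(\mathbb{T}))\cap L^2(0,T;H^4(\mathbb{T}))$ for every $T<T^*$, where $C(0,T;X)$ denotes continuous functions $[0,T]\to X$. *)

(* Defs.v *)
From HB Require Import structures.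
From mathcomp Require Import all_boot all_order all_algebra.
From mathcomp Require Import all_classical all_reals all_analysis.

Set Implicit Arguments.
Unset Strict Implicit.
Unset Printing Implicit Defensive.

Import Order.TTheory GRing.Theory Num.Theory.
Import numFieldNormedType.Exports.

Local Open Scope classical_set_scope.
Local Open Scope ring_scope.

(* Functions on the torus are 1-periodic functions R -> R, integrated over the
   fundamental domain (0, 1]. Space-time functions h take time first: h t x. *)

Definition periodic1 {R : realType} (f : R -> R) : Prop :=
  forall x, f (x + 1) = f x.

Definition torus {R : realType} : set R := `]0, 1].

Lemma measurable_torus {R : realType} : measurable (@torus R).
Proof. exact: measurable_itv. Qed.

Definition torus_norm {R : realType} (p : \bar R) (f : R -> R) : \bar R :=
  ('N[mrestr lebesgue_measure measurable_torus]_p[EFin \o f])%E.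

Definition Lp_torus {R : realType} (p : \bar R) (f : R -> R) : Prop :=
  [/\ periodic1 f, measurable_fun setT f & (torus_norm p f < +oo)%E].

(** Sobolev spaces H^k of the torus *)

(* Weak derivatives are tested against C^1 functions: by density this gives the
   same notion as testing against C^oo functions. *)
Definition C1_torus {R : realType} (phi : R -> R) : Prop :=
  [/\ periodic1 phi, (forall x, derivable phi x 1) & continuous (derive1 phi)].

Definition is_weak_deriv {R : realType} (f h : R -> R) : Prop :=
  [/\ Lp_torus 1%E f, Lp_torus 1%E h &
      forall phi, C1_torus phi ->
        \int[lebesgue_measure]_(x in torus) (f x * derive1 phi x) =
        - \int[lebesgue_measure]_(x in torus) (h x * phi x)].

(* A weak derivative of f if there is one (unique almost everywhere), and 0
   otherwise. *)
Definition weak_deriv {R : realType} (f : R -> R) : R -> R :=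
  xget (cst 0) [set h | is_weak_deriv f h].

Fixpoint Hspace {R : realType} (k : nat) (f : R -> R) : Prop :=
  match k with
  | 0%N => Lp_torus 2%:E f
  | k'.+1 => Lp_torus 2%:E f /\ exists2 h, is_weak_deriv f h & Hspace k' h
  end.

Definition Hnorm {R : realType} (k : nat) (f : R -> R) : \bar R :=
  ((\sum_(j < k.+1) torus_norm 2%:E (iter j weak_deriv f) `^ 2) `^ 2^-1)%E.

(** Spaces of functions of time with values in H^k *)

(* h is continuous from [0, T] to H^k *)
Definition C_Hspace {R : realType} (T : R) (k : nat) (h : R -> R -> R) : Prop :=
  (forall t, t \in `[0, T] -> Hspace k (h t)) /\
  (forall t, t \in `[0, T] ->
     Hnorm k (h s \- h t) @[s --> within [set` `[0, T]] (nbhs t)]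
       --> 0%E).

Lemma measurable_time {R : realType} (T : \bar R) :
  measurable [set t : R | (0 < t%:E < T)%E].
Proof.
case: T => [r| |].
- rewrite (_ : [set _ | _] = [set` `]0, r[]); first exact: measurable_itv.
  by apply/seteqP; split => t /=; rewrite in_itv /= !lte_fin.
- rewrite (_ : [set _ | _] = [set` `]0, +oo[]); first exact: measurable_itv.
  by apply/seteqP; split => t /=; rewrite in_itv /= lte_fin ltry.
- rewrite (_ : [set _ | _] = set0) //.
  by apply/seteqP; split => t //= /andP[_]; rewrite ltNge leNye.
Qed.

Definition time_measure {R : realType} (T : \bar R) :=
  mrestr (@lebesgue_measure R) (measurable_time T).

(* A simple function of time with values in H^k *)
Definition simple_Hspace {R : realType} (k : nat) (s : R -> R -> R) : Prop :=
  exists (m : nat) (A : 'I_m -> set R) (v : 'I_m -> R -> R),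
    (forall i, measurable (A i) /\ Hspace k (v i)) /\
    s = fun t x => \sum_(i < m) \1_(A i) t * v i x.

(* The Bochner space L^2(0, T; H^k) *)
Definition L2_Hspace {R : realType} (T : R) (k : nat) (h : R -> R -> R) : Prop :=
  [/\ (\forall t \ae time_measure T%:E, Hspace k (h t)),
      (exists s : nat -> R -> R -> R, (forall n, simple_Hspace k (s n)) /\
         \forall t \ae time_measure T%:E,
           (fun n => Hnorm k (s n t \- h t)) @ \oo --> 0%E) &
      (\int[lebesgue_measure]_(t in `]0%R, T[) (Hnorm k (h t) `^ 2) < +oo)%E].

(** The space L^oo(0, T; L^oo) *)

Definition Linfty_norm {R : realType} (T : \bar R) (h : R -> R -> R) : \bar R :=
  ('N[time_measure T]_+oo [(fun t => torus_norm +oo (h t))])%E.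

(* As usual for L^oo(0, T; L^oo), measurability is meant jointly in (t, x). *)
Definition Linfty_space {R : realType} (T : \bar R) (h : R -> R -> R) : Prop :=
  [/\ (forall t, (0 < t%:E < T)%E -> periodic1 (h t)),
      measurable_fun [set z : R * R | (0 < z.1%:E < T)%E]
        (fun z => h z.1 z.2) &
      (Linfty_norm T h < +oo)%E].

(** Distributions on (0, T) x torus *)

Definition dx {R : realType} (phi : R -> R -> R) (t x : R) : R :=
  derive1 (phi t) x.

Definition dt {R : realType} (phi : R -> R -> R) (t x : R) : R :=
  derive1 (phi ^~ x) t.

Definition test_fun {R : realType} (T : \bar R) (phi : R -> R -> R) : Prop :=
  [/\ (forall t, periodic1 (phi t)),
      (forall t x, derivable (phi t) x 1 /\ derivable (phi ^~ x) t 1),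
      continuous (fun z : R * R => dx phi z.1 z.2),
      continuous (fun z : R * R => dt phi z.1 z.2) &
      exists a b : R, [/\ 0 < a, (b%:E < T)%E &
        forall t x, ~~ (a <= t <= b) -> phi t x = 0]].

Definition pairing {R : realType} (T : \bar R) (h phi : R -> R -> R) : R :=
  \int[lebesgue_measure]_(t in [set t : R | (0 < t%:E < T)%E])
    \int[lebesgue_measure]_(x in torus) (h t x * phi t x).

Definition dist_dx {R : realType} (T : \bar R) (h phi : R -> R -> R) : R :=
  - pairing T h (dx phi).

Definition dist_dt {R : realType} (T : \bar R) (h phi : R -> R -> R) : R :=
  - pairing T h (dt phi).

(** The compressible Navier-Stokes system *)

Definition pressure {R : realType} (cp gamma r : R) : R := cp * r `^ gamma.

Definition viscosity {R : realType} (cmu alpha r : R) : R := cmu * r `^ alpha.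

(* Since f is merely bounded, the system is understood in the sense of
   distributions. Elements of H^3 are identified with their continuous
   representatives. *)
Record smooth_solution {R : realType} (cp cmu alpha gamma : R) (Tstar : \bar R)
    (rho u f : R -> R -> R) (rho0 u0 : R -> R) : Prop := SmoothSolution {
  sol_rho_H3 : forall T, 0 < T -> (T%:E < Tstar)%E -> C_Hspace T 3 rho ;
  sol_u_H3 : forall T, 0 < T -> (T%:E < Tstar)%E -> C_Hspace T 3 u ;
  sol_u_H4 : forall T, 0 < T -> (T%:E < Tstar)%E -> L2_Hspace T 4 u ;
  sol_continuous : forall t, (0 <= t%:E < Tstar)%E ->
    continuous (rho t) /\ continuous (u t) ;
  sol_rho_gt0 : forall t x, (0 <= t%:E < Tstar)%E -> 0 < rho t x ;
  sol_mass : forall phi, test_fun Tstar phi ->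
    dist_dt Tstar rho phi
    + dist_dx Tstar (fun t x => u t x * rho t x) phi = 0 ;
  sol_momentum : forall phi, test_fun Tstar phi ->
    dist_dt Tstar (fun t x => rho t x * u t x) phi
    + dist_dx Tstar (fun t x => rho t x * u t x ^+ 2) phi
    = - dist_dx Tstar (fun t x => pressure cp gamma (rho t x)) phi
      + dist_dx Tstar
          (fun t x => viscosity cmu alpha (rho t x) * weak_deriv (u t) x) phi
      + pairing Tstar (fun t x => rho t x * f t x) phi ;
  sol_init : rho 0 = rho0 /\ u 0 = u0
}.

(* Main.v *)
Require Import Defs.
From HB Require Import structures.
From mathcomp Require Import all_boot all_order all_algebra.
From mathcomp Require Import all_classical all_reals all_analysis.
From mathcomp Require Import measurable_realfun ess_sup_inf.
From mathcomp Require Import ring lra.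
Import Order.TTheory GRing.Theory Num.Theory.
Import numFieldNormedType.Exports.
Local Open Scope classical_set_scope.
Local Open Scope ring_scope.

Set Implicit Arguments.
Unset Strict Implicit.
Unset Printing Implicit Defensive.

(** Let [v = u + cmu rho^(alpha - 2) rho_x] be the effective velocity. The
    energy [E], the integral of [rho v^2 / 2] plus the internal energy, decreases
    by the dissipation [D], the integral of
    [cp cmu gamma rho^(gamma + alpha - 3) rho_x^2], up to the work of the force.
    In one dimension [D] controls the maximum of [rho]: at the minimum the density
    is at most the conserved mass [M], and from there the power
    [(gamma + alpha - 1) / 2] of the density oscillates by at most a multiple of
    the square root of [D]. As this exponent is at least 1/2, the maximum is
    bounded by [1 + 2 M^(gamma + alpha - 1)] plus a multiple of [D]
    ([density_sup_le]). So the time average of [D] is what has to be bounded.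

    The force acts on [rho v = rho u + cmu rho^(alpha - 1) rho_x]. Against the
    second term it is absorbed by half of the dissipation, because [gamma] is
    between [alpha] and [alpha + 1] ([force_visc_le]). Against [rho u], the
    identity [f = g_x] and the continuity equation turn it into the integral of
    [g rho_t]; an integration by parts in time leaves boundary terms of size
    [|g| M] and an integral of size [|g_t| M T] ([work_le]). Hence
    [1/2 int_0^T D <= E(0) + cp + 2 |g| M + (c (1 + M) + |g_t| M) T]
    ([total_dissip_le]), and dividing by [T] gives the claim.

    The energy inequality is not obtained by differentiating [E]: the force is
    only bounded and the momentum equation holds in the sense of distributions.
    It is obtained from increments ([energy_step]). The kinetic energy is convex in
    momentum and density, so its increment over [s, t] is at most the momentum
    increment paired with [v] frozen at time [t], corrected by density
    increments. The first is given by the momentum equation with a test function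
    that is constant in time, apart from cut-offs; all errors are small multiples
    of [t - s], and such increments add up ([nonincreasing_of_increments]).

    The regularity used is that [rho], its first two space derivatives, [u] and
    its first space derivative are continuous in time and space. It follows from
    continuity in time with values in H^3 by the one-dimensional Sobolev embedding
    ([Hspace_derive1], [C_Hspace_jcont]). The continuity equation then holds
    pointwise ([mass_is_derive]). *)

(** * Integrals and derivatives in one variable *)

#[export] Hint Extern 0 (measurable torus) => solve [exact: measurable_torus] : core.

Section Integrals.
Context {R : realType}.
Notation mu := (@lebesgue_measure R).

Lemma torus_measure : mu torus = 1%E.
Proof. by rewrite /torus lebesgue_measure_itv /= lte_fin ltr01 oppr0 adde0. Qed.

Lemma itv_measure_lty (a b : R) (b1 b2 : bool) :
  (mu [set` Interval (BSide b1 a) (BSide b2 b)] < +oo)%E.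
Proof. by rewrite lebesgue_measure_itv /=; case: ifP => _; rewrite ?ltry// -EFinB ltry. Qed.

Lemma torus_measure_lty : (mu torus < +oo)%E.
Proof. by rewrite torus_measure ltry. Qed.

Lemma bounded_integrable (D : set R) (f : R -> R) (N : R) : measurable D ->
  (mu D < +oo)%E -> measurable_fun D f -> (forall x, D x -> `|f x| <= N) ->
  mu.-integrable D (EFin \o f).
Proof.
move=> mD fD mf fN; apply: measurable_bounded_integrable => //.
exists N; split; first exact: num_real.
by move=> M NM x Dx; exact: le_trans (fN _ Dx) (ltW NM).
Qed.

Lemma integrable_addr (D : set R) (f g : R -> R) : measurable D ->
  mu.-integrable D (EFin \o f) -> mu.-integrable D (EFin \o g) ->
  mu.-integrable D (EFin \o (fun x => f x + g x)).
Proof.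
move=> mD fi gi.
rewrite (_ : _ \o _ = ((EFin \o f) \+ (EFin \o g))%E); last exact/funext.
exact: integrableD.
Qed.

Lemma integrable_subr (D : set R) (f g : R -> R) : measurable D ->
  mu.-integrable D (EFin \o f) -> mu.-integrable D (EFin \o g) ->
  mu.-integrable D (EFin \o (fun x => f x - g x)).
Proof.
move=> mD fi gi.
rewrite (_ : _ \o _ = ((EFin \o f) \- (EFin \o g))%E); last exact/funext.
exact: integrableB.
Qed.

Lemma integrable_scalerl (D : set R) (c : R) (f : R -> R) : measurable D ->
  mu.-integrable D (EFin \o f) -> mu.-integrable D (EFin \o (fun x => c * f x)).
Proof.
move=> mD fi.
rewrite (_ : _ \o _ = (fun x => c%:E * (EFin \o f) x)%E); last exact/funext.
exact: integrableZl.
Qed.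

Lemma EFin_Rintegral (D : set R) (f : R -> R) : measurable D ->
  mu.-integrable D (EFin \o f) ->
  (\int[mu]_(x in D) (f x)%:E)%E = (\int[mu]_(x in D) f x)%:E.
Proof. by move=> mD fi; rewrite fineK//; exact: integrable_fin_num. Qed.

Lemma normr_Rintegral_bound (D : set R) (f : R -> R) (N : R) : measurable D ->
  (mu D < +oo)%E -> measurable_fun D f -> (forall x, D x -> `|f x| <= N) ->
  `|\int[mu]_(x in D) f x| <= N * fine (mu D).
Proof.
move=> mD fD mf fN.
have fi : mu.-integrable D (EFin \o f) by exact: bounded_integrable fN.
have h : `|\int[mu]_(x in D) f x| <= \int[mu]_(x in D) `|f x|.
  exact: le_normr_Rintegral.
apply: (le_trans h).
rewrite -Rintegral_cst//; apply: le_Rintegral => //.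
  exact: integrable_norm.
by apply: (@bounded_integrable _ (cst N) `|N|) => //; exact: measurable_cst.
Qed.

Lemma continuous_integrable_itv (f : R -> R) (a b : R) (b1 b2 : bool) : continuous f ->
  mu.-integrable [set` Interval (BSide b1 a) (BSide b2 b)] (EFin \o f).
Proof.
move=> cf.
have ic : mu.-integrable `[a, b] (EFin \o f).
  apply: continuous_compact_integrable; first exact: segment_compact.
  exact: continuous_subspaceT.
apply: integrableS ic => //; by apply: subset_itv; rewrite bnd_simp//.
Qed.

Lemma FTC_itv (f f' : R -> R) (a b : R) (b1 b2 : bool) : a <= b ->
  (forall x : R, is_derive x 1 f (f' x)) -> continuous f' ->
  \int[mu]_(x in [set` Interval (BSide b1 a) (BSide b2 b)]) f' x = f b - f a.
Proof.
move=> ab df cf'.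
have cf : continuous f.
  by move=> x; apply/differentiable_continuous/derivable1_diffP; case: (df x).
have mf' : measurable_fun `]a, b[ (EFin \o f').
  apply/measurable_EFinP; apply: measurable_funTS.
  exact: continuous_measurable_fun.
rewrite /Rintegral integral_itv_bndoo// -(integral_itv_bndoo true false)//.
have [->|anb] := eqVneq a b; first by rewrite set_itv1 integral_set1 subrr.
have ltab : a < b by rewrite lt_neqAle anb.
rewrite (continuous_FTC2 ltab (F := f))//.
- exact: continuous_subspaceT.
- split=> [x _||]; first by case: (df x).
  + exact/cvg_at_right_filter/cf.
  + exact/cvg_at_left_filter/cf.
- by move=> x _; rewrite derive1E; case: (df x).
Qed.

(** Estimates of increments give differentiability in this form. *)
Lemma is_derive_eps (F : R -> R) (y d : R) :
  (forall e, 0 < e -> exists2 k, 0 < k &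
     forall h, `|h| < k -> `|F (y + h) - F y - h * d| <= e * `|h|) ->
  is_derive y 1 F d.
Proof.
move=> Fe.
have lim : h^-1 *: (F (h *: 1 + y) - F y) @[h --> 0^'] --> d.
  apply/cvgrPdist_le => e e0; have [k k0 Fk] := Fe e e0.
  near=> h.
  have h0 : h != 0 by near: h; exact: nbhs_dnbhs_neq.
  have hk : `|h| < k by near: h; apply: dnbhs0_lt.
  have -> : d - h^-1 *: (F (h *: 1 + y) - F y) =
      - (h^-1 * (F (y + h) - F y - h * d)).
    by rewrite /GRing.scale /= mulr1 (addrC h y); field.
  rewrite normrN normrM normfV ler_pdivrMl ?normr_gt0// [leRHS]mulrC.
  exact: Fk.
split; first by apply/cvg_ex; exists d.
exact/cvg_lim.
Unshelve. all: by end_near. Qed.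

(** The square of the positive part is the simplest C^1 function that vanishes
    on a half-line; all cut-off functions are built from it. *)
Definition possq (y : R) : R := Num.max y 0 ^+ 2.

Lemma is_derive_possq (y : R) : is_derive y 1 possq (2 * Num.max y 0).
Proof.
apply: is_derive_eps => e e0; exists e => // h /ltW he.
apply: (@le_trans _ _ (`|h| * `|h|)); last by rewrite ler_wpM2r.
rewrite -normrM -expr2 ger0_norm ?sqr_ge0// ler_norml /possq.
by case: (lerP y 0) => y0; case: (lerP (y + h) 0) => yh0; apply/andP; split; nra.
Qed.

Lemma continuous_pospart : continuous (fun y : R => Num.max y 0).
Proof. by move=> y; apply: continuous_max; [exact: cvg_id|exact: cvg_cst]. Qed.

Lemma is_derive1M (f g : R -> R) (x a b : R) : is_derive x 1 f a ->
  is_derive x 1 g b -> is_derive x 1 (fun y => f y * g y) (a * g x + f x * b).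
Proof.
move=> df dg; rewrite (_ : (fun y => _) = f * g); last exact/funext.
apply: is_derive_eq.
by rewrite /GRing.scale /=; ring.
Qed.

Lemma is_derive1D (f g : R -> R) (x a b : R) : is_derive x 1 f a ->
  is_derive x 1 g b -> is_derive x 1 (fun y => f y + g y) (a + b).
Proof.
move=> df dg; rewrite (_ : (fun y => _) = f + g); last exact/funext.
exact: is_deriveD.
Qed.

Lemma is_derive1N (f : R -> R) (x a : R) : is_derive x 1 f a ->
  is_derive x 1 (fun y => - f y) (- a).
Proof.
move=> df; rewrite (_ : (fun y => _) = - f); last exact/funext.
exact: is_deriveN.
Qed.

Lemma is_derive1Zl (k : R) (f : R -> R) (x a : R) : is_derive x 1 f a ->
  is_derive x 1 (fun y => k * f y) (k * a).
Proof.
move=> df; rewrite (_ : (fun y => _) = k *: f); last exact/funext.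
exact: is_deriveZ.
Qed.

Lemma is_derive1c (f g : R -> R) (x a b : R) : is_derive (g x) 1 f a ->
  is_derive x 1 g b -> is_derive x 1 (fun y => f (g y)) (a * b).
Proof. by move=> df dg; exact: (is_derive1_comp df dg). Qed.

Lemma continuous_is_derive (f f' : R -> R) :
  (forall x : R, is_derive x 1 f (f' x)) -> continuous f.
Proof.
by move=> df x; apply/differentiable_continuous/derivable1_diffP; case: (df x).
Qed.

Lemma continuous_integrable_torus (f : R -> R) : continuous f ->
  mu.-integrable torus (EFin \o f).
Proof. exact: continuous_integrable_itv. Qed.

Lemma eq_Rintegral_ae (D : set R) (f g : R -> R) : measurable D ->
  measurable_fun D f -> measurable_fun D g ->
  {ae mu, forall x, D x -> f x = g x} ->
  \int[mu]_(x in D) f x = \int[mu]_(x in D) g x.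
Proof.
move=> mD mf mg fg; rewrite /Rintegral; congr fine; apply: ae_eq_integral => //.
- exact/measurable_EFinP.
- exact/measurable_EFinP.
- by apply: (@filterS _ _ (ae_filter_ringOfSetsType mu)) fg => x fg tx; rewrite fg.
Qed.

Lemma Rintegral_torus_cst (a : R) : \int[mu]_(x in torus) a = a.
Proof.
rewrite Rintegral_cst// [X in fine X](_ : _ = 1%E) ?mulr1//; exact: torus_measure.
Qed.

Lemma periodic1_sub1 (f : R -> R) : periodic1 f -> f 1 = f 0.
Proof. by move=> pf; rewrite -[1]add0r pf. Qed.

(** Periodicity cancels the boundary terms. *)
Lemma IBP_torus (f f' g g' : R -> R) : periodic1 f -> periodic1 g ->
  (forall x : R, is_derive x 1 f (f' x)) -> (forall x : R, is_derive x 1 g (g' x)) ->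
  continuous f' -> continuous g' ->
  \int[mu]_(x in torus) (f' x * g x) = - \int[mu]_(x in torus) (f x * g' x).
Proof.
move=> pf pg df dg cf' cg'.
have cf := continuous_is_derive df; have cg := continuous_is_derive dg.
have cM (a b : R -> R) : continuous a -> continuous b ->
    continuous (fun x => a x * b x) by move=> ca cb x; apply: cvgM; [exact: ca|exact: cb].
apply/eqP; rewrite -addr_eq0 -RintegralD//; last 2 first.
- exact/continuous_integrable_torus/cM.
- exact/continuous_integrable_torus/cM.
have dfg (x : R) : is_derive x 1 (fun x => f x * g x) (f' x * g x + f x * g' x).
  exact: is_derive1M.
rewrite (FTC_itv false false ler01 dfg)//; first by rewrite !periodic1_sub1// subrr.
by move=> x; apply: cvgD; exact: cM.
Qed.

End Integrals.

(** * Jointly continuous functions of time and space *)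


Section JointContinuity.
Context {R : realType}.
Notation mu := (@lebesgue_measure R).

Definition jcont (H : R -> R -> R) := continuous (fun z : R * R => H z.1 z.2).

Lemma jcontD H K : jcont H -> jcont K -> jcont (fun t x => H t x + K t x).
Proof. by move=> cH cK z; apply: cvgD; [exact: cH|exact: cK]. Qed.

Lemma jcontN H : jcont H -> jcont (fun t x => - H t x).
Proof. by move=> cH z; apply: cvgN; exact: cH. Qed.

Lemma jcontM H K : jcont H -> jcont K -> jcont (fun t x => H t x * K t x).
Proof. by move=> cH cK z; apply: cvgM; [exact: cH|exact: cK]. Qed.

Lemma jcont_cst (c : R) : jcont (fun _ _ => c).
Proof. by move=> z; exact: cvg_cst. Qed.

Lemma jcont_t (f : R -> R) : continuous f -> jcont (fun t _ => f t).
Proof.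
move=> cf z; apply: (@continuous_comp _ _ _ (@fst R R) f); [exact: cvg_fst|exact: cf].
Qed.

Lemma jcont_x (f : R -> R) : continuous f -> jcont (fun _ x => f x).
Proof.
move=> cf z; apply: (@continuous_comp _ _ _ (@snd R R) f); [exact: cvg_snd|exact: cf].
Qed.

Lemma jcont_comp (f : R -> R) H : (forall t x, {for H t x, continuous f}) ->
  jcont H -> jcont (fun t x => f (H t x)).
Proof.
move=> cf cH z; apply: (@continuous_comp _ _ _ (fun z : R * R => H z.1 z.2) f).
  exact: cH.
exact: cf.
Qed.

Lemma jcont_sect H t : jcont H -> continuous (H t).
Proof.
move=> cH x.
apply: (@continuous_comp _ _ _ (fun x : R => (t, x)) (fun z : R * R => H z.1 z.2)).
  apply: (@cvg_pair _ _ _ (nbhs x) (nbhs t) (nbhs x)); [exact: cvg_cst|exact: cvg_id].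
exact: cH.
Qed.

(** Heine's theorem in the time variable: continuity is uniform on the compact
    slab. *)
Lemma jcont_unif H (a b e : R) : jcont H -> 0 < e ->
  exists2 d, 0 < d & forall s t x, a <= s <= b -> 0 <= x <= 1 ->
    `|s - t| < d -> `|H s x - H t x| <= e.
Proof.
move=> cH e0.
have : compact (`[a, b] `*` `[0 : R, 1]).
  by apply: compact_setX; exact: segment_compact.
move=> /compact_near_coveringP/(_ R 0^'+
  (fun d z => forall t, `|z.1 - t| < d -> `|H z.1 z.2 - H t z.2| <= e)).
case.
  move=> z0 _; have e20 : 0 < e / 2 by rewrite divr_gt0.
  have /nbhs_ballP[k /= k0 Hk] : \forall z \near z0, `|H z0.1 z0.2 - H z.1 z.2| < e / 2.
    by have /cvgrPdist_lt := cH z0; apply.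
  have k20 : 0 < k / 2 by rewrite divr_gt0.
  exists (ball z0 (k / 2), [set d | d < k / 2]) => /=.
    split; first exact: nbhsx_ballx.
    exact: nbhs_right_lt.
  move=> [z d] /= [[z1 z2] dk] t std.
  have h1 := Hk z.
  have h2 := Hk (t, z.2).
  have {}h1 : `|H z0.1 z0.2 - H z.1 z.2| < e / 2.
    apply: h1; split => /=; rewrite /ball /=; [move: z1|move: z2];
      rewrite /ball /=; lra.
  have {}h2 : `|H z0.1 z0.2 - H t z.2| < e / 2.
    apply: h2; split => /=; rewrite /ball /=; [move: z1|move: z2];
      rewrite /ball /=; last by lra.
    move=> z1; have := ler_distD z.1 z0.1 t; lra.
  have := ler_distD (H z0.1 z0.2) (H z.1 z.2) (H t z.2).
  rewrite (distrC (H z.1 z.2) (H z0.1 z0.2)); move: h1 h2 => /= h1 h2; lra.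
move=> d /= d0 Hd; exists (d / 2); first by rewrite divr_gt0.
move=> s t x sab x01 st.
have d20 : 0 < d / 2 by rewrite divr_gt0.
apply: (Hd (d / 2) _ d20 (s, x)) => //=.
  by rewrite /= sub0r normrN gtr0_norm// gtr_pMr// invf_lt1// ltr1n.
Qed.

Lemma jcont_bound H (a b : R) : jcont H ->
  exists2 N, 0 <= N & forall t x, a <= t <= b -> 0 <= x <= 1 -> `|H t x| <= N.
Proof.
move=> cH; have [ab|ba] := leP a b; last first.
  by exists 0 => // t x /andP[? ?]; lra.
have cK : compact (`[a, b] `*` `[0 : R, 1]).
  by apply: compact_setX; exact: segment_compact.
have [||c _ Hc] := compact_EVT_max (f := fun z => `|H z.1 z.2|) _ cK.
- by exists (a, 0); split => /=; rewrite in_itv /= ?lexx ?ler01 ?ab.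
- by apply: continuous_subspaceT => z; apply: cvg_norm; exact: cH.
exists `|H c.1 c.2| => // t x tab x01.
by apply: (Hc (t, x)); rewrite inE; split => /=; rewrite in_itv.
Qed.

Lemma Rintegral_torus_bound (f : R -> R) (N : R) : measurable_fun torus f ->
  (forall x, 0 <= x <= 1 -> `|f x| <= N) ->
  `|\int[mu]_(x in torus) f x| <= N.
Proof.
move=> mf fN; rewrite -[leRHS]mulr1.
rewrite [X in _ * X](_ : 1 = fine (mu torus)); last by rewrite torus_measure.
apply: normr_Rintegral_bound => //; first exact: torus_measure_lty.
by move=> x; rewrite /torus /= in_itv /= => /andP[/ltW x0 x1]; apply: fN; rewrite x0.
Qed.

Lemma Rintegral_torus_dist (f g : R -> R) (e : R) : continuous f ->
  continuous g -> (forall x, 0 <= x <= 1 -> `|f x - g x| <= e) ->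
  `|\int[mu]_(x in torus) f x - \int[mu]_(x in torus) g x| <= e.
Proof.
move=> cf cg fg; rewrite -RintegralB//; last 2 first.
- exact: continuous_integrable_torus.
- exact: continuous_integrable_torus.
apply: Rintegral_torus_bound => //; apply: measurable_funTS.
by apply: continuous_measurable_fun => x; apply: cvgB; [exact: cf|exact: cg].
Qed.

(** Uniform continuity on compact slabs passes to the integral over a period.
    *)
Lemma continuous_Rintegral_torus H : jcont H ->
  continuous (fun t => \int[mu]_(x in torus) H t x).
Proof.
move=> cH t; apply/cvgrPdist_le => e e0.
have [d d0 Hd] := jcont_unif (t - 1) (t + 1) cH e0.
near=> s; apply: Rintegral_torus_dist; [exact: jcont_sect..|].
move=> x x01; apply: Hd => //; first by apply/andP; split; lra.
Unshelve. all: by end_near. Qed.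

Lemma open_measurable_prod (U : set (R * R)) : open U -> measurable U.
Proof.
move=> oU.
pose box (q : (rat * rat) * (rat * rat)) : set (R * R) :=
  `]ratr q.1.1, ratr q.1.2[ `*` `]ratr q.2.1, ratr q.2.2[.
have -> : U = \bigcup_q (if `[< box q `<=` U >] then box q else set0).
  apply/seteqP; split; last first.
    by move=> z [q _]; case: asboolP => // qU; exact: qU.
  move=> z Uz; have /nbhs_ballP[e /= e0 eU] : nbhs z U by exact: open_nbhs_nbhs.
  have rat4 (x : R) : exists q : rat * rat, x - e < ratr q.1 < x /\ x < ratr q.2 < x + e.
    have [q1 h1] : exists q : rat, ratr q \in `]x - e, x[.
      by apply: rat_in_itvoo; rewrite ltrBlDr ltrDl.
    have [q2 h2] : exists q : rat, ratr q \in `]x, x + e[.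
      by apply: rat_in_itvoo; rewrite ltrDl.
    by exists (q1, q2); move: h1 h2; rewrite !in_itv.
  have [q1 [/andP[h1 h2] /andP[h3 h4]]] := rat4 z.1.
  have [q2 [/andP[k1 k2] /andP[k3 k4]]] := rat4 z.2.
  exists (q1, q2) => //; case: asboolP => [_|[]].
    by split => /=; rewrite in_itv /=; apply/andP.
  move=> w [/=]; rewrite !in_itv /= => /andP[? ?] /andP[? ?]; apply: eU.
  by split; rewrite /ball /= ltr_norml; apply/andP; split; lra.
apply: countable_bigcupT_measurable; first exact: countableP.
move=> q; case: asboolP => _; last exact: measurable0.
by apply: measurableX; exact: measurable_itv.
Qed.

Lemma jcont_measurable H : jcont H ->
  measurable_fun setT (fun z : R * R => H z.1 z.2).
Proof.
move=> cH; apply: (measurability _ (RGenOpens.measurableE R)).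
move=> _ [_ [a [b ->] <-]]; rewrite setTI; apply: open_measurable_prod.
by move/continuousP : cH; apply; exact: interval_open.
Qed.

Lemma measurable_Rintegral_torus (F : R -> R -> R) :
  measurable_fun setT (fun z : R * R => F z.1 z.2) ->
  measurable_fun setT (fun t => \int[mu]_(x in torus) F t x).
Proof.
move=> mF; apply: measurableT_comp => //.
pose f (z : R * R) : \bar R := (F z.1 z.2 * \1_torus z.2)%:E.
have mf : measurable_fun setT f.
  apply/measurable_EFinP; apply: measurable_funM => //.
  apply: (@measurableT_comp _ _ _ _ _ _ (\1_torus : R -> R)) => //.
rewrite [X in measurable_fun _ X](_ : _ = (fun t =>
  \int[mu]_x (f^\+ (t, x)) - \int[mu]_x (f^\- (t, x)))%E); last first.
  apply/funext => t.
  rewrite integral_mkcond integralE; congr (_ - _)%E; apply: eq_integral => x _;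
  by rewrite ?funeposE ?funenegE patchE /f indicE /=; case: (_ \in _);
    rewrite ?mulr1 ?mulr0.
apply: emeasurable_funB.
  apply: (@measurable_fun_fubini_tonelli_F _ _ _ _ _ mu) => //.
  exact: measurable_funepos.
apply: (@measurable_fun_fubini_tonelli_F _ _ _ _ _ mu) => //.
exact: measurable_funeneg.
Qed.

End JointContinuity.

(** * Monotonicity from increments, and primitives *)


Section Increments.
Context {R : realType}.
Notation mu := (@lebesgue_measure R).

(** Over a fine subdivision the increments of [F] add up to at most an
    arbitrarily small multiple of the increment of [W]. This serves for
    primitives of integrable functions and for the energy, where derivatives
    are not at hand. *)
Lemma nonincreasing_of_increments (F W : R -> R) (a b : R) : a <= b ->
  (forall e, 0 < e -> exists2 d, 0 < d & forall s t, a <= s -> s < t -> t <= b ->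
     t - s < d -> F t - F s <= e * (W t - W s)) ->
  F b <= F a.
Proof.
move=> ab FW; have [->//|anb] := eqVneq a b.
have ltab : a < b by rewrite lt_neqAle anb.
have step e : 0 < e -> F b - F a <= e * (W b - W a).
  move=> e0; have [d d0 Fd] := FW e e0.
  have [N N0 bN] : exists2 N, (0 < N)%N & (b - a) / N%:R < d.
    exists (Num.truncn ((b - a) / d)).+1 => //.
    by rewrite ltr_pdivrMr// mulrC -ltr_pdivrMr// truncnS_gt.
  pose p i := a + i%:R * ((b - a) / N%:R).
  have l0 : 0 < (b - a) / N%:R by rewrite divr_gt0 ?subr_gt0 ?ltr0n.
  have pN : p N = b by rewrite /p mulrC divfK ?pnatr_eq0 -?lt0n// addrC subrK.
  have H i : (i <= N)%N -> F (p i) - F a <= e * (W (p i) - W a).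
    elim: i => [_|i IH iN]; first by rewrite /p mul0r addr0 !subrr mulr0.
    have pS : p i.+1 = p i + (b - a) / N%:R by rewrite /p -natr1 mulrDl mul1r addrA.
    have h : F (p i.+1) - F (p i) <= e * (W (p i.+1) - W (p i)).
      apply: Fd; last by rewrite pS addrC addKr.
      - by rewrite /p lerDl mulr_ge0// ltW.
      - by rewrite pS ltrDl.
      - by rewrite -pN /p lerD2l ler_wpM2r ?ler_nat// ltW.
    by have := IH (ltnW iN); lra.
  by have := H N (leqnn N); rewrite pN.
rewrite -subr_le0; apply/ler_addgt0Pr => e e0; rewrite add0r.
have [K0|K0] := leP (W b - W a) 0.
  by apply: le_trans (step 1 ltr01) _; rewrite mul1r; lra.
by have := step _ (divr_gt0 e0 K0); rewrite divfK// gt_eqF.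
Qed.

(** A primitive of a continuous function on the whole line; Lebesgue integrals
    are unsigned, hence the two terms. *)
Definition prim (f : R -> R) (x : R) : R :=
  \int[mu]_(y in `]0, x]) f y - \int[mu]_(y in `]x, 0]) f y.

Lemma Rintegral_itv_split (f : R -> R) (a b c : R) : continuous f ->
  a <= b -> b <= c -> \int[mu]_(y in `]a, c]) f y =
  \int[mu]_(y in `]a, b]) f y + \int[mu]_(y in `]b, c]) f y.
Proof.
move=> cf ab bc.
rewrite -(@Rintegral_itvB _ f (BRight a) (BRight c) b) ?bnd_simp//.
  by rewrite addrC subrK.
exact: continuous_integrable_itv.
Qed.

Lemma is_derive_prim (f : R -> R) (x : R) : continuous f ->
  is_derive x 1 (prim f) (f x).
Proof.
move=> cf; pose a := Num.min x 0 - 1.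
have [a0 ax] : a < 0 /\ a < x by rewrite /a; case: (ltP x 0) => ?; split; lra.
pose G y := \int[mu]_(t in `]a, y]) f t.
have primE y : a < y -> prim f y = G y - G 0.
  move=> ay; rewrite /prim /G; have [y0|y0] := leP 0 y.
    rewrite (@Rintegral_itv_split f a 0 y) ?(ltW a0)//.
    rewrite [`]y, 0]%classic](_ : _ = set0) ?Rintegral_set0; first by ring.
    by rewrite set_itv_ge// bnd_simp -leNgt.
  rewrite (@Rintegral_itv_split f a y 0) ?(ltW y0) ?(ltW ay)//.
  rewrite [`]0, y]%classic](_ : _ = set0) ?Rintegral_set0; first by ring.
  by rewrite set_itv_ge// bnd_simp -leNgt ltW.
have [dG GE] : derivable G x 1 /\ derive1 G x = f x.
  apply: (@continuous_FTC1 _ f (BRight a) x (x + 1)); rewrite ?ltrDl ?bnd_simp//.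
  - exact: continuous_integrable_itv.
  - exact: cf.
have h : is_derive x 1 (fun y => G y + cst (- G 0) y) (f x).
  rewrite -[f x]addr0; apply: (@is_derive1D R G (cst (- G 0)) x).
  by split => //; rewrite -GE derive1E.
apply: (@near_eq_is_derive _ _ _ (fun y => G y + cst (- G 0) y)) h => //.
by near=> y; rewrite primE//; near: y; exact: lt_nbhsr.
Unshelve. all: by end_near. Qed.

Lemma derive0_eq (F : R -> R) (x y : R) : (forall z : R, is_derive z 1 F 0) ->
  F x = F y.
Proof. by move=> dF; exact: is_derive_0_is_cst. Qed.

End Increments.

(** * Periodic test functions *)


Section TestFunctions.
Context {R : realType}.
Notation mu := (@lebesgue_measure R).

Lemma C1_torus_is_derive (f f' : R -> R) : periodic1 f ->
  (forall x : R, is_derive x 1 f (f' x)) -> continuous f' ->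
  C1_torus f /\ derive1 f = f'.
Proof.
move=> pf df cf'.
have E : derive1 f = f' by apply/funext => x; rewrite derive1E; case: (df x).
by split => //; split => //; rewrite E.
Qed.

Lemma is_derive_C1_torus (f : R -> R) : C1_torus f ->
  forall x : R, is_derive x 1 f (derive1 f x).
Proof. by move=> [_ df _] x; split; [exact: df|rewrite derive1E]. Qed.

(** On the fundamental domain this trigonometric product is positive exactly
    between its zeros [s] and [t]; it is 1-periodic because both factors change
    sign, so no periodization of a bump function is needed. *)
Definition arc (s t x : R) : R := sin (pi * (x - s)) * sin (pi * (t - x)).

Lemma periodic1_arc s t : periodic1 (arc s t).
Proof.
move=> x; rewrite /arc.
have -> : pi * (x + 1 - s) = pi * (x - s) + pi by ring.
have -> : pi * (t - (x + 1)) = pi * (t - x) - pi by ring.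
rewrite sinDpi; have := sinDpi (pi * (t - x) - pi); rewrite subrK => ->; ring.
Qed.

Lemma arc_gt0 (s t x : R) : 0 <= s -> s < t -> t <= 1 -> 0 < x <= 1 ->
  (0 < arc s t x) = (s < x < t).
Proof.
move=> s0 st t1 /andP[x0 x1]; rewrite /arc.
have pi0 := @pi_gt0 R.
have spos (y : R) : 0 < y < 1 -> 0 < sin (pi * y).
  move=> /andP[y0 y1]; apply: sin_gt0_pi.
  apply/andP; split; nra.
have snneg (y : R) : 0 <= y <= 1 -> 0 <= sin (pi * y).
  move=> /andP[y0 y1]; apply: sin_ge0_pi.
  apply/andP; split; nra.
have snpos (y : R) : - 1 <= y <= 0 -> sin (pi * y) <= 0.
  by move=> y01; rewrite -[y]opprK mulrN sinN oppr_le0; apply: snneg; lra.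
apply/idP/idP => [|/andP[sx xt]]; last first.
  by rewrite mulr_gt0// spos//; apply/andP; split; lra.
apply: contraTT; rewrite negb_and -!leNgt => /orP[xs|tx].
- by rewrite mulr_le0_ge0 ?snpos ?snneg//; apply/andP; split; lra.
- by rewrite mulr_ge0_le0 ?snpos ?snneg//; apply/andP; split; lra.
Qed.

Definition bump (s t x : R) : R := possq (arc s t x).

Lemma bump_ge0 s t x : 0 <= bump s t x.
Proof. exact: sqr_ge0. Qed.

Lemma bump_gt0 (s t x : R) : 0 <= s -> s < t -> t <= 1 -> 0 < x <= 1 ->
  (0 < bump s t x) = (s < x < t).
Proof.
move=> s0 st t1 x01; rewrite -(arc_gt0 s0 st t1 x01) /bump /possq.
rewrite lt_neqAle sqr_ge0 andbT eq_sym sqrf_eq0.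
by case: (lerP (arc s t x) 0) => [|a0]; rewrite ?eqxx// gt_eqF.
Qed.

Definition darc (s t x : R) : R :=
  pi * cos (pi * (x - s)) * sin (pi * (t - x)) -
  sin (pi * (x - s)) * (pi * cos (pi * (t - x))).

Lemma is_derive_arc s t (x : R) : is_derive x 1 (arc s t) (darc s t x).
Proof.
have daff (a b : R) : is_derive x 1 (fun y => a * y + b) a.
  apply: (is_derive_eq (is_derive1D
    (is_derive1Zl a (is_derive_id x 1)) (is_derive_cst b x 1))).
  by rewrite addr0 mulr1.
have d1 : is_derive x 1 (fun y => sin (pi * (y - s))) (cos (pi * (x - s)) * pi).
  rewrite (_ : (fun y => _) = fun y => sin (pi * y + - (pi * s))); last first.
    by apply/funext => y; congr sin; ring.
  rewrite (_ : pi * (x - s) = pi * x + - (pi * s)); last by ring.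
  exact: (is_derive1c (is_derive_sin _) (daff _ _)).
have d2 : is_derive x 1 (fun y => sin (pi * (t - y))) (cos (pi * (t - x)) * - pi).
  rewrite (_ : (fun y => _) = fun y => sin (- pi * y + pi * t)); last first.
    by apply/funext => y; congr sin; ring.
  rewrite (_ : pi * (t - x) = - pi * x + pi * t); last by ring.
  exact: (is_derive1c (is_derive_sin _) (daff _ _)).
apply: (is_derive_eq (is_derive1M d1 d2)).
by rewrite /darc; ring.
Qed.

Lemma continuous_darc s t : continuous (darc s t).
Proof.
have caff (a b : R) : continuous (fun x : R => a * x + b).
  by move=> x; apply: cvgD; [apply: cvgM; [exact: cvg_cst|exact: cvg_id]|exact: cvg_cst].
have cc (a b : R) : continuous (fun x : R => cos (a * x + b)).
  move=> x; apply: (@continuous_comp _ _ _ (fun x : R => a * x + b) cos).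
    exact: caff.
  exact: continuous_cos.
have cs (a b : R) : continuous (fun x : R => sin (a * x + b)).
  move=> x; apply: (@continuous_comp _ _ _ (fun x : R => a * x + b) sin).
    exact: caff.
  exact: continuous_sin.
rewrite (_ : darc s t = fun x => pi * cos (pi * x + - (pi * s)) *
   sin (- pi * x + pi * t) - sin (pi * x + - (pi * s)) *
   (pi * cos (- pi * x + pi * t))); last first.
  apply/funext => x; rewrite /darc.
  have -> : pi * (x - s) = pi * x + - (pi * s) by ring.
  by have -> : pi * (t - x) = - pi * x + pi * t by ring.
move=> x; apply: cvgB; apply: cvgM.
- by apply: cvgM; [exact: cvg_cst|exact: cc].
- exact: cs.
- exact: cs.
- by apply: cvgM; [exact: cvg_cst|exact: cc].
Qed.

Definition dbump (s t x : R) : R := 2 * Num.max (arc s t x) 0 * darc s t x.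

Lemma is_derive_bump s t (x : R) : is_derive x 1 (bump s t) (dbump s t x).
Proof.
by apply: is_derive1c; [exact: is_derive_possq|exact: is_derive_arc].
Qed.

Lemma continuous_dbump s t : continuous (dbump s t).
Proof.
move=> x; apply: cvgM; last exact: continuous_darc.
apply: cvgM; first exact: cvg_cst.
apply: (@continuous_comp _ _ _ (arc s t) (fun y : R => Num.max y 0)).
  exact: continuous_is_derive (is_derive_arc s t) x.
exact: continuous_pospart.
Qed.

Lemma periodic1_bump s t : periodic1 (bump s t).
Proof. by move=> x; rewrite /bump periodic1_arc. Qed.

Lemma C1_torus_bump s t : C1_torus (bump s t).
Proof.
have [] // := C1_torus_is_derive (@periodic1_bump s t) (is_derive_bump s t).
exact: continuous_dbump.
Qed.

(** These test functions increase to the indicator of the arc as [n] grows. *)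
Definition plateau (n : nat) (s t x : R) : R := 1 - (1 + n%:R * bump s t x)^-1.

Lemma C1_torus_plateau n s t : C1_torus (plateau n s t).
Proof.
have den0 x : 0 < 1 + n%:R * bump s t x.
  by rewrite ltr_wpDr// mulr_ge0// bump_ge0.
pose d x := - (- (1 + n%:R * bump s t x) ^- 2 * (n%:R * dbump s t x)).
have dd (x : R) : is_derive x 1 (fun y => 1 + n%:R * bump s t y) (n%:R * dbump s t x).
  have h := is_derive1Zl n%:R (is_derive_bump s t x).
  apply: (is_derive_eq (is_derive1D (is_derive_cst (1 : R) x 1) h)).
  by rewrite add0r.
suff [pd cd] : (forall x : R, is_derive x 1 (plateau n s t) (d x)) /\ continuous d.
  have [] // := @C1_torus_is_derive (plateau n s t) d _ pd cd.
  by move=> x; rewrite /plateau periodic1_bump.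
split.
- move=> x; have h : is_derive x 1 (fun y => (1 + n%:R * bump s t y)^-1)
      (- (1 + n%:R * bump s t x) ^- 2 * (n%:R * dbump s t x)).
    have g0 : (fun y => 1 + n%:R * bump s t y) x != 0 by rewrite gt_eqF.
    by apply: (is_derive_eq (is_deriveV (f := fun y => 1 + n%:R * bump s t y) g0 (dd x))).
  apply: (is_derive_eq (is_derive1D (is_derive_cst (1 : R) x 1) (is_derive1N h))).
  by rewrite add0r.
- have cb := continuous_is_derive (is_derive_bump s t).
  move=> x; apply: cvgN; apply: cvgM; last first.
    by apply: cvgM; [exact: cvg_cst|exact: continuous_dbump].
  apply: cvgN; apply: cvgV; first by rewrite expf_neq0// gt_eqF.
  have c1 : (1 + n%:R * bump s t y) @[y --> x] --> 1 + n%:R * bump s t x.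
    apply: cvgD; first exact: cvg_cst.
    by apply: cvgM; [exact: cvg_cst|exact: cb].
  by rewrite expr2; apply: cvgM; exact: c1.
Qed.

Lemma plateau_itv01 n s t x : 0 <= plateau n s t x <= 1.
Proof.
have b0 : 0 <= n%:R * bump s t x by rewrite mulr_ge0// bump_ge0.
rewrite /plateau subr_ge0 gerBl invr_ge0 invf_le1 ?ltr_wpDr// lerDl b0 /=.
by rewrite addr_ge0.
Qed.

Lemma cvg_plateau (s t x : R) : 0 <= s -> s < t -> t <= 1 -> 0 < x <= 1 ->
  (fun n => plateau n s t x) @ \oo --> (\1_(`]s, t[%classic) x : R).
Proof.
move=> s0 st t1 x01; have := bump_gt0 s0 st t1 x01.
rewrite indicE [x \in _](_ : _ = (s < x < t)); last first.
  by apply/idP/idP; rewrite ?inE /= in_itv.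
case: (s < x < t) => b; last first.
  have b0 : bump s t x = 0.
    by apply/eqP; rewrite eq_le bump_ge0 andbT leNgt b.
  rewrite /plateau b0; under eq_fun do rewrite mulr0 addr0 invr1 subrr.
  exact: cvg_cst.
rewrite /plateau /= -[X in _ --> X]subr0; move: (bump s t x) b => p b.
apply: cvgB; first exact: cvg_cst.
apply/cvgrPdist_le => e e0; near=> n.
rewrite sub0r normrN ger0_norm; last by rewrite invr_ge0 addr_ge0// mulr_ge0// ltW.
have np0 : 0 <= n%:R * p by rewrite mulr_ge0// ltW.
rewrite -[leRHS]invrK lef_pV2 ?posrE ?invr_gt0 ?ltr_wpDr//.
by rewrite ler_wpDl// -ler_pdivrMr//; near: n; exact: nbhs_infty_ger.
Unshelve. all: by end_near. Qed.

End TestFunctions.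

(** * The fundamental lemma on the torus *)


Section Clamp.
Context {R : realType}.

Definition clamp (a b x : R) : R := Num.max a (Num.min x b).

Lemma clamp_itv (a b x : R) : a <= b -> a <= clamp a b x <= b.
Proof. by move=> ab; rewrite /clamp le_max lexx/= ge_max ab ge_min lexx orbT. Qed.

Lemma clamp_id (a b x : R) : a <= x <= b -> clamp a b x = x.
Proof. by move=> /andP[ax xb]; rewrite /clamp (min_idPl xb) (max_idPr ax). Qed.

Lemma continuous_clamp (a b : R) : continuous (clamp a b).
Proof.
move=> x.
apply: (@continuous_max R _ (fun=> a) (fun y => Num.min y b)); first exact: cvg_cst.
apply: (@continuous_min R _ (fun y => y) (fun=> b)); first exact: cvg_id.
exact: cvg_cst.
Qed.

Lemma continuous_comp_clamp (f : R -> R) (a b : R) : a <= b ->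
  {within `[a, b], continuous f} -> continuous (fun x => f (clamp a b x)).
Proof.
move=> ab cf x.
have cx : clamp a b x \in `[a, b] by rewrite in_itv /= clamp_itv.
apply: (@cvg_comp _ _ _ (clamp a b) f (nbhs x)
    (within [set` `[a, b]] (nbhs (clamp a b x)))); last first.
  by have /subspace_continuousP := cf; apply.
move=> A /= [e /= e0 eA]; have : \forall y \near x, ball (clamp a b x) e (clamp a b y).
  by have /cvgrPdist_lt := @continuous_clamp a b x; apply.
by apply: filterS => y /eA; apply; rewrite /= in_itv /= clamp_itv.
Qed.

End Clamp.

Section FundamentalLemma.
Context {R : realType}.
Notation mu := (@lebesgue_measure R).

Lemma integrable_mulr (D : set R) (k h : R -> R) (N : R) : measurable D ->
  mu.-integrable D (EFin \o k) -> measurable_fun D h ->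
  (forall x, D x -> `|h x| <= N) ->
  mu.-integrable D (EFin \o (fun x => k x * h x)).
Proof.
move=> mD ik mh hN.
rewrite (_ : _ \o _ = ((EFin \o k) \* (EFin \o h))%E); last exact/funext.
apply: integrableMl => //; exists N; split; first exact: num_real.
by move=> M NM x Dx; exact: le_trans (hN _ Dx) (ltW NM).
Qed.

Lemma integrable_mulr_continuous (k h : R -> R) :
  mu.-integrable torus (EFin \o k) -> continuous h ->
  mu.-integrable torus (EFin \o (fun x => k x * h x)).
Proof.
move=> ik ch; have [N _ hN] := jcont_bound 0 0 (jcont_x ch).
apply: (@integrable_mulr _ _ _ N) => //.
  by apply: measurable_funTS; exact: continuous_measurable_fun.
move=> x; rewrite /torus /= in_itv /= => /andP[/ltW x0 x1].
by apply: (hN 0); rewrite ?lexx// x0.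
Qed.

Lemma itv_sub_torus (a b : R) : 0 <= a -> b <= 1 -> `]a, b] `<=` (@torus R).
Proof. by move=> a0 b1; apply: subset_itv; rewrite bnd_simp. Qed.

Lemma integrable_sub_torus (f : R -> R) (a b : R) : 0 <= a -> b <= 1 ->
  mu.-integrable torus (EFin \o f) -> mu.-integrable `]a, b] (EFin \o f).
Proof. by move=> a0 b1; apply: integrableS => //; exact: itv_sub_torus. Qed.

(** The plateaus of an arc starting at 0 are test functions that converge,
    dominatedly, to the indicator of the interval. *)
Lemma Rintegral_prefix (f : R -> R) (t : R) : 0 < t -> t <= 1 ->
  mu.-integrable torus (EFin \o f) ->
  (forall phi, C1_torus phi -> \int[mu]_(x in torus) (f x * phi x) = 0) ->
  \int[mu]_(x in `]0, t]) f x = 0.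
Proof.
move=> t0 t1 fi fphi.
have cp n : continuous (plateau n 0 t).
  by case: (C1_torus_plateau n 0 t) => _ d _; apply: continuous_is_derive => x;
    apply: is_derive_C1_torus; exact: C1_torus_plateau.
have fip n := integrable_mulr_continuous fi (cp n).
have mfi : measurable_fun torus f by case/integrableP : fi => /measurable_EFinP.
pose g (x : R) := f x * \1_(`]0, t[%classic) x.
have mg : measurable_fun torus g.
  apply: measurable_funM => //; apply: measurable_funTS.
have cvgi : (fun n => \int[mu]_(x in torus) (f x * plateau n 0 t x)%:E)%E @ \oo
    --> (\int[mu]_(x in torus) (g x)%:E)%E.
  apply: (@dominated_cvg _ _ _ mu torus _ _ _ (fun x => `|f x|%:E)) => //.
  - by move=> n; case/integrableP : (fip n).
  - move=> x tx; apply: cvg_EFin; first by near=> n.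
    have x01 : 0 < x <= 1 by move: tx; rewrite /torus /= in_itv.
    apply: cvgM; first exact: cvg_cst.
    exact: cvg_plateau.
  - exact: integrable_norm.
  - move=> n x _; rewrite lee_fin normrM ler_piMr//.
    by have /andP[? ?] := plateau_itv01 n 0 t x; rewrite ger0_norm.
have int0 n : (\int[mu]_(x in torus) (f x * plateau n 0 t x)%:E)%E = 0%E.
  rewrite -[LHS]fineK; last by apply: integrable_fin_num => //; exact: fip n.
  by have := fphi _ (C1_torus_plateau n 0 t); rewrite /Rintegral => ->.
have {}cvgi : (\int[mu]_(x in torus) (g x)%:E)%E = 0%E.
  move: cvgi; rewrite (_ : (fun n => _) = cst 0%E); last exact/funext.
  by move/(cvg_lim (@ereal_hausdorff R)) => <-; rewrite lim_cst.
rewrite -Rintegral_itv_bndo_bndc; last first.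
  by apply: integrableS fi => //; apply: subset_itv; rewrite bnd_simp.
have E : torus `&` `]0, t[ = `]0, t[%classic :> set R.
  by apply/setIidr; apply: subset_itv; rewrite bnd_simp.
rewrite -E Rintegral_mkcondr /Rintegral.
rewrite [X in fine X](_ : _ = 0%E)//; rewrite -[RHS]cvgi; apply: eq_integral => x _.
by rewrite /g patchE indicE; case: (_ \in _); rewrite ?mulr1 ?mulr0.
Unshelve. all: by end_near. Qed.

(** The primitive of [f] vanishes on the unit interval, hence so does [f] at
    its Lebesgue points. *)
Lemma torus_ae0 (f : R -> R) : mu.-integrable torus (EFin \o f) ->
  (forall phi, C1_torus phi -> \int[mu]_(x in torus) (f x * phi x) = 0) ->
  {ae mu, forall x, torus x -> f x = 0}.
Proof.
move=> fi fphi.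
pose k := f \_ torus.
have ki : mu.-integrable setT (EFin \o k).
  by rewrite -restrict_EFin; apply/integrable_restrict => //; rewrite setTI.
have lk : locally_integrable setT k by exact: open_integrable_locally openT ki.
have kia (y : R) : mu.-integrable [set` Interval (BRight 0) (BRight y)] (EFin \o k).
  by apply: integrableS ki.
have h1 : {ae mu, forall x, x != 1 :> R}.
  exists [set 1]; split => //; first exact: lebesgue_measure_set1.
  by move=> x /= /negP; rewrite negbK => /eqP.
have /= h2 := FTC1 kia lk.
apply: (@filterS2 _ _ (ae_filter_ringOfSetsType mu) _ _ _ _ h1 h2) => x x1 dF tx.
have /andP[x0 xle1] : 0 < x <= 1 by move: tx; rewrite /torus /= in_itv.
have xlt1 : x < 1 by rewrite lt_neqAle x1.
have [_] := dF x0.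
rewrite {2}/k patchE mem_set// => <-.
rewrite derive1E (near_eq_derive _ (g := cst 0)) ?derive_cst//.
near=> y; have y0 : 0 < y by near: y; exact: lt_nbhsr.
have y1 : y < 1 by near: y; exact: lt_nbhsl.
rewrite /= -[RHS](Rintegral_prefix y0 (ltW y1) fi fphi).
apply: eq_Rintegral => z; rewrite inE /= in_itv /= => /andP[z0 zy].
by rewrite /k patchE mem_set// /torus /= in_itv /= z0 (le_trans zy (ltW y1)).
Unshelve. all: by end_near. Qed.

End FundamentalLemma.

(** * Periodization and primitives of integrable functions *)


Section Periodize.
Context {R : realType}.

Definition periodize (f : R -> R) (x : R) : R := f (x - (Num.floor x)%:~R).

Lemma floorD1 (x : R) : Num.floor (x + 1) = Num.floor x + 1.
Proof.
apply: floor_def; have := floor_itv x; rewrite !intrD; lra.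
Qed.

Lemma periodic1_periodize f : periodic1 (periodize f).
Proof. by move=> x; rewrite /periodize floorD1 intrD; congr f; ring. Qed.

Lemma periodize_itv f (x : R) : f 0 = f 1 -> 0 <= x <= 1 -> periodize f x = f x.
Proof.
move=> f01 /andP[x0 x1]; rewrite /periodize; have [->|xn1] := eqVneq x 1.
  have -> : Num.floor (1 : R) = 1 by apply: floor_def; rewrite lexx /= intrD ltrDl.
  by rewrite subrr.
have -> : Num.floor x = 0 by apply: floor_def; rewrite x0 /= lt_neqAle xn1.
by rewrite subr0.
Qed.

(** Near any point the periodization of a function supported in the unit
    interval is a sum of two translates. *)
Lemma continuous_periodize (f : R -> R) : continuous f ->
  (forall x, x <= 0 -> f x = 0) -> (forall x, 1 <= x -> f x = 0) ->
  continuous (periodize f).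
Proof.
move=> cf f0 f1 x; pose n : R := (Num.floor x)%:~R.
have /andP[nx xn] : n <= x < n + 1 by have := floor_itv x; rewrite intrD.
have E (y : R) : n - 1 < y -> y < n + 1 -> periodize f y = f (y - n) + f (y + (1 - n)).
  move=> ny yn; rewrite /periodize; have [h|h] := leP n y.
    rewrite (_ : Num.floor y = Num.floor x); last first.
      by apply: floor_def; rewrite intrD; apply/andP.
    by rewrite [X in _ = _ + X]f1 ?addr0// -/n; lra.
  rewrite (_ : Num.floor y = Num.floor x - 1); last first.
    apply: floor_def; rewrite subrK intrB -/n h andbT; exact: ltW.
  rewrite [X in _ = X + _]f0; last by lra.
  by rewrite add0r intrB -/n; congr f; ring.
have cE : {for x, continuous (fun y => f (y - n) + f (y + (1 - n)))}.
  have caff (a : R) : {for x, continuous (fun y => f (y + a))}.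
    apply: (@continuous_comp _ _ _ (fun y : R => y + a) f); last exact: cf.
    by apply: cvgD; [exact: cvg_id|exact: cvg_cst].
  by apply: cvgD; exact: caff.
rewrite /continuous_at E//; last by lra.
apply: cvg_trans cE; apply: near_eq_cvg; near=> y; apply/esym/E.
  by near: y; apply: lt_nbhsr; lra.
by near: y; exact: lt_nbhsl.
Unshelve. all: by end_near. Qed.

End Periodize.

Section Prefix.
Context {R : realType}.
Notation mu := (@lebesgue_measure R).

Definition prefix (k : R -> R) (x : R) : R := \int[mu]_(y in `]0, clamp 0 1 x]) k y.

Lemma prefix_itv k (x : R) : 0 <= x <= 1 ->
  prefix k x = \int[mu]_(y in `]0, x]) k y.
Proof. by move=> x01; rewrite /prefix clamp_id. Qed.

Lemma prefix_le0 k (x : R) : x <= 0 -> prefix k x = 0.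
Proof.
move=> x0; rewrite /prefix /clamp (min_idPl _) ?(le_trans x0)// (max_idPl _)//.
by rewrite set_itv_ge ?Rintegral_set0// bnd_simp ltxx.
Qed.

Lemma prefix_ge1 k (x : R) : 1 <= x -> prefix k x = \int[mu]_(y in torus) k y.
Proof. by move=> x1; rewrite /prefix /clamp (min_idPr x1) (max_idPr _). Qed.

Lemma prefix_sub k (s t : R) : mu.-integrable torus (EFin \o k) ->
  0 <= s -> s <= t -> t <= 1 ->
  prefix k t - prefix k s = \int[mu]_(y in `]s, t]) k y.
Proof.
move=> ik s0 st t1; rewrite !prefix_itv ?s0 ?t1 ?(le_trans s0 st) ?(le_trans st t1)//.
by apply: Rintegral_itvB; rewrite ?bnd_simp//; exact: integrable_sub_torus.
Qed.

Lemma continuous_prefix k : mu.-integrable torus (EFin \o k) ->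
  continuous (prefix k).
Proof.
move=> ik; pose k' := k \_ torus.
have ki : mu.-integrable setT (EFin \o k').
  by rewrite -restrict_EFin; apply/integrable_restrict => //; rewrite setTI.
have kia (i : interval R) : mu.-integrable [set` i] (EFin \o k').
  by apply: integrableS ki.
have E x : 0 <= x <= 1 ->
    \int[mu]_(y in `]0, x]) k y = parameterized_integral mu 0 x k'.
  move=> /andP[x0 x1]; rewrite /parameterized_integral -Rintegral_itv_obnd_cbnd//.
  apply: eq_Rintegral => y; rewrite inE /= in_itv /= => /andP[y0 yx].
  by rewrite /k' patchE mem_set// /torus /= in_itv /= y0 (le_trans yx).
rewrite (_ : prefix k = fun x => parameterized_integral mu 0 (clamp 0 1 x) k').
  apply: (@continuous_comp_clamp _ (fun x => parameterized_integral mu 0 x k') 0 1 ler01).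
  exact: parameterized_integral_continuous.
by apply/funext => x; rewrite /prefix E// clamp_itv.
Qed.

(** Integration by parts against the primitive of a merely integrable function:
    both sides have the same increments up to an arbitrarily small multiple of
    those of the primitive of the modulus. *)
Lemma IBP_prefix (k phi phi' : R -> R) : mu.-integrable torus (EFin \o k) ->
  (forall x : R, is_derive x 1 phi (phi' x)) -> continuous phi' ->
  \int[mu]_(x in torus) (prefix k x * phi' x + k x * phi x) =
  (\int[mu]_(x in torus) k x) * phi 1.
Proof.
move=> ik dphi cphi'.
have cphi := continuous_is_derive dphi; have cH := continuous_prefix ik.
have iHp : mu.-integrable torus (EFin \o (fun x => prefix k x * phi' x)).
  by apply: continuous_integrable_torus => x; apply: cvgM; [exact: cH|exact: cphi'].
have ikp := integrable_mulr_continuous ik cphi.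
pose g x := prefix k x * phi' x + k x * phi x.
have ig : mu.-integrable torus (EFin \o g) by exact: integrable_addr.
pose G x := prefix k x * phi x - prefix g x.
have [N N0 phiN] := jcont_bound 0 0 (jcont_x cphi').
have iabs : mu.-integrable torus (EFin \o (fun x => `|k x| + N)).
  apply: integrable_addr => //; first exact: integrable_norm.
  by apply: continuous_integrable_torus => x; exact: cvg_cst.
pose W := prefix (fun x => `|k x| + N).
have key e : 0 < e -> exists2 d, 0 < d & forall s t, 0 <= s -> s < t -> t <= 1 ->
    t - s < d -> `|G t - G s| <= e * (W t - W s).
  move=> e0.
  have [d1 d10 Hphi] := jcont_unif 0 1 (jcont_t cphi) e0.
  have [d2 d20 HH] := jcont_unif 0 1 (jcont_t cH) e0.
  exists (Num.min d1 d2); first by rewrite lt_min d10.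
  move=> s t s0 st t1; rewrite lt_min => /andP[td1 td2].
  have st' := ltW st.
  have isub f : mu.-integrable torus (EFin \o f) -> mu.-integrable `]s, t] (EFin \o f).
    exact: integrable_sub_torus.
  have icst f c : mu.-integrable `]s, t] (EFin \o f) ->
      mu.-integrable `]s, t] (EFin \o (fun x => c * f x)).
    by move=> fi; exact: integrable_scalerl.
  pose q x := (phi t * k x - k x * phi x) + (prefix k s * phi' x - prefix k x * phi' x).
  have i1 : mu.-integrable `]s, t] (EFin \o (fun x => phi t * k x)) by exact/icst/isub.
  have i3 : mu.-integrable `]s, t] (EFin \o phi') by exact: continuous_integrable_itv.
  have i2 : mu.-integrable `]s, t] (EFin \o (fun x => prefix k s * phi' x)) by exact/icst.
  have iq : mu.-integrable `]s, t] (EFin \o q).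
    by apply: integrable_addr => //; apply: integrable_subr => //; exact: isub.
  have -> : G t - G s = \int[mu]_(x in `]s, t]) q x.
    rewrite /q RintegralD//; last 2 first.
    - by apply: integrable_subr => //; exact: isub.
    - by apply: integrable_subr => //; exact: isub.
    rewrite !RintegralB ?RintegralZl//; try exact: isub.
    rewrite -(prefix_sub ik)// (FTC_itv _ _ st' dphi cphi').
    have := prefix_sub ig s0 st' t1; rewrite /g RintegralD//; try exact: isub.
    by rewrite /G => h; lra.
  rewrite /W prefix_sub// -RintegralZl//; last exact: isub.
  apply: le_trans (le_normr_Rintegral _ iq) _ => //.
  apply: le_Rintegral => //; [exact: integrable_norm|exact/icst/isub|].
  move=> x /=; rewrite in_itv /= => /andP[sx xt].
  have x01 : 0 <= x <= 1 by rewrite (le_trans s0 (ltW sx)) (le_trans xt t1).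
  have h1 : `|phi t - phi x| <= e.
    apply: (Hphi t x 0); rewrite ?lexx ?ler01//.
      by rewrite t1 (le_trans s0 st').
    by rewrite ger0_norm ?subr_ge0//; lra.
  have h2 : `|prefix k s - prefix k x| <= e.
    apply: (HH s x 0); rewrite ?lexx ?ler01//.
      by rewrite s0 (le_trans st' t1).
    by rewrite distrC ger0_norm ?subr_ge0 ?(ltW sx)//; lra.
  have h3 : `|phi' x| <= N by apply: (phiN 0) => //; rewrite lexx.
  have -> : q x = (phi t - phi x) * k x + (prefix k s - prefix k x) * phi' x.
    by rewrite /q; ring.
  apply: le_trans (ler_normD _ _) _; rewrite mulrDr !normrM.
  by apply: lerD; apply: ler_pM.
have Gle (b : bool) : (-1) ^+ b * G 1 <= (-1) ^+ b * G 0.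
  apply: (nonincreasing_of_increments (F := fun x => (-1) ^+ b * G x) (W := W) ler01).
  move=> e e0; have [d d0 Gd] := key e e0; exists d => // s t s0 st t1 td.
  rewrite -mulrBr; apply: le_trans (Gd _ _ s0 st t1 td).
  by rewrite (le_trans (ler_norm _))// normrM normr_sign mul1r.
have GE : G 1 = G 0.
  by have := Gle false; have := Gle true; rewrite expr0 expr1; lra.
move: GE; rewrite /G !(@prefix_le0 _ 0)// !(@prefix_ge1 _ 1)// => GE.
rewrite -/(g _); lra.
Qed.

End Prefix.

(** * Norms on the torus *)


Section TorusNorm.
Context {R : realType}.
Notation mu := (@lebesgue_measure R).
Notation nu := (mrestr (@lebesgue_measure R) measurable_torus).

Lemma integral_mrestr (D : set R) (mD : measurable D) (f : R -> \bar R) :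
  measurable_fun setT f -> (forall x, 0 <= f x)%E ->
  (\int[mrestr mu mD]_x f x = \int[mu]_(x in D) f x)%E.
Proof.
move=> mf f0; rewrite -(setUv D) ge0_integral_setU//; last 3 first.
- exact: measurableC.
- by apply: measurable_funTS.
- exact/disj_setPCl.
have -> : (\int[mrestr mu mD]_(x in D) f x = \int[mu]_(x in D) f x)%E.
  rewrite (@eq_measure_integral _ _ _ _ mu)// => A _ AD.
  by transitivity (mu (A `&` D)) => //; rewrite (setIidl AD).
have -> : (\int[mrestr mu mD]_(x in ~` D) f x = 0)%E.
  rewrite (@eq_measure_integral _ _ _ _ mzero) ?integral_measure_zero// => A _ AD.
  transitivity (mu (A `&` D)) => //.
  have -> : A `&` D = set0 by apply/seteqP; split => // x [/AD nDx Dx]; exact: nDx.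
  by rewrite measure0.
by rewrite adde0.
Qed.

Definition torus_ae (f g : R -> R) := {ae mu, forall x, torus x -> f x = g x}.

Lemma torus_ae_refl f : torus_ae f f.
Proof.
by rewrite /torus_ae; apply: (@filterE _ _ (ae_filter_ringOfSetsType mu)).
Qed.

Lemma torus_ae_sym f g : torus_ae f g -> torus_ae g f.
Proof.
by apply: (@filterS _ _ (ae_filter_ringOfSetsType mu)) => x fg tx; rewrite fg.
Qed.

Lemma torus_norm1E (f : R -> R) : measurable_fun setT f ->
  torus_norm 1%E f = (\int[mu]_(x in torus) `|f x|%:E)%E.
Proof.
move=> mf; rewrite /torus_norm Lnorm1 integral_mrestr//.
by apply: measurableT_comp => //; apply/measurable_EFinP.
Qed.

Lemma torus_norm2E (f : R -> R) : measurable_fun setT f ->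
  torus_norm 2%:E f = ((\int[mu]_(x in torus) (f x ^+ 2)%:E) `^ 2^-1)%E.
Proof.
move=> mf; rewrite /torus_norm unlock /Lnorm.
have E x : (`|(EFin \o f) x| `^ 2 = (f x ^+ 2)%:E)%E.
  by rewrite /= -[2]/(2%:R) powR_mulrn// real_normK// num_real.
under eq_integral do rewrite E; rewrite integral_mrestr//.
- by apply/measurable_EFinP; exact: measurable_funX.
- by move=> x; rewrite lee_fin sqr_ge0.
Qed.

Lemma torus_norm_le12 (f : R -> R) : measurable_fun setT f ->
  (torus_norm 1%E f <= torus_norm 2%:E f)%E.
Proof.
move=> mf; rewrite /torus_norm.
have := @hoelder _ _ _ nu f (cst 1) 2 2 mf (measurable_cst _).
have n1 : ('N[nu]_2%:E[cst 1] = 1)%E.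
  rewrite Lnorm_cst1 [X in (X `^ _)%E](_ : _ = 1%E) ?poweR1r//.
  by transitivity (mu (setT `&` torus)) => //; rewrite setTI torus_measure.
rewrite (_ : EFin \o cst 1%R = cst 1%E)// n1 mule1.
rewrite (_ : f \* cst 1 = f); last by apply/funext => x /=; rewrite mulr1.
by apply => //; field.
Qed.

Lemma torus_norm_ge0 p (f : R -> R) : (0 <= torus_norm p f)%E.
Proof. exact: Lnorm_ge0. Qed.

Lemma eq_torus_norm2 (f g : R -> R) : measurable_fun setT f ->
  measurable_fun setT g -> torus_ae f g -> torus_norm 2%:E f = torus_norm 2%:E g.
Proof.
move=> mf mg fg; rewrite !torus_norm2E//; congr (_ `^ _)%E.
apply: ge0_ae_eq_integral => //.
- by apply: measurable_funTS; apply/measurable_EFinP; exact: measurable_funX.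
- by apply: measurable_funTS; apply/measurable_EFinP; exact: measurable_funX.
- by move=> x _; rewrite lee_fin sqr_ge0.
- by move=> x _; rewrite lee_fin sqr_ge0.
- by apply: (@filterS _ _ (ae_filter_ringOfSetsType mu)) fg => x fg tx; rewrite fg.
Qed.

Lemma Lp1_integrable (f : R -> R) : Lp_torus 1%E f ->
  mu.-integrable torus (EFin \o f).
Proof.
move=> [_ mf]; rewrite torus_norm1E// => fi; apply/integrableP; split => //.
by apply: measurable_funTS; apply/measurable_EFinP.
Qed.

Lemma Lp_measurable p (f : R -> R) : Lp_torus p f -> measurable_fun setT f.
Proof. by case. Qed.

Lemma eq_Rintegral_torus_ae (f g : R -> R) : measurable_fun torus f ->
  measurable_fun torus g -> torus_ae f g ->
  \int[mu]_(x in torus) f x = \int[mu]_(x in torus) g x.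
Proof.
by move=> mf mg fg; exact: eq_Rintegral_ae.
Qed.

Lemma continuous_Lp_torus (f : R -> R) : periodic1 f -> continuous f ->
  Lp_torus 1%E f /\ Lp_torus 2%:E f.
Proof.
move=> pf cf; have mf := continuous_measurable_fun cf.
have n2 : (torus_norm 2%:E f < +oo)%E.
  rewrite torus_norm2E//.
  have fi : mu.-integrable torus (EFin \o (fun x => f x ^+ 2)).
    by apply: continuous_integrable_torus => x; apply: cvgM; exact: cf.
  by rewrite EFin_Rintegral// poweR_EFin ltry.
split; split => //.
exact: le_lt_trans (torus_norm_le12 mf) n2.
Qed.

End TorusNorm.

(** * Weak derivatives on the torus *)


Section WeakDerivative.
Context {R : realType}.
Notation mu := (@lebesgue_measure R).

Lemma is_derive_torus_shift (f : R -> R) (x d : R) :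
  is_derive (x + 1) 1 f d -> is_derive x 1 (fun y => f (y + 1)) d.
Proof.
move=> df.
have h : is_derive x 1 (fun y : R => id y + cst (1 : R) y) (1 + 0).
  exact: (is_derive1D (is_derive_id x 1) (is_derive_cst (1 : R) x 1)).
by apply: (is_derive_eq (is_derive1c (g := fun y => id y + cst (1 : R) y) df h));
  rewrite addr0 mulr1.
Qed.

Lemma periodic1_prim (f : R -> R) : continuous f -> periodic1 f ->
  \int[mu]_(x in torus) f x = 0 -> periodic1 (prim f).
Proof.
move=> cf pf f0 x; apply/eqP; rewrite -subr_eq0.
have dF (z : R) : is_derive z 1 (fun y => prim f (y + 1) + - prim f y) 0.
  have h1 := is_derive_torus_shift (is_derive_prim (z + 1) cf).
  apply: (is_derive_eq (is_derive1D h1 (is_derive1N (is_derive_prim z cf)))).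
  by rewrite pf subrr.
rewrite (derive0_eq x 0 dF) add0r.
have := FTC_itv false false ler01 (fun x => is_derive_prim x cf) cf.
by rewrite -/torus f0 => <-.
Qed.

Lemma C1_torus_prim (f : R -> R) : continuous f -> periodic1 f ->
  \int[mu]_(x in torus) f x = 0 -> C1_torus (prim f) /\ derive1 (prim f) = f.
Proof.
move=> cf pf f0; apply: C1_torus_is_derive => //; first exact: periodic1_prim.
by move=> x; exact: is_derive_prim.
Qed.

Lemma C1_torus_continuous (f : R -> R) : C1_torus f -> continuous f.
Proof. by move=> /is_derive_C1_torus; exact: continuous_is_derive. Qed.

Lemma C1_torus_cst (c : R) : C1_torus (cst c) /\ derive1 (cst c) = cst (0 : R).
Proof.
by apply: C1_torus_is_derive => // x; exact: cvg_cst.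
Qed.

Lemma periodic1_int (f : R -> R) (n : int) x : periodic1 f -> f (x + n%:~R) = f x.
Proof.
move=> pf; have nat_case (m : nat) y : f (y + m%:R) = f y.
  by elim: m => [|m IH]; rewrite ?addr0// -natr1 addrA pf.
case: n => m; first exact: nat_case.
by rewrite NegzE -[LHS](nat_case m.+1) mulrNz subrK.
Qed.

Lemma ceil_shift (x : R) : 0 < x + (1 - Num.ceil x)%:~R <= 1.
Proof. by have := ceil_itv x; rewrite !intrB; lra. Qed.

Lemma periodic1_eq (f g : R -> R) : periodic1 f -> periodic1 g ->
  (forall x, 0 < x <= 1 -> f x = g x) -> f = g.
Proof.
move=> pf pg fg; apply/funext => x.
rewrite -(periodic1_int (1 - Num.ceil x) x pf) -(periodic1_int (1 - Num.ceil x) x pg).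
by apply: fg; exact: ceil_shift.
Qed.

(** Every test function of mean zero is the derivative of a test function,
    hence annihilated by [k]; subtracting the mean of [k] makes it annihilate
    the constants too. *)
Lemma torus_ae_cst (k : R -> R) : mu.-integrable torus (EFin \o k) ->
  (forall phi, C1_torus phi -> \int[mu]_(x in torus) (k x * derive1 phi x) = 0) ->
  torus_ae k (cst (\int[mu]_(x in torus) k x)).
Proof.
move=> ik kphi; set c := \int[mu]_(x in torus) k x.
have icst (a : R) : mu.-integrable torus (EFin \o (fun _ => a)).
  by apply: continuous_integrable_torus => x; exact: cvg_cst.
have h : {ae mu, forall x, torus x -> k x - c = 0}.
  apply: torus_ae0; first exact: integrable_subr.
  move=> psi psi1; have cpsi := C1_torus_continuous psi1.
  have ipsi := continuous_integrable_torus cpsi.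
  set m := \int[mu]_(x in torus) psi x.
  have cm : continuous (fun x => psi x - m).
    by move=> x; apply: cvgB; [exact: cpsi|exact: cvg_cst].
  have [p1 p2] : C1_torus (prim (fun x => psi x - m)) /\
      derive1 (prim (fun x => psi x - m)) = fun x => psi x - m.
    apply: C1_torus_prim => //.
      by move=> x; case: psi1 => ->.
    by rewrite RintegralB// Rintegral_torus_cst subrr.
  have := kphi _ p1; rewrite p2.
  have ikpsi := integrable_mulr_continuous ik cpsi.
  under eq_Rintegral do rewrite mulrBr.
  rewrite RintegralB//; last first.
    by apply: (integrable_mulr_continuous ik) => x; exact: cvg_cst.
  rewrite RintegralZr// -/c => kE.
  under eq_Rintegral do rewrite mulrBl.
  rewrite RintegralB//; last exact: integrable_scalerl.
  by rewrite RintegralZl// -/m; lra.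
by apply: (@filterS _ _ (ae_filter_ringOfSetsType mu)) h => x h tx; apply/eqP;
  rewrite -subr_eq0 h.
Qed.

(** The constant 1 is a test function. *)
Lemma weak_deriv_int0 (f h : R -> R) : is_weak_deriv f h ->
  \int[mu]_(x in torus) h x = 0.
Proof.
move=> [_ _ fh]; have [c1 c2] := C1_torus_cst (1 : R).
have := fh _ c1; rewrite c2.
under eq_Rintegral do rewrite mulr0.
rewrite Rintegral_cst// mul0r => /esym/eqP; rewrite oppr_eq0 => /eqP <-.
by apply: eq_Rintegral => x _; rewrite mulr1.
Qed.

(** The primitive of [h] is periodic because [h] has mean zero, and [h] is also
    its weak derivative; so [f] differs from it by a constant. *)
Lemma weak_deriv_repr (f h : R -> R) : is_weak_deriv f h ->
  exists G, [/\ continuous G, periodic1 G, torus_ae f G &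
    forall x, 0 <= x <= 1 -> G x = G 0 + prefix h x].
Proof.
move=> fh; have h0 := weak_deriv_int0 fh; case: fh => Lf Lh fh.
have iF := Lp1_integrable Lf; have ih := Lp1_integrable Lh.
pose H := periodize (prefix h).
have cH : continuous H.
  apply: continuous_periodize; first exact: continuous_prefix.
    exact: prefix_le0.
  by move=> x x1; rewrite prefix_ge1.
have HE x : 0 <= x <= 1 -> H x = prefix h x.
  by apply: periodize_itv; rewrite prefix_le0// prefix_ge1.
have iH := continuous_integrable_torus cH.
pose k x := f x - H x.
have ik : mu.-integrable torus (EFin \o k) by exact: integrable_subr.
have kphi phi : C1_torus phi -> \int[mu]_(x in torus) (k x * derive1 phi x) = 0.
  move=> p1; have cdphi : continuous (derive1 phi) by case: p1.
  have cphi := C1_torus_continuous p1.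
  have iHp : mu.-integrable torus (EFin \o (fun x => prefix h x * derive1 phi x)).
    apply: continuous_integrable_torus => x; apply: cvgM; last exact: cdphi.
    exact: continuous_prefix.
  have := IBP_prefix ih (is_derive_C1_torus p1) cdphi.
  rewrite RintegralD//; last exact: integrable_mulr_continuous.
  rewrite h0 mul0r => E; have {fh} := fh _ p1.
  under [in X in _ -> X]eq_Rintegral do rewrite mulrBl.
  rewrite RintegralB//; try exact: integrable_mulr_continuous.
  have -> : \int[mu]_(x in torus) (H x * derive1 phi x) =
      \int[mu]_(x in torus) (prefix h x * derive1 phi x).
    apply: eq_Rintegral => x; rewrite inE /torus /= in_itv /= => /andP[/ltW x0 x1].
    by rewrite HE ?x0.
  by lra.
have kc := torus_ae_cst ik kphi; set c := \int[mu]_(x in torus) k x in kc.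
exists (fun x => H x + c); split.
- by move=> x; apply: cvgD; [exact: cH|exact: cvg_cst].
- by move=> x; rewrite /H periodic1_periodize.
- apply: (@filterS _ _ (ae_filter_ringOfSetsType mu)) kc => x kc tx.
  by have := kc tx; rewrite /k /=; lra.
- by move=> x x01; rewrite (HE x x01) (HE 0) ?lexx ?ler01// (prefix_le0 h (lexx 0)) add0r addrC.
Qed.

Lemma weak_deriv_unique (f h h' : R -> R) : is_weak_deriv f h ->
  is_weak_deriv f h' -> torus_ae h h'.
Proof.
move=> [_ Lh fh] [_ Lh' fh'].
have ih := Lp1_integrable Lh; have ih' := Lp1_integrable Lh'.
have H : {ae mu, forall x, torus x -> h x - h' x = 0}.
  apply: torus_ae0; first exact: integrable_subr.
  move=> phi p1; have cphi := C1_torus_continuous p1.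
  under eq_Rintegral do rewrite mulrBl.
  rewrite RintegralB//; try exact: integrable_mulr_continuous.
  by have := fh _ p1; rewrite fh'//; lra.
by apply: (@filterS _ _ (ae_filter_ringOfSetsType mu)) H => x H tx; apply/eqP;
  rewrite -subr_eq0 H.
Qed.

Lemma is_weak_deriv_ae (f g h k : R -> R) : Lp_torus 1%E g -> Lp_torus 1%E k ->
  torus_ae f g -> torus_ae h k -> is_weak_deriv f h -> is_weak_deriv g k.
Proof.
move=> Lg Lk fg hk [Lf Lh fh]; split => // phi p1.
have cphi := C1_torus_continuous p1.
have cdphi : continuous (derive1 phi) by case: p1.
have mM (a b : R -> R) : measurable_fun setT a -> continuous b ->
    measurable_fun (@torus R) (fun x => a x * b x).
  move=> ma cb; apply: measurable_funTS; apply: measurable_funM => //.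
  exact: continuous_measurable_fun.
have E (a b c : R -> R) : measurable_fun setT a -> measurable_fun setT b ->
    continuous c -> torus_ae a b ->
    \int[mu]_(x in torus) (a x * c x) = \int[mu]_(x in torus) (b x * c x).
  move=> ma mb cc ab; apply: eq_Rintegral_torus_ae; try exact: mM.
  by apply: (@filterS _ _ (ae_filter_ringOfSetsType mu)) ab => x ab tx; rewrite ab.
move: Lf Lg Lh Lk => [_ mf _] [_ mg _] [_ mh _] [_ mk _].
rewrite -(E f g)// -(E h k)//; exact: fh.
Qed.

Lemma Rintegral_torus_gt0 (q : R -> R) (s t : R) : continuous q ->
  0 <= s -> s < t -> t <= 1 -> (forall x, 0 < x <= 1 -> 0 <= q x) ->
  (forall x, s < x < t -> 0 < q x) -> 0 < \int[mu]_(x in torus) q x.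
Proof.
move=> cq s0 st t1 q0 qst.
have dP := fun x => is_derive_prim x cq.
have pos a b : 0 <= a -> b <= 1 -> 0 <= \int[mu]_(x in `]a, b]) q x.
  move=> a0 b1; apply: Rintegral_ge0 => x /=; rewrite in_itv /= => /andP[ax xb].
  by apply: q0; rewrite (le_lt_trans a0 ax) (le_trans xb b1).
rewrite /torus (Rintegral_itv_split cq s0 (le_trans (ltW st) t1)).
rewrite (Rintegral_itv_split cq (ltW st) t1).
have cP : continuous (prim q) by exact: continuous_is_derive dP.
have [|c cst cE] := @MVT _ (prim q) q s t st (fun x _ => dP x).
  exact: continuous_subspaceT.
rewrite (FTC_itv _ _ (ltW st) dP cq) cE.
apply: ltr_wpDl; first by apply: pos => //; exact: le_trans (ltW st) t1.
apply: ltr_wpDr; first by apply: pos => //; exact: le_trans s0 (ltW st).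
by rewrite mulr_gt0 ?subr_gt0// qst//; move: cst; rewrite in_itv.
Qed.

(** If [k] exceeded [c] in modulus at some point, it would do so with a
    constant sign near that point, and a bump supported there would contradict
    the bound on the pairing. *)
Lemma norm_le_of_pairing (k : R -> R) (c : R) : periodic1 k -> continuous k ->
  (forall psi, C1_torus psi -> (forall x, 0 <= psi x) ->
     `|\int[mu]_(x in torus) (k x * psi x)| <= c * \int[mu]_(x in torus) psi x) ->
  forall x, `|k x| <= c.
Proof.
move=> pk ck H.
suff K x : 0 < x <= 1 -> `|k x| <= c.
  by move=> x; rewrite -(periodic1_int (1 - Num.ceil x) x pk); exact/K/ceil_shift.
move=> /andP[x0 x1]; rewrite leNgt; apply/negP => ckx.
pose b := k x < 0.
have cbk : continuous (fun y => (-1) ^+ b * k y).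
  by move=> y; apply: cvgM; [exact: cvg_cst|exact: ck].
have /nbhs_ballP[d /= d0 dK] : \forall y \near x, c < (-1) ^+ b * k y.
  by apply: (cvgr_gt _ (cbk x)); rewrite /b -normrEsign.
pose s := Num.max 0 (x - d).
have [s0 sx sd] : [/\ 0 <= s, s < x & x - d <= s].
  by rewrite /s !le_max lexx/= gt_max x0 gtrBl d0 lexx orbT.
have cpsi := C1_torus_continuous (C1_torus_bump s x).
have ipsi := continuous_integrable_torus cpsi.
have ikpsi := integrable_mulr_continuous (continuous_integrable_torus ck) cpsi.
have icbk := continuous_integrable_torus cbk.
have Hlt y : s < y < x -> c < (-1) ^+ b * k y.
  by move=> /andP[sy yx]; apply: dK; rewrite /ball /= ltr_norml; apply/andP; split; lra.
pose q y := ((-1) ^+ b * k y - c) * bump s x y.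
have : 0 < \int[mu]_(y in torus) q y.
  apply: (Rintegral_torus_gt0 (s := s) (t := x)) => //.
  - move=> y; apply: cvgM; last exact: cpsi.
    by apply: cvgB; [exact: cbk|exact: cvg_cst].
  - move=> y y01; have := bump_gt0 s0 sx x1 y01.
    case: (boolP (s < y < x)) => [syx|_] b0.
      by rewrite mulr_ge0 ?bump_ge0// subr_ge0 ltW// Hlt.
    rewrite /q (_ : bump s x y = 0) ?mulr0//.
    by apply/eqP; rewrite eq_le bump_ge0 andbT leNgt b0.
  - move=> y syx; have y01 : 0 < y <= 1.
      move: syx => /andP[sy yx].
      by rewrite (le_lt_trans s0 sy) (le_trans (ltW yx) x1).
    by rewrite mulr_gt0 ?subr_gt0 ?Hlt// bump_gt0.
have := H _ (C1_torus_bump s x) (bump_ge0 s x).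
have -> : \int[mu]_(y in torus) q y =
    (-1) ^+ b * \int[mu]_(y in torus) (k y * bump s x y) -
    c * \int[mu]_(y in torus) bump s x y.
  rewrite -!RintegralZl// -RintegralB//; try exact: integrable_scalerl.
  by apply: eq_Rintegral => y _; rewrite /q; ring.
set I := \int[mu]_(y in torus) (k y * bump s x y).
have : (-1) ^+ b * I <= `|I| by rewrite (le_trans (ler_norm _))// normrM normr_sign mul1r.
lra.
Qed.

Lemma torus_ae_eq (f g : R -> R) : periodic1 f -> periodic1 g -> continuous f ->
  continuous g -> torus_ae f g -> f = g.
Proof.
move=> pf pg cf cg fg; apply/funext => x; apply/eqP; rewrite -subr_eq0 -normr_le0.
have cfg : continuous (fun x => f x - g x).
  by move=> y; apply: cvgB; [exact: cf|exact: cg].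
apply: (norm_le_of_pairing (k := fun x => f x - g x)) => //.
  by move=> y; rewrite pf pg.
move=> psi psi1 _; rewrite mul0r normr_le0; apply/eqP.
have cpsi := C1_torus_continuous psi1.
rewrite (@eq_Rintegral_torus_ae _ _ (cst 0)).
- by rewrite Rintegral_cst// mul0r.
- apply: measurable_funTS; apply: continuous_measurable_fun => y.
  by apply: cvgM; [exact: cfg|exact: cpsi].
- exact: measurable_cst.
- apply: (@filterS _ _ (ae_filter_ringOfSetsType mu)) fg => y fg ty.
  by rewrite fg// subrr mul0r.
Qed.

(** The representative of [f] as a primitive of [h] is continuous, hence equal
    to [f] everywhere, and a primitive of a continuous function is
    differentiable. *)
Lemma weak_deriv_classical (f h : R -> R) : continuous f -> continuous h ->
  is_weak_deriv f h -> forall x : R, is_derive x 1 f (h x).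
Proof.
move=> cf ch fh x.
have pf : periodic1 f by case: fh => -[].
have ph : periodic1 h by case: fh => _ [].
have h0 := weak_deriv_int0 fh; have [G [cG pG fG GE]] := weak_deriv_repr fh.
have {fG} fG := torus_ae_eq pf pG cf cG fG.
have -> : f = fun y => cst (G 0) y + prim h y.
  rewrite fG; apply: periodic1_eq => // [y|y /andP[y0 y1]].
    by rewrite /= periodic1_prim.
  rewrite GE ?(ltW y0)// /prim prefix_itv ?(ltW y0)//.
  have -> : `]y, 0]%classic = set0 :> set R.
    by rewrite set_itv_ge// bnd_simp -leNgt ltW.
  by rewrite Rintegral_set0 subr0.
apply: (is_derive_eq (is_derive1D (is_derive_cst (G 0) x 1) (is_derive_prim x ch))).
by rewrite add0r.
Qed.

(** One-dimensional Sobolev embedding: a primitive differs from each of its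
    values, hence from its mean, by at most the L^1 norm of the derivative. *)
Lemma sobolev_sup (f h : R -> R) : continuous f -> is_weak_deriv f h ->
  forall x, (`|f x|%:E <= torus_norm 2%:E f + torus_norm 2%:E h)%E.
Proof.
move=> cf fh; have pf : periodic1 f by case: fh => -[].
have mf := continuous_measurable_fun cf.
have Lh : Lp_torus 1%E h by case: fh.
have mh := Lp_measurable Lh; have ih := Lp1_integrable Lh.
have [G [cG pG fG GE]] := weak_deriv_repr fh.
have {fG} fG := torus_ae_eq pf pG cf cG fG; rewrite -{}fG in GE.
have iah : mu.-integrable torus (EFin \o (fun x => `|h x|)) by exact: integrable_norm.
set A := \int[mu]_(x in torus) `|h x|.
have le_A s t : 0 <= s -> s <= t -> t <= 1 -> `|f t - f s| <= A.
  move=> s0 st t1; rewrite (GE t) ?t1 ?(le_trans s0 st)//.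
  rewrite (GE s) ?s0 ?(le_trans st t1)//.
  rewrite (_ : _ - _ = prefix h t - prefix h s); last by ring.
  rewrite prefix_sub//; apply: le_trans (le_normr_Rintegral _ _) _ => //.
    exact: integrable_sub_torus.
  rewrite -prefix_sub// (@prefix_itv _ _ t) ?t1 ?(le_trans s0 st)//.
  have -> : A = \int[mu]_(x in `]0, t]) `|h x| + \int[mu]_(x in `]t, 1]) `|h x|.
    rewrite -(prefix_sub iah (le_trans s0 st) t1 (lexx 1)) prefix_ge1//.
    by rewrite prefix_itv ?t1 ?(le_trans s0 st)// -/A; ring.
  have := @Rintegral_ge0 _ _ _ mu `]t, 1] (fun x => `|h x|) (fun _ _ => normr_ge0 _).
  have : 0 <= prefix (fun x => `|h x|) s by exact: Rintegral_ge0.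
  lra.
have le_fA x y : 0 <= x <= 1 -> 0 <= y <= 1 -> `|f x| <= `|f y| + A.
  move=> /andP[x0 x1] /andP[y0 y1]; have := ler_distD (f y) (f x) 0.
  rewrite !subr0; suff : `|f x - f y| <= A by lra.
  by have [xy|yx] := leP x y; [rewrite distrC|have {}yx := ltW yx]; exact: le_A.
have cnf : continuous (fun x => `|f x|).
  by move=> x; apply: cvg_norm; exact: cf.
have main x : 0 <= x <= 1 -> `|f x| <= \int[mu]_(y in torus) `|f y| + A.
  move=> x01; rewrite -lerBlDr -[leLHS]Rintegral_torus_cst.
  apply: le_Rintegral => //.
  - by apply: continuous_integrable_torus => y; exact: cvg_cst.
  - exact: continuous_integrable_torus.
  - move=> y; rewrite /torus /= in_itv /= => /andP[/ltW y0 y1].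
    by rewrite lerBlDr; apply: le_fA => //; rewrite y0.
move=> x.
have -> : f x = f (x + (1 - Num.ceil x)%:~R) by rewrite periodic1_int.
have /andP[/ltW z0 z1] := ceil_shift x.
apply: le_trans (leeD (torus_norm_le12 mf) (torus_norm_le12 mh)).
rewrite !torus_norm1E// !EFin_Rintegral//; last exact: continuous_integrable_torus.
by rewrite -EFinD lee_fin main// z0.
Qed.

End WeakDerivative.

(** * Sobolev spaces *)


Section Sobolev.
Context {R : realType}.
Notation mu := (@lebesgue_measure R).

Lemma is_weak_deriv_weak_deriv (f h : R -> R) : is_weak_deriv f h ->
  is_weak_deriv f (weak_deriv f).
Proof. by move=> fh; apply: (@xgetPex _ (cst 0) [set h | is_weak_deriv f h]); exists h. Qed.

Lemma weak_deriv_ae (f g : R -> R) : Lp_torus 1%E f -> Lp_torus 1%E g ->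
  torus_ae f g -> weak_deriv f = weak_deriv g.
Proof.
move=> Lf Lg fg; rewrite /weak_deriv; congr xget; apply/seteqP; split => h /= fh;
  have Lh : Lp_torus 1%E h by case: fh.
- by apply: is_weak_deriv_ae fh => //; exact: torus_ae_refl.
- by apply: is_weak_deriv_ae fh => //; [exact: torus_ae_sym|exact: torus_ae_refl].
Qed.

Lemma Lp2_Lp1 (f : R -> R) : Lp_torus 2%:E f -> Lp_torus 1%E f.
Proof.
by move=> [pf mf f2]; split => //; exact: le_lt_trans (torus_norm_le12 mf) f2.
Qed.

Lemma Lp2_sqr_integrable (f : R -> R) : measurable_fun setT f ->
  (torus_norm 2%:E f < +oo)%E <-> mu.-integrable torus (EFin \o (fun x => f x ^+ 2)).
Proof.
move=> mf; have m2 : measurable_fun (@torus R) (fun x => f x ^+ 2).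
  by apply: measurable_funTS; exact: measurable_funX.
rewrite torus_norm2E//; split => [h|fi]; last by rewrite EFin_Rintegral// poweR_EFin ltry.
apply/integrableP; split; first exact/measurable_EFinP.
under eq_integral do rewrite /= ger0_norm ?sqr_ge0//.
rewrite ltey; apply/eqP => E; move: h; rewrite E poweRyr ?ltxx// invr_neq0.
Qed.

Lemma Lp2_sub (f g : R -> R) : Lp_torus 2%:E f -> Lp_torus 2%:E g ->
  Lp_torus 2%:E (fun x => f x - g x).
Proof.
move=> [pf mf f2] [pg mg g2]; split; first by move=> x; rewrite pf pg.
  exact: measurable_funB.
apply/Lp2_sqr_integrable; first exact: measurable_funB.
move/(Lp2_sqr_integrable mf) : f2 => f2; move/(Lp2_sqr_integrable mg) : g2 => g2.
have := integrable_scalerl 2 _ (integrable_addr _ f2 g2).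
move=> /(_ measurable_torus measurable_torus); apply: le_integrable => //.
- apply/measurable_EFinP; apply: measurable_funTS; apply: measurable_funX.
  exact: measurable_funB.
- move=> x _; rewrite /= lee_fin !ger0_norm ?sqr_ge0//; last first.
    by rewrite mulr_ge0// addr_ge0// sqr_ge0.
  by rewrite -subr_ge0 (_ : _ - _ = (f x + g x) ^+ 2) ?sqr_ge0//; ring.
Qed.

Lemma is_weak_deriv_sub (f g h k : R -> R) : is_weak_deriv f h ->
  is_weak_deriv g k -> is_weak_deriv (fun x => f x - g x) (fun x => h x - k x).
Proof.
have L1 (a b : R -> R) : Lp_torus 1%E a -> Lp_torus 1%E b ->
    Lp_torus 1%E (fun x => a x - b x).
  move=> La Lb; have ia := Lp1_integrable La; have ib := Lp1_integrable Lb.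
  case: La => pa ma _; case: Lb => pb mb _.
  have mab : measurable_fun setT (fun x => a x - b x) by exact: measurable_funB.
  split=> //; first by move=> x; rewrite pa pb.
  rewrite torus_norm1E//.
  have iab : mu.-integrable torus (EFin \o (fun x => a x - b x)) by exact: integrable_subr.
  by case/integrableP : iab.
move=> [Lf Lh fh] [Lg Lk gk]; split; [exact: L1|exact: L1|move=> phi p1].
have cphi := C1_torus_continuous p1.
have cdphi : continuous (derive1 phi) by case: p1.
under eq_Rintegral do rewrite mulrBl.
rewrite RintegralB ?fh ?gk//; try by apply: integrable_mulr_continuous => //; exact:
  Lp1_integrable.
under [in RHS]eq_Rintegral do rewrite mulrBl.
rewrite RintegralB//; try by apply: integrable_mulr_continuous => //; exact: Lp1_integrable.
by rewrite opprB opprK addrC.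
Qed.

Lemma Hspace_Lp2 k (f : R -> R) : Hspace k f -> Lp_torus 2%:E f.
Proof. by case: k => [//|k] []. Qed.

Lemma Hspace_sub k (f g : R -> R) : Hspace k f -> Hspace k g ->
  Hspace k (fun x => f x - g x).
Proof.
elim: k f g => [|k IH] f g /=; first exact: Lp2_sub.
move=> [Lf [h fh Hh]] [Lg [l gl Hl]]; split; first exact: Lp2_sub.
exists (fun x => h x - l x); first exact: is_weak_deriv_sub.
exact: IH.
Qed.

Lemma Hspace_ae k (f g : R -> R) : Lp_torus 2%:E g -> torus_ae f g ->
  Hspace k f -> Hspace k g.
Proof.
case: k => [//|k] Lg fg /= [Lf [h fh Hh]]; split => //; exists h => //.
have Lh : Lp_torus 1%E h by case: fh.
by apply: is_weak_deriv_ae fh => //; [exact: Lp2_Lp1|exact: torus_ae_refl].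
Qed.

Lemma poweR_sqrK (x : \bar R) : (0 <= x -> (x `^ 2) `^ 2^-1 = x)%E.
Proof. by move=> x0; rewrite -poweRrM mulfV ?poweRe1. Qed.

Lemma le_Hnorm k j (f : R -> R) : (j <= k)%N ->
  (torus_norm 2%:E (iter j weak_deriv f) <= Hnorm k f)%E.
Proof.
move=> jk; rewrite -[leLHS]poweR_sqrK ?torus_norm_ge0// /Hnorm.
apply: gt0_ler_poweR => //.
- by rewrite in_itv/= poweR_ge0 leey.
- by rewrite in_itv/= sume_ge0 ?leey// => i _; exact: poweR_ge0.
- have jk' : (j < k.+1)%N by [].
  rewrite (bigD1 (Ordinal jk'))//= leeDl// sume_ge0// => i _; exact: poweR_ge0.
Qed.

Lemma Hnorm_weak_deriv k (f d : R -> R) : is_weak_deriv f d ->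
  (Hnorm k d <= Hnorm k.+1 f)%E.
Proof.
move=> fd; have fw := is_weak_deriv_weak_deriv fd.
have wd := weak_deriv_unique fw fd.
have Lw : Lp_torus 1%E (weak_deriv f) by case: fw.
have Ld : Lp_torus 1%E d by case: fd.
have E j : torus_norm 2%:E (iter j weak_deriv d) =
    torus_norm 2%:E (iter j.+1 weak_deriv f).
  rewrite iterSr; case: j => [|j].
    apply: eq_torus_norm2; [exact: Lp_measurable Ld|exact: Lp_measurable Lw|].
    exact: torus_ae_sym.
  by rewrite !iterSr (weak_deriv_ae Lw Ld wd).
rewrite /Hnorm; apply: gt0_ler_poweR => //.
- by rewrite in_itv/= sume_ge0 ?leey// => i _; exact: poweR_ge0.
- by rewrite in_itv/= sume_ge0 ?leey// => i _; exact: poweR_ge0.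
- rewrite [leRHS]big_ord_recl /=.
  under eq_bigr do rewrite E; rewrite leeDr ?poweR_ge0//.
Qed.

Lemma sobolev_Hnorm k (f : R -> R) : continuous f -> Hspace k.+1 f ->
  forall x, (`|f x|%:E <= Hnorm k.+1 f + Hnorm k.+1 f)%E.
Proof.
move=> cf [_ [h fh _]] x.
apply: le_trans (sobolev_sup cf (is_weak_deriv_weak_deriv fh) x) _.
by apply: leeD; [exact: (@le_Hnorm k.+1 0)|exact: (@le_Hnorm k.+1 1)].
Qed.

(** The weak derivative of a function in H^2 is itself in H^1, so it has a
    continuous representative, which is then the classical derivative. *)
Lemma Hspace_derive1 k (f : R -> R) : continuous f -> Hspace k.+2 f ->
  [/\ continuous (derive1 f), is_weak_deriv f (derive1 f), Hspace k.+1 (derive1 f) &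
      forall x : R, is_derive x 1 f (derive1 f x)].
Proof.
move=> cf [Lf [h fh Hh]]; have [_ [h2 hh2 _]] := Hh.
have [G [cG pG hG _]] := weak_deriv_repr hh2.
have [LG1 LG2] := continuous_Lp_torus pG cG.
have fG : is_weak_deriv f G.
  apply: is_weak_deriv_ae fh => //; first exact: Lp2_Lp1.
  exact: torus_ae_refl.
have dG := weak_deriv_classical cf cG fG.
have -> : derive1 f = G by apply/funext => x; rewrite derive1E; case: (dG x).
by split => //; exact: (@Hspace_ae k.+1 h G LG2 hG Hh).
Qed.

Lemma C_Hspace_derive1 T k (h : R -> R -> R) : C_Hspace T k.+2 h ->
  (forall t, 0 <= t <= T -> continuous (h t)) ->
  C_Hspace T k.+1 (fun t => derive1 (h t)).
Proof.
move=> [Hh cvh] ch; split.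
  by move=> t tT; have [] := Hspace_derive1 (ch t tT) (Hh t tT).
move=> t tT; apply: squeeze_cvge (cvg_cst 0%E) (cvh t tT).
near=> s; have sT : s \in `[0, T] by near: s; exact: withinT.
rewrite poweR_ge0 /=; apply: Hnorm_weak_deriv.
have [_ ws _ _] := Hspace_derive1 (ch s sT) (Hh s sT).
have [_ wt _ _] := Hspace_derive1 (ch t tT) (Hh t tT).
exact: is_weak_deriv_sub.
Unshelve. all: by end_near. Qed.

(** By the Sobolev embedding the oscillation in time is small uniformly in
    space, and each slice is continuous in space. Freezing time outside the
    interval extends the continuity to the whole plane. *)
Lemma C_Hspace_jcont T k (h : R -> R -> R) : 0 <= T -> C_Hspace T k.+1 h ->
  (forall t, 0 <= t <= T -> continuous (h t)) ->
  jcont (fun t x => h (clamp 0 T t) x).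
Proof.
move=> T0 [Hh cvh] ch [t0 x0]; set c0 := clamp 0 T t0.
have c0T : c0 \in `[0, T] by rewrite in_itv /= clamp_itv.
apply/cvgrPdist_lt => e e0; have e4 : 0 < e / 4 by rewrite divr_gt0.
have [d d0 Hd] : exists2 d, 0 < d & forall s, s \in `[0, T] -> `|c0 - s| < d ->
    (Hnorm k.+1 (h s \- h c0)%R < (e / 4)%:E)%E.
  have /fine_cvgP[fin /cvgrPdist_lt/(_ _ e4) lt4] := cvh c0 c0T.
  have /nbhs_ballP[d /= d0 Hd] : \forall s \near c0, s \in `[0, T] ->
      (Hnorm k.+1 (h s \- h c0)%R < (e / 4)%:E)%E.
    suff : \forall s \near within [set` `[0, T]] (nbhs c0),
      (Hnorm k.+1 (h s \- h c0)%R < (e / 4)%:E)%E by [].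
    apply: filterS2 fin lt4 => s fin; rewrite /= sub0r normrN => lt4.
    by rewrite -(fineK fin) lte_fin (le_lt_trans (ler_norm _)).
  by exists d => // s sT sd; exact: Hd.
have cc : continuous (fun t => clamp 0 T t) := @continuous_clamp _ 0 T.
have ctx : continuous (h c0) by apply: ch; move: c0T; rewrite in_itv.
have e20 : 0 < e / 2 by rewrite divr_gt0.
have /nbhs_ballP[d1 /= d10 H1] : \forall t \near t0, `|c0 - clamp 0 T t| < d.
  by have /cvgrPdist_lt := cc t0; apply.
have /nbhs_ballP[d2 /= d20 H2] : \forall x \near x0, `|h c0 x0 - h c0 x| < e / 2.
  by have /cvgrPdist_lt := ctx x0; apply.
exists (ball t0 d1, ball x0 d2); first by split; exact: nbhsx_ballx.
move=> [t x] /= [/H1 td /H2 xd].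
have cT : clamp 0 T t \in `[0, T] by rewrite in_itv /= clamp_itv.
have ccT : continuous (h (clamp 0 T t)) by apply: ch; rewrite clamp_itv.
have csub : continuous (h (clamp 0 T t) \- h c0).
  by move=> y; apply: cvgB; [exact: ccT|exact: ctx].
have Hsub : Hspace k.+1 (h (clamp 0 T t) \- h c0) by apply: Hspace_sub; exact: Hh.
have := sobolev_Hnorm csub Hsub x; have lt4 := Hd _ cT td.
move=> /le_lt_trans/(_ (lteD lt4 lt4)); rewrite -EFinD lte_fin /= => h3.
have := ler_distD (h c0 x) (h c0 x0) (h (clamp 0 T t) x).
rewrite (distrC (h c0 x) (h (clamp 0 T t) x)); lra.
Qed.

End Sobolev.

(** * Cut-offs in time *)


Section TimeCutoff.
Context {R : realType}.
Notation mu := (@lebesgue_measure R).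

(** A quadratic spline rising from 0 to 1 on the unit interval. *)
Definition ramp (y : R) : R := 2 * (possq y - 2 * possq (y - 2^-1) + possq (y - 1)).

Definition dramp (y : R) : R :=
  4 * (Num.max y 0 - 2 * Num.max (y - 2^-1) 0 + Num.max (y - 1) 0).

Lemma is_derive_shift (f : R -> R) (x a d : R) : is_derive (x - a) 1 f d ->
  is_derive x 1 (fun y => f (y - a)) d.
Proof.
move=> df.
have h : is_derive x 1 (fun y : R => id y + cst (- a) y) (1 + 0).
  exact: (is_derive1D (is_derive_id x 1) (is_derive_cst (- a) x 1)).
apply: (is_derive_eq (is_derive1c (g := fun y => id y + cst (- a) y) df h)).
by rewrite addr0 mulr1.
Qed.

Lemma is_derive_ramp (y : R) : is_derive y 1 ramp (dramp y).
Proof.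
have h1 := is_derive_possq y.
have h2 := is_derive1N (is_derive1Zl 2 (is_derive_shift (is_derive_possq (y - 2^-1)))).
have h3 := is_derive_shift (is_derive_possq (y - 1)).
have h := is_derive1Zl 2 (is_derive1D (is_derive1D h1 h2) h3).
apply: (is_derive_eq h); rewrite /dramp; ring.
Qed.

Lemma continuous_dramp : continuous dramp.
Proof.
have cp (a : R) : continuous (fun y : R => Num.max (y - a) 0).
  move=> y; apply: (@continuous_comp _ _ _ (fun y => y - a) (fun y : R => Num.max y 0)).
    by apply: cvgB; [exact: cvg_id|exact: cvg_cst].
  exact: continuous_pospart.
move=> y; apply: cvgM; first exact: cvg_cst.
apply: cvgD; last exact: cp.
apply: cvgB; first exact: continuous_pospart.
by apply: cvgM; [exact: cvg_cst|exact: cp].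
Qed.

Lemma ramp_le0 y : y <= 0 -> ramp y = 0.
Proof.
move=> y0; rewrite /ramp /possq !max_r; [ring|lra..].
Qed.

Lemma ramp_ge1 y : 1 <= y -> ramp y = 1.
Proof.
move=> y0; by rewrite /ramp /possq !max_l; [field|lra..].
Qed.

Lemma ramp_itv01 y : 0 <= ramp y <= 1.
Proof.
rewrite /ramp /possq; case: (lerP y 0) => h1; case: (lerP (y - 2^-1) 0) => h2;
  case: (lerP (y - 1) 0) => h3; apply/andP; split; nra.
Qed.

Lemma dramp_ge0 y : 0 <= dramp y.
Proof.
rewrite /dramp; case: (lerP y 0) => h1; case: (lerP (y - 2^-1) 0) => h2;
  case: (lerP (y - 1) 0) => h3; lra.
Qed.

Lemma dramp_eq0 y : y <= 0 \/ 1 <= y -> dramp y = 0.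
Proof.
by rewrite /dramp => -[y0|y1]; [rewrite !max_r; [ring|lra..]|rewrite !max_l; [field|lra..]].
Qed.

Lemma is_derive_ramp_scaled (h s x : R) : 
  is_derive x 1 (fun y => ramp ((y - s) / h)) (dramp ((x - s) / h) / h).
Proof.
have d1 : is_derive x 1 (fun y : R => (y - s) / h) (h^-1).
  rewrite (_ : (fun y => _) = fun y => h^-1 * id y + cst (- s / h) y); last first.
    by apply/funext => y /=; ring.
  apply: (is_derive_eq (is_derive1D (is_derive1Zl h^-1 (is_derive_id x 1))
    (is_derive_cst (- s / h) x 1))).
  by rewrite addr0 mulr1.
exact: (is_derive1c (is_derive_ramp _) d1).
Qed.

Lemma continuous_dramp_scaled (h s : R) :
  continuous (fun x => dramp ((x - s) / h) / h).
Proof.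
move=> x; apply: cvgM; last exact: cvg_cst.
apply: (@continuous_comp _ _ _ (fun x : R => (x - s) / h) dramp); last exact: continuous_dramp.
by apply: cvgM; [apply: cvgB; [exact: cvg_id|exact: cvg_cst]|exact: cvg_cst].
Qed.

(** The edges have width [h] and lie to the right of [s] and of [t]; as [h]
    tends to 0 these cut-offs tend to the indicator of the interval from [s] to
    [t]. *)
Definition trap (h s t x : R) : R := ramp ((x - s) / h) - ramp ((x - t) / h).

Definition dtrap (h s t x : R) : R :=
  dramp ((x - s) / h) / h - dramp ((x - t) / h) / h.

Lemma is_derive_trap h s t (x : R) : is_derive x 1 (trap h s t) (dtrap h s t x).
Proof.
exact: (is_derive1D (is_derive_ramp_scaled h s x)
  (is_derive1N (is_derive_ramp_scaled h t x))).
Qed.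

Lemma continuous_dtrap h s t : continuous (dtrap h s t).
Proof. by move=> x; apply: cvgB; exact: continuous_dramp_scaled. Qed.

Lemma continuous_trap h s t : continuous (trap h s t).
Proof. exact: continuous_is_derive (is_derive_trap h s t). Qed.

Lemma trap_out (h s t x : R) : 0 < h -> s <= t -> ~~ (s <= x <= t + h) ->
  trap h s t x = 0.
Proof.
move=> h0 st; rewrite negb_and -!ltNge /trap => /orP[xs|tx].
  by rewrite !ramp_le0 ?subrr// pmulr_lle0 ?invr_gt0//; lra.
by rewrite !ramp_ge1 ?subrr// ler_pdivlMr//; lra.
Qed.

Lemma trap_in (h s t x : R) : 0 < h -> s + h <= x <= t -> trap h s t x = 1.
Proof.
move=> h0 /andP[sx xt]; rewrite /trap ramp_ge1 ?ramp_le0 ?subr0//.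
  by rewrite pmulr_lle0 ?invr_gt0//; lra.
by rewrite ler_pdivlMr//; lra.
Qed.

Lemma trap_itv01 (h s t x : R) : 0 < h -> s + h <= t -> 0 <= trap h s t x <= 1.
Proof.
move=> h0 sht; have /andP[r0 r1] := ramp_itv01 ((x - s) / h).
have /andP[r0' r1'] := ramp_itv01 ((x - t) / h).
rewrite /trap; have [xt|tx] := leP x t.
  rewrite (@ramp_le0 ((x - t) / h)); first by lra.
  by rewrite pmulr_lle0 ?invr_gt0//; lra.
rewrite (@ramp_ge1 ((x - s) / h)); first by lra.
by rewrite ler_pdivlMr//; lra.
Qed.

Lemma Rintegral_split_itv (f : R -> R) (a b c : R) :
  mu.-integrable `]a, c] (EFin \o f) -> a <= b -> b <= c ->
  \int[mu]_(y in `]a, c]) f y =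
  \int[mu]_(y in `]a, b]) f y + \int[mu]_(y in `]b, c]) f y.
Proof.
move=> fi ab bc.
by rewrite -(@Rintegral_itvB _ f (BRight a) (BRight c) b) ?bnd_simp// addrC subrK.
Qed.

Lemma Rintegral_eq0 (D : set R) (f : R -> R) : (forall x, D x -> f x = 0) ->
  \int[mu]_(x in D) f x = 0.
Proof.
move=> f0; rewrite (_ : \int[mu]_(x in D) f x = \int[mu]_(x in D) cst 0 x).
  by rewrite /Rintegral integral0.
by apply: eq_Rintegral => x; rewrite inE => /f0.
Qed.

Lemma normr_Rintegral_itv (f : R -> R) (a b N : R) : a <= b ->
  measurable_fun `]a, b] f -> (forall x, a < x <= b -> `|f x| <= N) ->
  `|\int[mu]_(x in `]a, b]) f x| <= N * (b - a).
Proof.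
move=> ab mf fN; rewrite [b - a](_ : _ = fine (mu `]a, b])); last first.
  rewrite [X in fine X]lebesgue_measure_itv /= lte_fin.
  by case: ltP => // ba; rewrite (@le_anti _ _ a b) ?ab ?subrr.
by apply: normr_Rintegral_bound => //; exact: itv_measure_lty.
Qed.

(** The cut-off differs from the indicator of the interval only on its two
    edges, of width [h]. *)
Lemma Rintegral_trap (B : R -> R) (T N h s t : R) : 0 < h -> 0 <= s ->
  s + h <= t -> t + h <= T -> measurable_fun setT B ->
  (forall x, 0 < x <= T -> `|B x| <= N) ->
  `|\int[mu]_(x in `]0, T]) (B x * trap h s t x) - \int[mu]_(x in `]s, t]) B x|
    <= 2 * N * h.
Proof.
move=> h0 s0 sht thT mB BN.
have st : s <= t by lra.
have mBt : measurable_fun setT (fun x => B x * trap h s t x).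
  by apply: measurable_funM => //; apply: continuous_measurable_fun; exact: continuous_trap.
have BtN x : 0 < x <= T -> `|B x * trap h s t x| <= N.
  move=> x0; rewrite normrM -[leRHS]mulr1; apply: ler_pM => //; first exact: BN.
  by have /andP[t0 t1] := trap_itv01 x h0 sht; rewrite ger0_norm.
have ii (f : R -> R) a b : 0 <= a -> b <= T -> measurable_fun setT f ->
    (forall x, 0 < x <= T -> `|f x| <= N) -> mu.-integrable `]a, b] (EFin \o f).
  move=> a0 bT mf fN; apply: (@bounded_integrable _ _ _ N) => //.
  - exact: itv_measure_lty.
  - exact: measurable_funTS.
  - move=> x /=; rewrite in_itv /= => /andP[ax xb]; apply: fN.
    by rewrite (le_lt_trans a0 ax) (le_trans xb bT).
have z1 : \int[mu]_(x in `]0, s]) (B x * trap h s t x) = 0.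
  apply: Rintegral_eq0 => x /=; rewrite in_itv /= => /andP[x0 xs].
  rewrite /trap !ramp_le0 ?subrr ?mulr0// pmulr_lle0 ?invr_gt0//; lra.
have z2 : \int[mu]_(x in `]t + h, T]) (B x * trap h s t x) = 0.
  apply: Rintegral_eq0 => x /=; rewrite in_itv /= => /andP[x0 xs].
  by rewrite trap_out ?mulr0// negb_and -!ltNge x0 orbT.
rewrite (@Rintegral_split_itv _ 0 s T) ?z1; [|by apply: ii|lra..].
rewrite (@Rintegral_split_itv _ s (s + h) T); [|by apply: ii|lra..].
rewrite (@Rintegral_split_itv _ (s + h) t T); [|by apply: ii => //; lra|lra..].
rewrite (@Rintegral_split_itv _ t (t + h) T) ?z2; [|by apply: ii => //; lra|lra..].
rewrite (@Rintegral_split_itv B s (s + h) t); [|by apply: ii => //; lra|lra..].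
rewrite (_ : \int[mu]_(x in `]s + h, t]) (B x * trap h s t x) =
  \int[mu]_(x in `]s + h, t]) B x); last first.
  apply: eq_Rintegral => x; rewrite inE /= in_itv /= => /andP[sx xt].
  by rewrite trap_in ?mulr1// ltW.
set I1 := \int[mu]_(x in `]s, _]) _; set I2 := \int[mu]_(x in `]_, t]) _.
set I3 := \int[mu]_(x in `]t, _]) _; set I4 := \int[mu]_(x in `]s, _]) B x.
have e1 : `|I1 - I4| <= N * h.
  rewrite /I1 /I4 -RintegralB//; try by apply: ii => //; lra.
  rewrite [X in N * X](_ : h = s + h - s); last by ring.
  apply: normr_Rintegral_itv; first by lra.
    by apply: measurable_funB; apply: measurable_funTS.
  move=> x /andP[sx xs]; rewrite -[X in _ - X]mulr1 -mulrBr normrM -[leRHS]mulr1.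
  apply: ler_pM => //; first by apply: BN; lra.
  have /andP[t0 t1] := trap_itv01 x h0 sht.
  by rewrite ler0_norm; lra.
have e2 : `|I3| <= N * h.
  rewrite /I3 [X in N * X](_ : h = t + h - t); last by ring.
  apply: normr_Rintegral_itv; [lra|exact: measurable_funTS|].
  by move=> x /andP[tx xt]; apply: BtN; lra.
rewrite (_ : _ - _ = (I1 - I4) + I3); last by ring.
by apply: le_trans (ler_normD _ _) _; lra.
Qed.

Lemma Rintegral_dramp (h s T : R) : 0 < h -> 0 <= s -> s + h <= T ->
  \int[mu]_(x in `]0, T]) (dramp ((x - s) / h) / h) = 1.
Proof.
move=> h0 s0 shT.
rewrite (FTC_itv _ _ _ (is_derive_ramp_scaled h s) (@continuous_dramp_scaled h s)); last lra.
rewrite ramp_ge1 ?ler_pdivlMr//; last lra.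
by rewrite ramp_le0 ?subr0// pmulr_lle0 ?invr_gt0//; lra.
Qed.

(** The derivative of an edge is a probability density concentrated on an
    interval of length [h]. *)
Lemma Rintegral_dramp_near (A : R -> R) (h s T e : R) : continuous A -> 0 < h ->
  0 <= s -> s + h <= T -> (forall x, s <= x <= s + h -> `|A x - A s| <= e) ->
  `|\int[mu]_(x in `]0, T]) (A x * (dramp ((x - s) / h) / h)) - A s| <= e.
Proof.
move=> cA h0 s0 shT Ae.
have cd := @continuous_dramp_scaled h s.
have i1 : mu.-integrable `]0, T] (EFin \o (fun x => dramp ((x - s) / h) / h)).
  exact: continuous_integrable_itv.
have i2 : mu.-integrable `]0, T] (EFin \o (fun x => A x * (dramp ((x - s) / h) / h))).
  by apply: continuous_integrable_itv => x; apply: cvgM; [exact: cA|exact: cd].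
have i3 c := integrable_scalerl c (measurable_itv _) i1.
rewrite -[X in _ - X]mulr1 -(Rintegral_dramp h0 s0 shT) -RintegralZl// -RintegralB//.
rewrite -[leRHS]mulr1 -(Rintegral_dramp h0 s0 shT) -RintegralZl//.
apply: le_trans (le_normr_Rintegral _ _) _ => //; first exact: integrable_subr.
apply: le_Rintegral => //.
  by apply: integrable_norm; exact: integrable_subr.
move=> x _; rewrite -mulrBl normrM [X in _ * X]ger0_norm; last first.
  by rewrite mulr_ge0 ?dramp_ge0// invr_ge0 ltW.
have [/andP[sx xs]|] := boolP (s <= x <= s + h).
  rewrite ler_wpM2r//; last by apply: Ae; rewrite sx.
  by rewrite mulr_ge0 ?dramp_ge0// invr_ge0 ltW.
rewrite negb_and -!ltNge => xo; rewrite dramp_eq0 ?mul0r ?mulr0//.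
case/orP: xo => xo; [left|right].
  by rewrite pmulr_lle0 ?invr_gt0//; lra.
by rewrite ler_pdivlMr//; lra.
Qed.

(** As [h] tends to 0, the derivative of the trapezoid tends to the difference
    of the point masses at [s] and [t], and the trapezoid itself to the
    indicator of the interval. *)
Lemma weak_time_deriv (A B : R -> R) (T N : R) : continuous A ->
  measurable_fun setT B -> (forall x, 0 < x <= T -> `|B x| <= N) ->
  (forall h s t, 0 < h -> 0 < s -> s + h <= t -> t + h < T ->
     \int[mu]_(x in `]0, T]) (A x * dtrap h s t x) =
     - \int[mu]_(x in `]0, T]) (B x * trap h s t x)) ->
  forall s t, 0 < s -> s < t -> t < T -> A t - A s = \int[mu]_(x in `]s, t]) B x.
Proof.
move=> cA mB BN H s t s0 st tT.
have N0 : 0 <= N.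
  by apply: le_trans (normr_ge0 _) (BN t _); rewrite (lt_trans s0 st) ltW.
apply/eqP; rewrite -subr_eq0 -normr_le0; apply/ler_addgt0Pr => e e0; rewrite add0r.
have e4 : 0 < e / 4 by rewrite divr_gt0.
have [d d0 Ad] := jcont_unif s T (jcont_t cA) e4.
pose h := Num.min (Num.min (d / 2) ((t - s) / 2))
  (Num.min ((T - t) / 2) (e / 4 / (N + 1))).
have [h0 hd hst htT hN] : [/\ 0 < h, h < d, h < t - s, h < T - t & h * (N + 1) <= e / 4].
  have N1 : 0 < N + 1 by lra.
  split.
  - by rewrite !lt_min !divr_gt0 ?subr_gt0.
  - by rewrite /h !gt_min; apply/orP; left; apply/orP; left; lra.
  - by rewrite /h !gt_min; apply/orP; left; apply/orP; right; lra.
  - by rewrite /h !gt_min; apply/orP; right; apply/orP; left; lra.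
  - by rewrite -ler_pdivlMr// /h !ge_min lexx !orbT.
have near s' : s <= s' -> s' + h <= T ->
    `|\int[mu]_(x in `]0, T]) (A x * (dramp ((x - s') / h) / h)) - A s'| <= e / 4.
  move=> ss' s'T; apply: Rintegral_dramp_near => //; first by lra.
  move=> x /andP[sx xs]; apply: (Ad x s' 0); rewrite ?lexx ?ler01//.
    by apply/andP; split; lra.
  by rewrite ger0_norm; lra.
have := H h s t h0 s0; rewrite -/(_ <= _).
have -> : \int[mu]_(x in `]0, T]) (A x * dtrap h s t x) =
    \int[mu]_(x in `]0, T]) (A x * (dramp ((x - s) / h) / h)) -
    \int[mu]_(x in `]0, T]) (A x * (dramp ((x - t) / h) / h)).
  rewrite -RintegralB//; first by apply: eq_Rintegral => x _; rewrite /dtrap mulrBr.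
  - by apply: continuous_integrable_itv => x; apply: cvgM; [exact: cA|exact:
    continuous_dramp_scaled].
  - by apply: continuous_integrable_itv => x; apply: cvgM; [exact: cA|exact:
    continuous_dramp_scaled].
have sht : s + h <= t by lra.
have thT : t + h < T by lra.
move=> /(_ sht thT).
have n1 := near s (lexx s) _; have n2 := near t (ltW st) (ltW thT).
have {}n1 := n1 (le_trans sht (ltW tT)).
have n3 := Rintegral_trap h0 (ltW s0) sht (ltW thT) mB BN.
move: n1 n2 n3; set I1 := \int[mu]_(x in _) (A x * _); set I2 := \int[mu]_(x in _) (A x * _).
set I3 := \int[mu]_(x in _) (B x * _); set I4 := \int[mu]_(x in _) B x.
rewrite !ler_norml => /andP[? ?] /andP[? ?] /andP[? ?] ?.
by apply/andP; split; nra.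
Qed.

End TimeCutoff.

(** * Bounded representatives of essentially bounded functions *)


Section BoundedRepresentative.
Context {R : realType}.
Notation mu := (@lebesgue_measure R).

Lemma ae_mrestr (D : set R) (mD : measurable D) (P : R -> Prop) :
  (\forall t \ae mrestr mu mD, P t) <-> {ae mu, forall t, D t -> P t}.
Proof.
split=> -[N [mN N0 NP]].
- exists (N `&` D); split => //; first exact: measurableI.
  by move=> t /= /not_implyP[Dt nP]; split => //; exact: NP.
- exists (N `|` ~` D); split.
  + by apply: measurableU => //; exact: measurableC.
  + apply/eqP; rewrite -measure_le0.
    have : (mu (N `&` D) <= 0)%E.
      by rewrite -N0; apply: le_measure; rewrite ?inE//; exact: measurableI.
    apply: le_trans; rewrite [X in (X <= _)%E](_ : _ = mu ((N `|` ~` D) `&` D))//.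
    by rewrite setIUl setICl setU0.
  + move=> t /= nP; have [Dt|nDt] := pselect (D t); last by right.
    by left; apply: NP => /= DP; exact/nP/DP.
Qed.

Lemma time_measure_gt0 (T : R) : 0 < T -> (0 < time_measure T%:E [set: R])%E.
Proof.
move=> T0; rewrite [ltRHS](_ : _ = mu `]0, T[).
  by rewrite lebesgue_measure_itv /= lte_fin T0 oppr0 adde0 lte_fin.
rewrite /time_measure /mrestr setTI; congr (mu _).
Qed.

Lemma le_time_measure_gt0 (T : R) (T' : \bar R) : 0 < T -> (T%:E <= T')%E ->
  (0 < time_measure T' [set: R])%E.
Proof.
move=> T0 TT'; apply: lt_le_trans (time_measure_gt0 T0) _.
rewrite /time_measure /mrestr !setTI; apply: le_measure; rewrite ?inE.
- exact: measurable_time.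
- exact: measurable_time.
- by move=> t /= /andP[-> /lt_le_trans]; apply.
Qed.

Lemma Linfty_normP (T : R) (T' : \bar R) (h : R -> R -> R) (y : \bar R) : 0 < T ->
  (T%:E <= T')%E -> (Linfty_norm T' h <= y)%E <->
  {ae mu, forall t, (0 < t%:E < T')%E -> (torus_norm +oo (h t) <= y)%E}.
Proof.
move=> T0 TT'.
rewrite -(ae_mrestr (measurable_time T')) /Linfty_norm unlock /Lnorm.
rewrite (le_time_measure_gt0 T0 TT').
have E : abse \o (fun t => torus_norm +oo (h t)) = fun t => torus_norm +oo (h t).
  by apply/funext => t /=; rewrite gee0_abs// torus_norm_ge0.
by rewrite E; split => /ess_supP.
Qed.

Lemma le_Linfty_norm (T : R) (T' : \bar R) (h : R -> R -> R) : 0 < T ->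
  (T%:E <= T')%E -> (Linfty_norm T%:E h <= Linfty_norm T' h)%E.
Proof.
move=> T0 TT'; apply/(Linfty_normP _ _ T0 (lexx _)).
have := lexx (Linfty_norm T' h); move/(Linfty_normP _ _ T0 TT').
apply: (@filterS _ _ (ae_filter_ringOfSetsType mu)) => t + /andP[t0 tT].
by apply; rewrite t0 (lt_le_trans tT).
Qed.

Lemma Linfty_norm_ge0 (T : \bar R) (h : R -> R -> R) : (0 <= Linfty_norm T h)%E.
Proof. exact: Lnorm_ge0. Qed.

Lemma torus_norm_infP (f : R -> R) (y : \bar R) :
  (torus_norm +oo f <= y)%E <-> {ae mu, forall x, torus x -> (`|f x|%:E <= y)%E}.
Proof.
rewrite -(ae_mrestr measurable_torus) /torus_norm unlock /Lnorm.
rewrite [X in (0 < X)%E](_ : _ = 1%E) ?lte01; last first.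
  by transitivity (mu (setT `&` torus)) => //; rewrite setTI torus_measure.
by split => /ess_supP.
Qed.

(** In L^oo(0, T; L^oo) being bounded means being bounded at almost every point
    of almost every time slice. Truncation at the norm changes nothing almost
    everywhere and gives a bound everywhere. *)
Lemma Linfty_representative (Tstar : \bar R) (T : R) (h : R -> R -> R) :
  0 < T -> (T%:E < Tstar)%E -> Linfty_space Tstar h ->
  exists hb : R -> R -> R, exists N : R,
  [/\ Linfty_norm T%:E h = N%:E,
      measurable_fun setT (fun z : R * R => hb z.1 z.2),
      (forall t x, `|hb t x| <= N) &
      forall phi : R -> R -> R, jcont phi ->
        (forall a b, 0 < a -> b < T -> 
          (forall t x, ~~ (a <= t <= b) -> phi t x = 0) ->
          pairing Tstar h phi =
          \int[mu]_(t in `]0, T]) \int[mu]_(x in torus) (hb t x * phi t x))].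
Proof.
move=> T0 TT [_ mh hfin].
have hT : (Linfty_norm T%:E h < +oo)%E.
  by apply: le_lt_trans hfin; apply: le_Linfty_norm => //; exact: ltW.
have [N NE] : exists N, Linfty_norm T%:E h = N%:E.
  exists (fine (Linfty_norm T%:E h)); rewrite fineK// ge0_fin_numE//.
  exact: Linfty_norm_ge0.
have N0 : 0 <= N by rewrite -lee_fin -NE Linfty_norm_ge0.
pose D : set (R * R) := [set z | (0 < z.1%:E < Tstar)%E].
have mD : measurable D.
  rewrite (_ : D = [set t : R | (0 < t%:E < Tstar)%E] `*` setT).
    by apply: measurableX => //; exact: measurable_time.
  by apply/seteqP; split => [z Dz|z [Dz _]].
pose h2 (t x : R) : R := ((fun z => h z.1 z.2) \_ D) (t, x).
have mh2 : measurable_fun setT (fun z : R * R => h2 z.1 z.2).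
  rewrite (_ : (fun z => _) = (fun z => h z.1 z.2) \_ D); last first.
    by apply/funext => -[].
  by apply/(measurable_restrictT _ mD).
have h2E t x : 0 < t -> (t%:E < Tstar)%E -> h2 t x = h t x.
  by move=> t0 tT; rewrite /h2 patchE mem_set//= /D /= lte_fin t0 tT.
pose hb t x := clamp (- N) N (h2 t x).
have mhb : measurable_fun setT (fun z : R * R => hb z.1 z.2).
  apply: (measurableT_comp (f := clamp (- N) N)) => //.
  by apply: continuous_measurable_fun; exact: continuous_clamp.
exists hb, N; split; [exact: NE|exact: mhb| |].
  by move=> t x; rewrite ler_norml /hb clamp_itv//; lra.
move=> phi cphi a b a0 bT sphi.
have mphi := jcont_measurable cphi.
pose F (t : R) := \int[mu]_(x in torus) (h2 t x * phi t x).
rewrite /pairing; transitivity (\int[mu]_(t in `]0, T]) F t).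
  rewrite Rintegral_mkcond [RHS]Rintegral_mkcond; congr Rintegral.
  apply/funext => t; rewrite !patchE.
  have [/andP[ta tb]|/sphi phi0] := boolP (a <= t <= b); last first.
    have z (f : R -> R) : \int[mu]_(x in torus) (f x * phi t x) = 0.
      by apply: Rintegral_eq0 => x _; rewrite phi0 mulr0.
    by rewrite /F !z !if_same.
  have t0 : 0 < t by exact: lt_le_trans ta.
  have tT : t < T by exact: le_lt_trans tb bT.
  have tTs : (t%:E < Tstar)%E by apply: lt_trans TT; rewrite lte_fin.
  rewrite mem_set/= ?lte_fin ?t0// mem_set/= ?in_itv/= ?t0 ?(ltW tT)//.
  by apply: eq_Rintegral => x _; rewrite h2E.
have mhphi (k : R -> R -> R) : measurable_fun setT (fun z : R * R => k z.1 z.2) ->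
    measurable_fun setT (fun z : R * R => k z.1 z.2 * phi z.1 z.2).
  by move=> mk; exact: measurable_funM.
have mF (k : R -> R -> R) : measurable_fun setT (fun z : R * R => k z.1 z.2) ->
    measurable_fun setT (fun t => \int[mu]_(x in torus) (k t x * phi t x)).
  by move=> mk; exact: (measurable_Rintegral_torus (mhphi _ mk)).
have msec (k : R -> R -> R) t : measurable_fun setT (fun z : R * R => k z.1 z.2) ->
    measurable_fun (@torus R) (fun x => k t x * phi t x).
  move=> mk; apply: measurable_funTS.
  exact: (measurable_fun_pair2 t (mhphi _ mk)).
apply: eq_Rintegral_ae => //.
- by apply: measurable_funTS; exact: mF.
- by apply: measurable_funTS; exact: mF.
have := lexx (Linfty_norm T%:E h); rewrite [in X in (_ <= X)%E]NE.
move/(Linfty_normP _ _ T0 (lexx _)).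
apply: (@filterS _ _ (ae_filter_ringOfSetsType mu)) => t hN /=.
rewrite in_itv /= => /andP[t0 tT].
have [tltT|Tt] := ltP t T; last first.
  have phi0 x : phi t x = 0.
    by apply: sphi; rewrite negb_and -!ltNge (lt_le_trans bT Tt) orbT.
  by rewrite /F !Rintegral_eq0// => x _; rewrite phi0 mulr0.
apply: eq_Rintegral_torus_ae; [exact: msec|exact: msec|].
have {hN} := hN; rewrite !lte_fin t0 tltT => /(_ isT)/torus_norm_infP.
apply: (@filterS _ _ (ae_filter_ringOfSetsType mu)) => x hN tx.
have {hN} := hN tx; rewrite lee_fin ler_norml => hN.
have tTs : (t%:E < Tstar)%E by apply: lt_trans TT; rewrite lte_fin.
by rewrite /hb clamp_id ?h2E.
Qed.

End BoundedRepresentative.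

(** * Powers and the internal energy *)


Section Powers.
Context {R : realType}.
Implicit Types (y a b : R).

Lemma powR_add y a b : 0 < y -> y `^ (a + b) = y `^ a * y `^ b.
Proof. by move=> y0; rewrite powRD//; apply/implyP => _; rewrite gt_eqF. Qed.

Lemma powR_addn y a (n : nat) : 0 < y -> y `^ (a + n%:R) = y `^ a * y ^+ n.
Proof. by move=> y0; rewrite powR_add// powR_mulrn ?ltW. Qed.

Lemma continuous_powR_gt0 a y : 0 < y -> {for y, continuous (fun z : R => z `^ a)}.
Proof.
move=> y0; apply/differentiable_continuous/derivable1_diffP.
by case: (is_derive1_powR a y0).
Qed.

Lemma powR_le1D y a : 0 < y -> 0 <= a -> a <= 1 -> y `^ a <= 1 + y.
Proof.
move=> y0 a0 a1; have [y1|y1] := leP 1 y.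
  by apply: le_trans (ler1_powR y1 a1) _; lra.
have : y `^ a <= 1 `^ a by apply: ge0_ler_powR => //; rewrite ?nnegrE ltW.
by rewrite powR1; lra.
Qed.

Lemma le_1D_powR y a : 0 < y -> 1 <= a -> y <= 1 + y `^ a.
Proof.
move=> y0 a1; have p0 := powR_ge0 y a; have [y1|y1] := leP 1 y; last by lra.
by have := le1r_powR y1 a1; lra.
Qed.

End Powers.

Lemma ln_leB1 {R : realType} (y : R) : 0 < y -> ln y <= y - 1.
Proof.
by move=> y0; rewrite -{1}[y](subrK 1) addrC; apply: le_ln1Dx; lra.
Qed.

Section InternalEnergy.
Context {R : realType}.
Context (cp ga : R) (cp0 : 0 < cp) (ga1 : 1 <= ga).

(** The enthalpy and the internal energy of the barotropic gas: antiderivatives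
    of [p'(y) / y] and of the enthalpy; both become logarithmic when the
    adiabatic exponent is 1. *)
Definition enthalpy (y : R) : R :=
  if ga == 1 then cp * (ln y + 1) else cp * ga / (ga - 1) * y `^ (ga - 1).

Definition internal_energy (y : R) : R :=
  if ga == 1 then cp * (y * ln y) else cp / (ga - 1) * y `^ ga.

Lemma is_derive_enthalpy (y : R) : 0 < y ->
  is_derive y 1 enthalpy (cp * ga * y `^ (ga - 1) / y).
Proof.
move=> y0; rewrite /enthalpy; have [E|ne] := eqVneq ga 1.
  have h := is_derive1Zl cp (is_derive1D (is_derive1_ln y0) (is_derive_cst (1 : R) y 1)).
  by apply: (is_derive_eq h); rewrite E subrr powRr0; ring.
have h := is_derive1Zl (cp * ga / (ga - 1)) (is_derive1_powR (ga - 1) y0).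
apply: (is_derive_eq h).
have -> : y `^ (ga - 1) = y `^ (ga - 1 - 1) * y.
  by have := powR_addn (ga - 1 - 1) 1 y0; rewrite subrK expr1.
by field; rewrite subr_eq0 ne gt_eqF.
Qed.

Lemma is_derive_internal_energy (y : R) : 0 < y ->
  is_derive y 1 internal_energy (enthalpy y).
Proof.
move=> y0; rewrite /internal_energy /enthalpy; have [E|ne] := eqVneq ga 1.
  have h := is_derive1Zl cp (is_derive1M (is_derive_id y 1) (is_derive1_ln y0)).
  by apply: (is_derive_eq h); rewrite /=; field; rewrite gt_eqF.
have h := is_derive1Zl (cp / (ga - 1)) (is_derive1_powR ga y0).
by apply: (is_derive_eq h); field; rewrite subr_eq0.
Qed.

(** Only the logarithmic case takes negative values, by at most [cp]. *)
Lemma internal_energy_ge (y : R) : 0 < y -> - cp <= internal_energy y.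
Proof.
move=> y0; rewrite /internal_energy; case: eqVneq => [_|ne].
  have : ln y^-1 <= y^-1 - 1 by apply: ln_leB1; rewrite invr_gt0.
  rewrite lnV ?posrE// => h.
  have : y * - ln y <= y * (y^-1 - 1) by rewrite ler_pM2l.
  rewrite mulrBr mulfV ?gt_eqF// mulrN mulr1 => {}h.
  have h1 : 0 <= 1 + y * ln y by lra.
  by have := mulr_ge0 (ltW cp0) h1; lra.
have g1 : 1 < ga by rewrite lt_neqAle eq_sym ne.
have : 0 <= cp / (ga - 1) * y `^ ga.
  by rewrite mulr_ge0 ?powR_ge0// divr_ge0 ?ltW// subr_gt0.
by apply: le_trans; rewrite oppr_le0 ltW.
Qed.

(** In the logarithmic case the bound comes from [ln y <= y - 1]. *)
Definition energy_bound (m : R) : R :=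
  if ga == 1 then cp * m ^+ 2 else cp / (ga - 1) * m `^ ga.

Lemma internal_energy_le (y m : R) : 0 < y -> y <= m ->
  internal_energy y <= energy_bound m.
Proof.
move=> y0 ym; rewrite /internal_energy /energy_bound; case: eqVneq => [_|ne].
  have h : ln y <= y by have := ln_leB1 y0; lra.
  have : y * ln y <= y * y by rewrite ler_pM2l.
  by move=> h'; rewrite ler_pM2l//; nra.
have g1 : 1 < ga by rewrite lt_neqAle eq_sym ne.
apply: ler_wpM2l; first by rewrite divr_ge0 ?subr_ge0// ltW.
by apply: ge0_ler_powR; rewrite ?nnegrE; lra.
Qed.

End InternalEnergy.

(** * Integrals over space and time *)


Section SpaceTimeIntegral.
Context {R : realType}.
Notation mu := (@lebesgue_measure R).

Definition dint (a b : R) (F : R -> R -> R) : R :=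
  \int[mu]_(t in `]a, b]) \int[mu]_(x in torus) F t x.

(** Measurability is asked on the plane, so that slices and space integrals are
    measurable; the bound is asked on the closed slab, where jointly continuous
    functions satisfy it. *)
Definition bmeas (a b : R) (F : R -> R -> R) : Prop :=
  measurable_fun setT (fun z : R * R => F z.1 z.2) /\
  exists N, forall t x, a <= t <= b -> 0 <= x <= 1 -> `|F t x| <= N.

Lemma jcont_bmeas a b F : jcont F -> bmeas a b F.
Proof.
move=> jF; split; first exact: jcont_measurable.
by have [N _ FN] := jcont_bound a b jF; exists N.
Qed.

Lemma bmeasD a b F G : bmeas a b F -> bmeas a b G ->
  bmeas a b (fun t x => F t x + G t x).
Proof.
move=> [mF [N FN]] [mG [N' GN]]; split; first exact: measurable_funD.
exists (N + N') => t x tab x01; apply: le_trans (ler_normD _ _) _.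
by apply: lerD; [exact: FN|exact: GN].
Qed.

Lemma bmeasM a b F G : bmeas a b F -> bmeas a b G ->
  bmeas a b (fun t x => F t x * G t x).
Proof.
move=> [mF [N FN]] [mG [N' GN]]; split; first exact: measurable_funM.
exists (N * N') => t x tab x01; rewrite normrM.
by apply: ler_pM => //; [exact: FN|exact: GN].
Qed.

Lemma bmeasN a b F : bmeas a b F -> bmeas a b (fun t x => - F t x).
Proof.
move=> [mF [N FN]]; split; first exact: measurableT_comp.
by exists N => t x tab x01; rewrite normrN; exact: FN.
Qed.

Lemma bmeas_slice a b F t : bmeas a b F -> a <= t <= b ->
  mu.-integrable torus (EFin \o F t).
Proof.
move=> [mF [N FN]] tab; apply: (@bounded_integrable _ _ _ N) => //.
- exact: torus_measure_lty.
- by apply: measurable_funTS; exact: (measurable_fun_pair2 t mF).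
- move=> x; rewrite /torus /= in_itv /= => /andP[/ltW x0 x1].
  by apply: FN => //; rewrite x0.
Qed.

Lemma bmeas_integrable a b F : bmeas a b F ->
  mu.-integrable `]a, b] (EFin \o (fun t => \int[mu]_(x in torus) F t x)).
Proof.
move=> [mF [N FN]]; apply: (@bounded_integrable _ _ _ N) => //.
- exact: itv_measure_lty.
- by apply: measurable_funTS; exact: measurable_Rintegral_torus.
- move=> t /=; rewrite in_itv /= => /andP[/ltW at_ tb].
  apply: Rintegral_torus_bound => [|x x01]; last by apply: FN => //; rewrite at_.
  by apply: measurable_funTS; exact: (measurable_fun_pair2 t mF).
Qed.

Lemma eq_dint a b F G : (forall t x, a < t <= b -> 0 < x <= 1 -> F t x = G t x) ->
  dint a b F = dint a b G.
Proof.
move=> FG; apply: eq_Rintegral => t; rewrite inE /= in_itv /= => tab.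
apply: eq_Rintegral => x; rewrite inE /torus /= in_itv /= => x01.
exact: FG.
Qed.

Lemma dintD a b F G : bmeas a b F -> bmeas a b G ->
  dint a b (fun t x => F t x + G t x) = dint a b F + dint a b G.
Proof.
move=> bF bG; rewrite /dint -RintegralD//; try exact: bmeas_integrable.
apply: eq_Rintegral => t; rewrite inE /= in_itv /= => /andP[/ltW at_ tb].
have tab : a <= t <= b by rewrite at_.
by rewrite RintegralD//; [exact: bmeas_slice bF tab|exact: bmeas_slice bG tab].
Qed.

Lemma dintN a b F : bmeas a b F -> dint a b (fun t x => - F t x) = - dint a b F.
Proof.
move=> bF; have := dintD bF (bmeasN bF).
rewrite [LHS](_ : _ = 0); first by lra.
apply: Rintegral_eq0 => t _; apply: Rintegral_eq0 => x _.
by rewrite subrr.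
Qed.

Lemma le_dint a b F G : bmeas a b F -> bmeas a b G ->
  (forall t x, a <= t <= b -> 0 <= x <= 1 -> F t x <= G t x) ->
  dint a b F <= dint a b G.
Proof.
move=> bF bG FG; apply: le_Rintegral => //; try exact: bmeas_integrable.
move=> t /=; rewrite in_itv /= => /andP[/ltW at_ tb].
have tab : a <= t <= b by rewrite at_.
apply: le_Rintegral => //; [exact: bmeas_slice bF tab|exact: bmeas_slice bG tab|].
move=> x; rewrite /torus /= in_itv /= => /andP[/ltW x0 x1].
by apply: FG => //; rewrite x0.
Qed.

Lemma dint_static a b (k : R -> R) : a <= b ->
  dint a b (fun _ x => k x) = (b - a) * \int[mu]_(x in torus) k x.
Proof.
move=> ab; rewrite /dint Rintegral_cst// mulrC; congr (_ * _).
rewrite [X in fine X]lebesgue_measure_itv /= lte_fin.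
by case: ltP => // ba; rewrite (@le_anti _ _ a b) ?ab ?subrr.
Qed.

Lemma dint_split a b c F : a <= b -> b <= c -> bmeas a c F ->
  dint a c F = dint a b F + dint b c F.
Proof. by move=> ab bc bF; apply: Rintegral_split_itv => //; exact: bmeas_integrable. Qed.

End SpaceTimeIntegral.

(** * The work of the potential *)


Section Work.
Context {R : realType}.
Notation mu := (@lebesgue_measure R).

Lemma integrable_itv_mulr (k h : R -> R) (a b : R) :
  mu.-integrable `]a, b] (EFin \o k) -> continuous h ->
  mu.-integrable `]a, b] (EFin \o (fun t => k t * h t)).
Proof.
move=> ik ch; have [N _ HN] := jcont_bound a b (jcont_t ch).
apply: (@integrable_mulr _ _ _ _ N) => //.
  by apply: measurable_funTS; exact: continuous_measurable_fun.
move=> t /=; rewrite in_itv /= => /andP[/ltW at_ tb].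
by apply: (HN t 0); rewrite ?at_ ?lexx ?ler01.
Qed.

Lemma dint_mulr (F : R -> R -> R) (th : R -> R) (a b : R) : bmeas a b F ->
  dint a b (fun t x => F t x * th t) =
  \int[mu]_(t in `]a, b]) ((\int[mu]_(x in torus) F t x) * th t).
Proof.
move=> bF; apply: eq_Rintegral => t; rewrite inE /= in_itv /= => /andP[/ltW at_ tb].
have tt : a <= t <= b by rewrite at_.
by rewrite RintegralZr//; exact: bmeas_slice bF tt.
Qed.

Lemma weighted_mass_le (r h : R -> R -> R) (N M t : R) : jcont r ->
  (forall x, 0 < r t x) -> \int[mu]_(x in torus) r t x = M ->
  measurable_fun setT (fun z : R * R => h z.1 z.2) -> (forall t x, `|h t x| <= N) ->
  `|\int[mu]_(x in torus) (h t x * r t x)| <= N * M.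
Proof.
move=> jr r0 HM mh hN.
have bh : bmeas t t h by split => //; exists N.
have tt : t <= t <= t by rewrite lexx.
have ih := bmeas_slice (bmeasM bh (jcont_bmeas t t jr)) tt.
have ir := continuous_integrable_torus (jcont_sect (t := t) jr).
apply: le_trans (le_normr_Rintegral _ ih) _ => //.
rewrite -HM -RintegralZl//; apply: le_Rintegral => //; first exact: integrable_norm.
  exact: integrable_scalerl.
move=> x _; rewrite normrM (gtr0_norm (r0 x)).
by apply: ler_wpM2r => //; exact: ltW.
Qed.

Context (T M Ng Ngt : R) (r rt g gt : R -> R -> R).
Context (jr : jcont r) (jrt : jcont rt).
Context (r0 : forall t x, 0 < r t x)
  (HM : forall t, 0 < t < T -> \int[mu]_(x in torus) r t x = M).
Context (mg : measurable_fun setT (fun z : R * R => g z.1 z.2))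
  (gN : forall t x, `|g t x| <= Ng).
Context (mgt : measurable_fun setT (fun z : R * R => gt z.1 z.2))
  (gtN : forall t x, `|gt t x| <= Ngt).
Context (Hgt : forall h a b, 0 < h -> 0 < a -> a + h <= b -> b + h < T ->
  dint 0 T (fun t x => g t x * (rt t x * trap h a b t + r t x * dtrap h a b t)) =
  - dint 0 T (fun t x => gt t x * (r t x * trap h a b t))).

(** Testing the time derivative of [g] with the density times a trapezoid moves
    the time derivative off the density. Then only the total mass enters: the
    edges of the trapezoid carry the total mass of two point masses in time,
    and the plateau the time integral of [gt]. *)
Lemma work_le (a b : R) : 0 < a -> a < b -> b < T ->
  dint a b (fun t x => g t x * rt t x) <= 2 * Ng * M + Ngt * M * (b - a).
Proof.
move=> a0 ab bT.
have T0 : 0 < T by lra.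
have M0 : 0 <= M.
  have abT : 0 < b < T by rewrite bT (lt_trans a0).
  by rewrite -(HM abT); apply: Rintegral_ge0 => x _; exact: ltW.
have Ng0 : 0 <= Ng := le_trans (normr_ge0 _) (gN 0 0).
have Ngt0 : 0 <= Ngt := le_trans (normr_ge0 _) (gtN 0 0).
have bg : bmeas 0 T g by split => //; exists Ng.
have bgt : bmeas 0 T gt by split => //; exists Ngt.
have bj H : jcont H -> bmeas 0 T H by exact: jcont_bmeas.
have b1 : bmeas 0 T (fun t x => g t x * rt t x) by apply: bmeasM => //; exact: bj.
have b2 : bmeas 0 T (fun t x => g t x * r t x) by apply: bmeasM => //; exact: bj.
have b3 : bmeas 0 T (fun t x => gt t x * r t x) by apply: bmeasM => //; exact: bj.
pose B1 t := \int[mu]_(x in torus) (g t x * rt t x).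
pose B2 t := \int[mu]_(x in torus) (g t x * r t x).
pose B3 t := \int[mu]_(x in torus) (gt t x * r t x).
have [N1 N10 B1N] : exists2 N, 0 <= N & forall t, 0 < t <= T -> `|B1 t| <= N.
  have [mq [N qN]] := b1.
  have bd t : 0 < t <= T -> `|B1 t| <= N.
    move=> /andP[t0 tT]; apply: Rintegral_torus_bound.
      by apply: measurable_funTS; exact: (measurable_fun_pair2 t mq).
    by move=> x x01; apply: qN => //; rewrite ltW.
  by exists N => //; apply: le_trans (normr_ge0 _) (bd T _); rewrite T0 lexx.
apply/ler_addgt0Pr => e e0.
(* The edges of a trapezoid of width [h] contribute an error of at most [c *
   h]. *)
pose c := 2 * N1 + 2 * (Ngt * M) + 1.
have c0 : 0 < c by rewrite /c; have := mulr_ge0 Ngt0 M0; lra.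
pose h := Num.min (Num.min ((b - a) / 2) ((T - b) / 2)) (e / c).
have [h0 hab hT hc] : [/\ 0 < h, a + h <= b, b + h < T & h * c <= e].
  split.
  - by rewrite !lt_min !divr_gt0 ?subr_gt0.
  - by rewrite addrC -lerBrDr /h !ge_min; apply/orP; left; apply/orP; left; lra.
  - by rewrite addrC -ltrBrDr /h !gt_min; apply/orP; left; apply/orP; right; lra.
  - by rewrite -ler_pdivlMr// /h ge_min lexx orbT.
have ct := @continuous_trap R h a b; have cdt := @continuous_dtrap R h a b.
have E1 : dint 0 T (fun t x => g t x * (rt t x * trap h a b t + r t x * dtrap h a b t)) =
    \int[mu]_(t in `]0, T]) (B1 t * trap h a b t) +
    \int[mu]_(t in `]0, T]) (B2 t * dtrap h a b t).
  rewrite (eq_dint (G := fun t x => g t x * rt t x * trap h a b t +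
    g t x * r t x * dtrap h a b t)); last by move=> t x _ _; ring.
  rewrite dintD ?dint_mulr//.
  - by apply: bmeasM => //; apply: bj; exact: jcont_t.
  - by apply: bmeasM => //; apply: bj; exact: jcont_t.
have E3 : dint 0 T (fun t x => gt t x * (r t x * trap h a b t)) =
    \int[mu]_(t in `]0, T]) (B3 t * trap h a b t).
  rewrite (eq_dint (G := fun t x => gt t x * r t x * trap h a b t)).
    by rewrite dint_mulr.
  by move=> t x _ _; ring.
have := Hgt h0 a0 hab hT; rewrite E1 E3 => {E1 E3}.
have mB1 : measurable_fun setT B1 by case: b1 => m _; exact: measurable_Rintegral_torus.
have i2 := integrable_itv_mulr (bmeas_integrable b2) cdt.
have i3 := integrable_itv_mulr (bmeas_integrable b3) ct.
have cdr s : continuous (fun t : R => dramp ((t - s) / h) / h).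
  exact: continuous_dramp_scaled.
have I1 : `|\int[mu]_(t in `]0, T]) (B1 t * trap h a b t) -
    dint a b (fun t x => g t x * rt t x)| <= 2 * N1 * h.
  by apply: Rintegral_trap => //; [exact: ltW|exact: ltW].
have I2 : `|\int[mu]_(t in `]0, T]) (B2 t * dtrap h a b t)| <= 2 * Ng * M.
  have -> : 2 * Ng * M = \int[mu]_(t in `]0, T])
      (Ng * M * (dramp ((t - a) / h) / h + dramp ((t - b) / h) / h)).
    have ik s : mu.-integrable `]0, T] (EFin \o (fun t => dramp ((t - s) / h) / h)).
      exact: continuous_integrable_itv.
    rewrite RintegralZl//; last exact: integrable_addr.
    rewrite RintegralD// !Rintegral_dramp//; [by ring|lra..].
  apply: le_trans (le_normr_Rintegral _ i2) _ => //.
  apply: le_Rintegral => //; first exact: integrable_norm.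
    apply: continuous_integrable_itv => t; apply: cvgM; first exact: cvg_cst.
    by apply: cvgD; exact: cdr.
  move=> t /=; rewrite in_itv /= => /andP[t0 tT].
  have kp s : 0 <= dramp ((t - s) / h) / h by rewrite divr_ge0 ?dramp_ge0// ltW.
  rewrite normrM; have [tlT|Tlt] := ltP t T; last first.
    rewrite /dtrap !dramp_eq0 ?mul0r ?subr0 ?normr0 ?mulr0 ?add0r ?mulr0//.
      by right; rewrite ler_pdivlMr//; lra.
    by right; rewrite ler_pdivlMr//; lra.
  apply: ler_pM => //; first by apply: weighted_mass_le => //; apply: HM; rewrite t0.
  by apply: le_trans (ler_normB _ _) _; rewrite !ger0_norm.
have I3 : `|\int[mu]_(t in `]0, T]) (B3 t * trap h a b t)| <=
    Ngt * M * (b - a + 2 * h).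
  have it : mu.-integrable `]0, T] (EFin \o trap h a b) by exact: continuous_integrable_itv.
  have tr : \int[mu]_(t in `]0, T]) trap h a b t <= b - a + 2 * h.
    have : `|\int[mu]_(t in `]0, T]) (cst 1 t * trap h a b t) -
        \int[mu]_(t in `]a, b]) cst 1 t| <= 2 * 1 * h.
      apply: Rintegral_trap => //; [exact: ltW|exact: ltW|].
      by move=> t _; rewrite normr1.
    rewrite Rintegral_cst// mul1r [X in fine X]lebesgue_measure_itv /= lte_fin ab /=.
    under eq_Rintegral do rewrite mul1r.
    by rewrite ler_norml => /andP[_]; lra.
  apply: le_trans (_ : Ngt * M * \int[mu]_(t in `]0, T]) trap h a b t <= _); last first.
    by apply: ler_wpM2l => //; exact: mulr_ge0.
  apply: le_trans (le_normr_Rintegral _ i3) _ => //; rewrite -RintegralZl//.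
  apply: le_Rintegral => //; [exact: integrable_norm|exact: integrable_scalerl|].
  move=> t /=; rewrite in_itv /= => /andP[t0 tT].
  have /andP[p0 _] := @trap_itv01 _ h a b t h0 hab.
  rewrite normrM (ger0_norm p0).
  have [tlT|Tlt] := ltP t T.
    by apply: ler_wpM2r => //; apply: weighted_mass_le => //; apply: HM; rewrite t0.
  rewrite trap_out ?mulr0 ?normr0//; first exact: ltW.
  by rewrite negb_and -!ltNge; apply/orP; right; lra.
move: I1 I2 I3 hc; rewrite /c; set J1 := Rintegral _ _ _; set J2 := Rintegral _ _ _.
set J3 := Rintegral _ _ _; set J := dint _ _ _ => I1 I2 I3 hc E.
have E' : J1 = - J3 - J2 by rewrite -E; ring.
move: I1 I2 I3 E' hc; rewrite !ler_norml => /andP[I1 _] /andP[I2 _] /andP[I3 _] E' hc.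
move: I1 I2 I3 E' hc h0; clear; move: J1 J2 J3 J => J1 J2 J3 J; move: h => h.
by move: (Ngt * M) => x I1 I2 I3 E' hc h0; lra.
Qed.

End Work.

(** * The energy inequality for the effective velocity *)


Lemma continuous_ge0_closure {R : realType} (F : R -> R) (a b : R) : continuous F ->
  a < b -> (forall t, a < t < b -> 0 <= F t) -> forall t, a <= t <= b -> 0 <= F t.
Proof.
move=> cF ab F0 t /andP[at_ tb]; rewrite leNgt; apply/negP => Ft.
have /cvgrPdist_lt /(_ (- F t)) := cF t; rewrite oppr_gt0 => /(_ Ft).
case/nbhs_ballP => d /= d0 Hd.
have [s sd sab] : exists2 s, `|t - s| < d & a < s < b.
  pose k : R := Num.min d (b - a) / 3.
  have k0 : 0 < k by rewrite divr_gt0// lt_min d0 subr_gt0.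
  have kd : k < d by rewrite ltr_pdivrMr// gt_min ltr_pMr// ltr1n.
  have kb : k <= (b - a) / 3 by rewrite ler_pM2r// ge_min lexx orbT.
  have [ta|ta] := leP t ((a + b) / 2).
    exists (t + k); last by apply/andP; split; lra.
    by rewrite opprD addrA subrr sub0r normrN gtr0_norm.
  by exists (t - k); [rewrite subKr gtr0_norm|apply/andP; split; lra].
have := Hd s sd => /=; have := F0 s sab; rewrite ltr_norml => ? /andP[]; lra.
Qed.

(** The setting is a positive density [r] and a velocity [u] with continuous
    space derivatives, where the density solves the continuity equation
    pointwise. The momentum equation and the relation between the force [f] and
    its potential [g] hold between any two times against test functions of
    space. *)
Section Flow.
Context {R : realType}.
Notation mu := (@lebesgue_measure R).
Context (cp cmu al ga T : R).
Context (cp0 : 0 < cp) (cmu0 : 0 < cmu) (al_gt0 : 0 < al) (T0 : 0 < T).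
Context (ga_ge1 : 1 <= ga) (al_le_ga : al <= ga) (ga_le : ga <= al + 1).
Context (r rx rxx u ux : R -> R -> R).
Context (jr : jcont r) (jrx : jcont rx) (jrxx : jcont rxx) (ju : jcont u) (jux : jcont ux).
Context (pr : forall t, periodic1 (r t)) (prx : forall t, periodic1 (rx t))
  (pu : forall t, periodic1 (u t)).
Context (dr : forall t (x : R), is_derive x 1 (r t) (rx t x))
  (drx : forall t (x : R), is_derive x 1 (rx t) (rxx t x))
  (du : forall t (x : R), is_derive x 1 (u t) (ux t x)).
Context (r0 : forall t x, 0 < r t x).

(** The time derivative of the density according to the continuity equation. *)
Definition mass_rate (t x : R) : R := - (ux t x * r t x + u t x * rx t x).

Lemma jcont_density_powR a : jcont (fun t x => r t x `^ a).
Proof.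
by apply: (@jcont_comp R (fun y : R => y `^ a)) => // t x; exact: continuous_powR_gt0.
Qed.

Lemma is_derive_density_powR a t (x : R) : is_derive x 1 (fun y => r t y `^ a) (a * r t x
  `^ (a - 1) * rx t x).
Proof. by apply: (@is_derive1c _ (fun y : R => y `^ a)); exact: is_derive1_powR. Qed.

Definition visc_flux (t x : R) : R := cmu * (r t x `^ (al - 1) * rx t x).

(** The effective velocity of Bresch and Desjardins. *)
Definition eff_vel (t x : R) : R := u t x + cmu * (r t x `^ (al - 2) * rx t x).

Definition eff_vel_x (t x : R) : R :=
  ux t x + cmu * ((al - 2) * r t x `^ (al - 2 - 1) * rx t x * rx t x +
                  r t x `^ (al - 2) * rxx t x).

Definition visc_pot (y : R) : R := cmu / al * y `^ al.

Definition stress (t x : R) : R :=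
  r t x * (u t x * u t x) + cp * r t x `^ ga - cmu * r t x `^ al * ux t x.

Definition dissip (t x : R) : R :=
  cp * cmu * ga * (r t x `^ (ga + al - 3) * (rx t x * rx t x)).

Definition enth (t x : R) : R := enthalpy cp ga (r t x).

Definition energy_density (t x : R) : R :=
  2^-1 * (r t x * (eff_vel t x * eff_vel t x)) + internal_energy cp ga (r t x).

Ltac jc := lazymatch goal with
  | |- jcont (fun t x => _ + _) => apply: jcontD; jc
  | |- jcont (fun t x => - _) => apply: jcontN; jc
  | |- jcont (fun t x => _ * _) => apply: jcontM; jc
  | |- jcont (fun t x => _ `^ _) => exact: jcont_density_powR
  | |- jcont (fun t x => _ _ _) => first [assumption | exact: jcont_cst]
  | |- jcont (fun t x => _) => exact: jcont_cst
  | |- _ => assumption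
  end.

Lemma jcont_mass_rate : jcont mass_rate. Proof. by rewrite /mass_rate; jc. Qed.
Lemma jcont_visc_flux : jcont visc_flux. Proof. by rewrite /visc_flux; jc. Qed.
Lemma jcont_eff_vel : jcont eff_vel. Proof. by rewrite /eff_vel; jc. Qed.
Lemma jcont_eff_vel_x : jcont eff_vel_x. Proof. by rewrite /eff_vel_x; jc. Qed.
Lemma jcont_stress : jcont stress. Proof. by rewrite /stress; jc. Qed.
Lemma jcont_dissip : jcont dissip. Proof. by rewrite /dissip; jc. Qed.

Lemma jcont_enth : jcont enth.
Proof.
apply: (@jcont_comp R (enthalpy cp ga)) => // t x.
apply/differentiable_continuous/derivable1_diffP.
by case: (is_derive_enthalpy cp ga (r0 t x)).
Qed.

Lemma jcont_energy_density : jcont energy_density.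
Proof.
rewrite /energy_density; have jv := jcont_eff_vel; apply: jcontD; first by jc.
apply: (@jcont_comp R (internal_energy cp ga)) => // t x.
apply/differentiable_continuous/derivable1_diffP.
by case: (is_derive_internal_energy cp ga (r0 t x)).
Qed.

Lemma is_derive_eff_vel t (x : R) : is_derive x 1 (eff_vel t) (eff_vel_x t x).
Proof.
have h := is_derive1D (du t x)
  (is_derive1Zl cmu (is_derive1M (is_derive_density_powR (al - 2) t x) (drx t x))).
exact: (is_derive_eq h).
Qed.

Lemma periodic_eff_vel t : periodic1 (eff_vel t).
Proof. by move=> x; rewrite /eff_vel pu pr prx. Qed.

Lemma C1_torus_eff_vel t : C1_torus (eff_vel t) /\ derive1 (eff_vel t) = eff_vel_x t.
Proof.
apply: C1_torus_is_derive; [exact: periodic_eff_vel|exact: is_derive_eff_vel|].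
exact: jcont_sect jcont_eff_vel_x.
Qed.

Lemma C1_torus_momentum t : C1_torus (fun x => r t x * u t x) /\
  derive1 (fun x => r t x * u t x) = fun x => - mass_rate t x.
Proof.
apply: C1_torus_is_derive.
- by move=> x; rewrite pr pu.
- move=> x; apply: (is_derive_eq (is_derive1M (dr t x) (du t x))).
  by rewrite /mass_rate; ring.
- by move=> x; apply: cvgN; exact: jcont_sect jcont_mass_rate x.
Qed.

Lemma is_derive_visc_pot t (x : R) : is_derive x 1 (fun y => visc_pot (r t y)) (visc_flux t x).
Proof.
apply: (is_derive_eq (is_derive1Zl (cmu / al) (is_derive_density_powR al t x))).
by rewrite /visc_flux; field; rewrite gt_eqF.
Qed.

Lemma density_eff_vel t x : r t x * eff_vel t x = r t x * u t x + visc_flux t x.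
Proof.
rewrite /eff_vel /visc_flux; have := powR_addn (al - 2) 1 (r0 t x).
rewrite (_ : al - 2 + 1 = al - 1) ?expr1; last by ring.
by move=> ->; ring.
Qed.

(** The algebra behind the entropy of Bresch and Desjardins: at a fixed time,
    the terms [production] of the energy balance are the space derivative of
    this flux minus the dissipation. *)
Definition flux (t x : R) : R :=
  2^-1 * (r t x * u t x * (eff_vel t x * eff_vel t x)) +
  cp * r t x `^ ga * eff_vel t x - enth t x * (r t x * u t x).

Definition production (t x : R) : R :=
  stress t x * eff_vel_x t x - eff_vel_x t x * (cmu * r t x `^ (al - 1) * mass_rate t x)
  - 2^-1 * (eff_vel t x * eff_vel t x) * mass_rate t x + enth t x * mass_rate t x.

Lemma is_derive_flux t (x : R) : is_derive x 1 (flux t) (production t x + dissip t x).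
Proof.
have h1 := is_derive1M (is_derive1M (dr t x) (du t x)) 
  (is_derive1M (is_derive_eff_vel t x) (is_derive_eff_vel t x)).
have h2 := is_derive1M (is_derive1Zl cp (is_derive_density_powR ga t x))
  (is_derive_eff_vel t x).
have h3 := is_derive1M (is_derive1c (is_derive_enthalpy cp ga (r0 t x)) (dr t x))
  (is_derive1M (dr t x) (du t x)).
have h := is_derive1D (is_derive1D (is_derive1Zl 2^-1 h1) h2) (is_derive1N h3).
apply: (is_derive_eq h).
rewrite /production /dissip /stress /mass_rate /enth /eff_vel.
have y0 := r0 t x; set y := r t x in y0 *.
have -> : y `^ (ga + al - 3) = y `^ (ga - 1) * y `^ (al - 2).
  by rewrite -powR_add//; congr (_ `^ _); ring.
have -> : y `^ (al - 1) = y `^ (al - 2) * y.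
  by have := powR_addn (al - 2) 1 y0; rewrite expr1 => <-; congr (_ `^ _); ring.
have -> : y `^ al = y `^ (al - 2) * y ^+ 2.
  by have := powR_addn (al - 2) 2 y0 => <-; congr (_ `^ _); ring.
have -> : y `^ ga = y `^ (ga - 1) * y.
  by have := powR_addn (ga - 1) 1 y0; rewrite expr1 => <-; congr (_ `^ _); ring.
by field; rewrite gt_eqF.
Qed.

Lemma jcont_production : jcont production.
Proof.
have jv := jcont_eff_vel; have jvx := jcont_eff_vel_x; have js := jcont_stress; have jrt
  := jcont_mass_rate.
have je := jcont_enth; by rewrite /production; jc.
Qed.

Lemma Rintegral_production t :
  \int[mu]_(x in torus) production t x = - \int[mu]_(x in torus) dissip t x.
Proof.
have cP := jcont_sect (t := t) jcont_production; have cD := jcont_sect (t := t) jcont_dissip.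
have c x : {for x, continuous (fun x => production t x + dissip t x)}.
  by apply: cvgD; [exact: cP|exact: cD].
have := FTC_itv false false ler01 (is_derive_flux t) c; rewrite -/torus.
rewrite RintegralD//; try exact: continuous_integrable_torus.
rewrite (_ : flux t 1 - flux t 0 = 0); first by lra.
have pf : periodic1 (flux t) by move=> x; rewrite /flux /enth !(pr, pu, periodic_eff_vel).
by rewrite periodic1_sub1// subrr.
Qed.

(** Young's inequality with half of the dissipation leaves the power [al + 1 -
    ga] of the density, which lies between 0 and 1 and hence is controlled by
    [1 + r]. *)
Lemma force_visc_le (N : R) t x : 0 <= N ->
  N * `|visc_flux t x| <=
    2^-1 * dissip t x + N ^+ 2 * cmu / (2 * cp * ga) * (1 + r t x).
Proof.
move=> N0; have y0 := r0 t x; have ga0 : 0 < ga := lt_le_trans ltr01 ga_ge1.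
rewrite /visc_flux /dissip; set y := r t x in y0 *; set z := rx t x.
pose a := y `^ ((ga + al - 3) / 2) * `|z|.
pose b := y `^ ((al + 1 - ga) / 2).
have ab : y `^ (al - 1) * `|z| = a * b.
  by rewrite /a /b mulrAC -powR_add//; congr (_ `^ _ * _); field.
have aa : y `^ (ga + al - 3) * (z * z) = a * a.
  rewrite /a mulrACA -powR_add// -normrM ger0_norm ?sqr_ge0 -?expr2 ?sqr_ge0//.
  by congr (_ `^ _ * _); field.
have bb : b * b <= 1 + y.
  rewrite /b -powR_add//.
  rewrite (_ : _ + _ = al + 1 - ga); last by field.
  by apply: powR_le1D => //; [rewrite subr_ge0|rewrite lerBlDr addrC lerD2l].
rewrite !normrM (gtr0_norm cmu0) (ger0_norm (powR_ge0 _ _)) ab aa.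
have cg0 : 0 < cp * ga by rewrite mulr_gt0.
have h : 0 <= cmu / (2 * (cp * ga)) * (cp * ga * a - N * b) ^+ 2.
  by rewrite mulr_ge0 ?sqr_ge0// divr_ge0 ?ltW// mulr_gt0.
have k : N ^+ 2 * cmu / (2 * cp * ga) * (b * b) <= N ^+ 2 * cmu / (2 * cp * ga) * (1 + y).
  rewrite ler_wpM2l//; apply: divr_ge0; first by rewrite mulr_ge0 ?sqr_ge0// ltW.
  by rewrite ltW// !mulr_gt0.
apply: le_trans (lerD (lexx _) k); rewrite -subr_ge0; apply: le_trans h _.
rewrite le_eqVlt; apply/orP; left; apply/eqP; field.
by rewrite !gt_eqF.
Qed.

Lemma continuousD (a b : R -> R) : continuous a -> continuous b ->
  continuous (fun x => a x + b x).
Proof. by move=> ca cb x; apply: cvgD; [exact: ca|exact: cb]. Qed.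

Lemma continuousM (a b : R -> R) : continuous a -> continuous b ->
  continuous (fun x => a x * b x).
Proof. by move=> ca cb x; apply: cvgM; [exact: ca|exact: cb]. Qed.

Lemma continuousN (a : R -> R) : continuous a -> continuous (fun x => - a x).
Proof. by move=> ca x; apply: cvgN; exact: ca. Qed.

Lemma continuous_norm (a : R -> R) : continuous a -> continuous (fun x => `|a x|).
Proof. by move=> ca x; apply: cvg_norm; exact: ca. Qed.

Lemma continuous_const (c : R) : continuous (fun _ : R => c).
Proof. by move=> x; exact: cvg_cst. Qed.

Context (Hmass : forall t (x : R), 0 < t < T ->
  is_derive t 1 (fun s => r s x) (mass_rate t x)).

(** Mean value theorem in time, made uniform in space by the uniform continuity
    of the derivative. *)
Lemma time_increment (F Ft : R -> R -> R) (e : R) : jcont Ft ->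
  (forall t (x : R), 0 < t < T -> is_derive t 1 (fun s => F s x) (Ft t x)) -> 0 < e ->
  exists2 d, 0 < d & forall s t x, 0 < s -> s < t -> t < T -> t - s < d ->
    0 <= x <= 1 -> `|F t x - F s x - (t - s) * Ft t x| <= (t - s) * e.
Proof.
move=> jF dF e0; have [d d0 Hd] := jcont_unif 0 T jF e0.
exists d => // s t x s0 st tT td x01.
have dF' z : z \in `[s, t] -> is_derive z 1 (fun s => F s x) (Ft z x).
  rewrite in_itv /= => /andP[sz zt]; apply: dF.
  by rewrite (lt_le_trans s0 sz) (le_lt_trans zt tT).
have dFoo z : z \in `]s, t[ -> is_derive z 1 (fun s => F s x) (Ft z x).
  by rewrite in_itv /= => /andP[/ltW sz /ltW zt]; apply: dF'; rewrite in_itv /= sz.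
have cF : {within `[s, t], continuous (fun s => F s x)}.
  by apply: derivable_within_continuous => z zst; case: (dF' z zst).
have [c cst cE] := MVT st dFoo cF.
rewrite cE mulrC -mulrBr normrM gtr0_norm ?subr_gt0// ler_pM2l ?subr_gt0//.
move: cst; rewrite in_itv /= => /andP[sc ct].
apply: Hd => //; first by rewrite (le_trans (ltW s0) (ltW sc)) (le_trans (ltW ct) (ltW tT)).
by rewrite distrC gtr0_norm ?subr_gt0//; lra.
Qed.

Context (f g : R -> R -> R) (Nf Ng M : R).
Context (mf : measurable_fun setT (fun z : R * R => f z.1 z.2))
  (mg : measurable_fun setT (fun z : R * R => g z.1 z.2))
  (fN : forall t x, `|f t x| <= Nf) (gN : forall t x, `|g t x| <= Ng).
Context (Hmom : forall psi s t, C1_torus psi -> 0 < s -> s < t -> t < T ->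
  \int[mu]_(x in torus) (r t x * u t x * psi x) -
  \int[mu]_(x in torus) (r s x * u s x * psi x) =
  dint s t (fun tau x => stress tau x * derive1 psi x + r tau x * f tau x * psi x)).
Context (Hfg : forall psi s t, C1_torus psi -> 0 < s -> s < t -> t < T ->
  dint s t (fun tau x => f tau x * psi x + g tau x * derive1 psi x) = 0).
Context (HM : forall t, 0 < t < T -> \int[mu]_(x in torus) r t x = M).

Lemma normr_le_addr (a b : R) : `|a| <= b -> 0 <= b + a.
Proof. by rewrite ler_norml => /andP[h _]; rewrite addrC -lerBlDr sub0r. Qed.

Lemma normr_le_subr (a b : R) : `|a| <= b -> 0 <= b - a.
Proof. by rewrite subr_ge0; apply: le_trans; exact: ler_norm. Qed.

Definition energy (t : R) : R := \int[mu]_(x in torus) energy_density t x.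

Definition force_cost : R := Nf ^+ 2 * cmu / (2 * cp * ga) * (1 + M).

(** By convexity of the kinetic energy in momentum and density, the increment
    of the energy is at most the increment of the momentum paired with the
    effective velocity [v] of time [t], corrected by increments of functions of
    the density. The momentum equation, tested with this frozen [v], gives the
    former; the continuity equation gives the latter to first order in [t - s].
    *)
Lemma energy_step (e : R) : 0 < e ->
  exists2 d, 0 < d & forall s t, 0 < s -> s < t -> t < T -> t - s < d ->
    energy t - energy s <=
    (t - s) * (- (2^-1 * \int[mu]_(x in torus) dissip t x) + force_cost + e) +
    dint s t (fun tau x => g tau x * mass_rate tau x).
Proof.
move=> e0.
have Nf0 : 0 <= Nf := le_trans (normr_ge0 _) (fN 0 0).
have Ng0 : 0 <= Ng := le_trans (normr_ge0 _) (gN 0 0).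
have jrt := jcont_mass_rate; have jw := jcont_visc_flux; have jv := jcont_eff_vel.
have jvx := jcont_eff_vel_x; have js := jcont_stress; have jd := jcont_dissip.
have je := jcont_enth; have jE := jcont_energy_density; have jP := jcont_production.
have [V V0 HV] := jcont_bound 0 T jv; have [X X0 HX] := jcont_bound 0 T jvx.
(* All approximations below are made with precision [k]; [C] adds up the
   coefficients of the resulting errors. *)
pose C := X + 2^-1 * (V * V) + 1 + (X + Nf * V + Ng).
have C0 : 0 < C by rewrite /C; have := mulr_ge0 V0 V0; have := mulr_ge0 Nf0 V0; lra.
pose k := e / C; have k0 : 0 < k by rewrite divr_gt0.
have kC : k * C = e by rewrite divfK// gt_eqF.
pose pot t x := visc_pot (r t x).
pose pot_t t x := cmu * r t x `^ (al - 1) * mass_rate t x.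
have jpot_t : jcont pot_t by rewrite /pot_t; jc.
have dpot t (x : R) : 0 < t < T -> is_derive t 1 (fun s => pot s x) (pot_t t x).
  move=> tT; have h := is_derive1Zl (cmu / al)
    (is_derive1c (is_derive1_powR al (r0 t x)) (Hmass x tT)).
  by apply: (is_derive_eq h); rewrite /pot_t; field; rewrite gt_eqF.
pose ie t x := internal_energy cp ga (r t x).
have jie_t : jcont (fun t x => enth t x * mass_rate t x) by jc.
have die t (x : R) : 0 < t < T -> is_derive t 1 (fun s => ie s x) (enth t x * mass_rate t x).
  move=> tT.
  exact: (is_derive1c (is_derive_internal_energy cp ga (r0 t x)) (Hmass x tT)).
have [d1 d10 H1] := time_increment jrt (fun t x => @Hmass t x) k0.
have [d2 d20 H2] := time_increment jpot_t dpot k0.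
have [d3 d30 H3] := time_increment jie_t die k0.
have [d4 d40 H4] := jcont_unif 0 T js k0.
have [d5 d50 H5] := jcont_unif 0 T jr k0.
have [d6 d60 H6] := jcont_unif 0 T jrt k0.
exists (Num.min (Num.min (Num.min d1 d2) d3) (Num.min (Num.min d4 d5) d6)).
  by rewrite !lt_min d10 d20 d30 d40 d50 d60.
move=> s t s0 st tT; rewrite lt_min => /andP[+ tdd]; rewrite !lt_min => /andP[/andP[td1
  td2] td3].
have t0 : 0 < t := lt_trans s0 st.
have tT' : 0 <= t <= T by rewrite !ltW.
have ts0 : 0 < t - s by rewrite subr_gt0.
have [vC1 vC1E] := C1_torus_eff_vel t; have [mC1 mC1E] := C1_torus_momentum t.
set v := eff_vel t; set vx := eff_vel_x t.
have cv : continuous v := jcont_sect jv; have cvx : continuous vx := jcont_sect jvx.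
have cri t' : continuous (fun x => r t' x * u t' x * v x).
  by apply: continuousM => //; apply: continuousM; apply: jcont_sect.
have cw t' : continuous (fun x => v x * visc_flux t' x).
  by apply: continuousM => //; apply: jcont_sect.
have cpot t' : continuous (pot t').
  exact: continuous_is_derive (is_derive_visc_pot t').
have cie t' : continuous (ie t').
  apply: continuous_is_derive => x.
  exact: (is_derive1c (is_derive_internal_energy cp ga (r0 t' x)) (dr t' x)).
pose Y x := - (2^-1 * (v x * v x) * (r t x - r s x)) + (ie t x - ie s x).
have cr t' : continuous (r t') by exact: jcont_sect.
have cY : continuous Y.
  apply: continuousD; last by apply: continuousD => //; exact: continuousN.
  apply: continuousN; apply: continuousM; last by apply: continuousD => //; exact: continuousN.
  by apply: continuousM; [exact: continuous_const|exact: continuousM].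
have iT (h : R -> R) := @continuous_integrable_torus R h.
(* The two sides differ by [r s * (v - eff_vel s)^2 / 2]. *)
have convex x : energy_density t x - energy_density s x <=
    (r t x * u t x * v x - r s x * u s x * v x) +
    (v x * visc_flux t x - v x * visc_flux s x) + Y x.
  have e1 := density_eff_vel t x; have e2 := density_eff_vel s x; have ys := r0 s x.
  rewrite /Y /ie /energy_density -/(v x); set a := eff_vel s x in e2 *.
  have : 0 <= 2^-1 * (r s x * (v x - a) ^+ 2).
    by apply: mulr_ge0 => //; apply: mulr_ge0; [exact: ltW|exact: sqr_ge0].
  rewrite -/(v x) in e1.
  have -> : visc_flux t x = r t x * v x - r t x * u t x by lra.
  have -> : visc_flux s x = r s x * a - r s x * u s x by lra.
  by move=> h; rewrite -subr_ge0; apply: le_trans h _; rewrite le_eqVlt; apply/orP;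
    left; apply/eqP; field.
have cA : continuous (fun x => r t x * u t x * v x - r s x * u s x * v x).
  by apply: continuousD => //; exact: continuousN.
have cB : continuous (fun x => v x * visc_flux t x - v x * visc_flux s x).
  by apply: continuousD => //; exact: continuousN.
have step1 : energy t - energy s <=
    dint s t (fun tau x => stress tau x * vx x + r tau x * f tau x * v x) +
    \int[mu]_(x in torus) (v x * visc_flux t x - v x * visc_flux s x) +
    \int[mu]_(x in torus) Y x.
  have hm := Hmom vC1 s0 st tT; rewrite vC1E in hm.
  rewrite -[dint _ _ _]hm -RintegralB//; try exact: iT.
  rewrite /energy -RintegralB//; try by apply: iT; exact: jcont_sect.
  rewrite -!RintegralD//; try exact: iT; last first.
    by apply: iT; exact: continuousD.
  apply: le_Rintegral => //.
  - apply: iT; apply: continuousD; first exact: jcont_sect.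
    by apply: continuousN; exact: jcont_sect.
  - by apply: iT; apply: continuousD => //; exact: continuousD.
(* The viscous flux is a space derivative, so its increment can be expressed by
   the increment of a function of the density. *)
have step2 : \int[mu]_(x in torus) (v x * visc_flux t x - v x * visc_flux s x) =
    - \int[mu]_(x in torus) ((pot t x - pot s x) * vx x).
  have dpd (x : R) : is_derive x 1 (fun x => pot t x - pot s x)
      (visc_flux t x - visc_flux s x).
    exact: (is_derive1D (is_derive_visc_pot t x) (is_derive1N (is_derive_visc_pot s x))).
  have pp : periodic1 (fun x => pot t x - pot s x) by move=> x; rewrite /pot !pr.
  have cdw : continuous (fun x => visc_flux t x - visc_flux s x).
    apply: continuousD; first exact: jcont_sect.
    by apply: continuousN; exact: jcont_sect.
  rewrite -(IBP_torus pp (periodic_eff_vel t) dpd (is_derive_eff_vel t) cdw cvx).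
  by apply: eq_Rintegral => x _; rewrite -/v; ring.
(* [Z] collects the first-order terms in [t - s] of the density increments. *)
pose Z x := - vx x * pot_t t x - 2^-1 * (v x * v x) * mass_rate t x + enth t x * mass_rate t x.
have cZ : continuous Z.
  have jZ : jcont (fun t x => - eff_vel_x t x * pot_t t x -
      2^-1 * (eff_vel t x * eff_vel t x) * mass_rate t x + enth t x * mass_rate t x) by jc.
  exact: (jcont_sect (t := t) jZ).
have step3 : \int[mu]_(x in torus) Y x - \int[mu]_(x in torus) ((pot t x - pot s x) * vx x) <=
    (t - s) * (\int[mu]_(x in torus) Z x + k * (X + 2^-1 * (V * V) + 1)).
  have cbv : continuous (fun x => (pot t x - pot s x) * vx x).
    by apply: continuousM => //; apply: continuousD => //; exact: continuousN.
  rewrite -[k * (X + _ + 1)]Rintegral_torus_cst -RintegralD//; try exact: iT; last first.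
    by apply: iT; exact: continuous_const.
  have cZk : continuous (fun x => Z x + k * (X + 2^-1 * (V * V) + 1)).
    by apply: continuousD => //; exact: continuous_const.
  rewrite -RintegralZl//; last exact: iT.
  rewrite -RintegralB//; try exact: iT.
  apply: le_Rintegral => //.
  - by apply: iT; apply: continuousD => //; exact: continuousN.
  - by apply: iT; apply: continuousM => //; exact: continuous_const.
  move=> x; rewrite /torus /= in_itv /= => /andP[/ltW x0 x1].
  have x01 : 0 <= x <= 1 by rewrite x0.
  have b1 := H1 s t x s0 st tT td1 x01; have b2 := H2 s t x s0 st tT td2 x01.
  have b3 := H3 s t x s0 st tT td3 x01.
  have bv := HV t x tT' x01; have bx := HX t x tT' x01.
  have n1 : `|2^-1 * (v x * v x) * (r t x - r s x - (t - s) * mass_rate t x)| <=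
      2^-1 * (V * V) * ((t - s) * k).
    rewrite normrM (ger0_norm (_ : 0 <= 2^-1 * (v x * v x))); last first.
      by rewrite mulr_ge0// -expr2 sqr_ge0.
    apply: ler_pM => //; first by rewrite mulr_ge0// -expr2 sqr_ge0.
    rewrite ler_pM2l// (_ : v x * v x = `|v x| * `|v x|); first exact: ler_pM.
    by rewrite -normrM ger0_norm// -expr2 sqr_ge0.
  have n2 : `|vx x * (pot t x - pot s x - (t - s) * pot_t t x)| <= X * ((t - s) * k).
    by rewrite normrM; apply: ler_pM.
  have -> : Y x - (pot t x - pot s x) * vx x =
      - (2^-1 * (v x * v x) * (r t x - r s x - (t - s) * mass_rate t x))
      - vx x * (pot t x - pot s x - (t - s) * pot_t t x)
      + (ie t x - ie s x - (t - s) * (enth t x * mass_rate t x)) + (t - s) * Z x.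
    by rewrite /Y /Z; ring.
  move: n1 n2 b3; rewrite !ler_norml => /andP[n1 _] /andP[n2 _] /andP[_ b3].
  have -> : (t - s) * (Z x + k * (X + 2^-1 * (V * V) + 1)) =
      2^-1 * (V * V) * ((t - s) * k) + X * ((t - s) * k) + (t - s) * k + (t - s) * Z x.
    by ring.
  by rewrite lerD2r; apply: lerD => //; apply: lerD; rewrite lerNl.
have bf : bmeas s t f by split => //; exists Nf.
have bg : bmeas s t g by split => //; exists Ng.
have bj H : jcont H -> bmeas s t H by exact: jcont_bmeas.
have bx (h : R -> R) : continuous h -> bmeas s t (fun _ x => h x).
  by move=> ch; apply: jcont_bmeas; exact: jcont_x.
pose k1 x := stress t x * vx x + Nf * `|visc_flux t x| + k * (X + Nf * V + Ng).
have ck1 : continuous k1.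
  apply: continuousD; last exact: continuous_const.
  apply: continuousD; first by apply: continuousM => //; exact: jcont_sect.
  by apply: continuousM; [exact: continuous_const|apply: continuous_norm; exact: jcont_sect].
pose psi x := r t x * u t x.
have cpsi : continuous psi by apply: continuousM; exact: jcont_sect.
have cdpsi : continuous (fun x => - mass_rate t x) by apply: continuousN; exact: jcont_sect.
(* Freezing the coefficients at time [t]: there the force acts on the momentum,
   where it becomes the work of its potential, and on the viscous flux. *)
have step4 : dint s t (fun tau x => stress tau x * vx x + r tau x * f tau x * v x) <=
    (t - s) * \int[mu]_(x in torus) k1 x + dint s t (fun tau x => g tau x * mass_rate tau x).
  have fg0 : dint s t (fun tau x => f tau x * psi x + g tau x * - mass_rate t x) = 0.
    by have := Hfg mC1 s0 st tT; rewrite mC1E.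
  rewrite -(dint_static k1 (ltW st)) -[X in X + _]addr0 -fg0.
  have b1 : bmeas s t (fun tau x => f tau x * psi x + g tau x * - mass_rate t x).
    by apply: bmeasD; apply: bmeasM => //; exact: bx.
  have b2 : bmeas s t (fun tau x => g tau x * mass_rate tau x) by apply: bmeasM => //;
    exact: bj.
  have b3 := bmeasD (bx _ ck1) b1.
  rewrite -dintD//; last exact: bx.
  rewrite -dintD//; apply: le_dint; last 1 first.
  - move=> tau x taust x01.
    have tauT : 0 <= tau <= T.
      move: taust => /andP[h1 h2].
      by rewrite (le_trans (ltW s0) h1) (le_trans h2 (ltW tT)).
    have ttau : `|t - tau| < Num.min (Num.min d4 d5) d6.
      move: taust => /andP[h1 h2]; rewrite ger0_norm ?subr_ge0//.
      by apply: le_lt_trans tdd; rewrite lerD2l lerN2.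
    move: ttau; rewrite !lt_min => /andP[/andP[q4 q5] q6].
    have b4 := H4 t tau x tT' x01 q4; have b5 := H5 t tau x tT' x01 q5.
    have b6 := H6 t tau x tT' x01 q6.
    have bv := HV t x tT' x01; have bvx := HX t x tT' x01.
    have n1 : `|(stress t x - stress tau x) * vx x| <= k * X by rewrite normrM; exact: ler_pM.
    have n2 : `|f tau x * (r t x - r tau x) * v x| <= Nf * k * V.
      by rewrite !normrM; apply: ler_pM => //; apply: ler_pM.
    have n3 : `|g tau x * (mass_rate t x - mass_rate tau x)| <= Ng * k by rewrite normrM;
      exact: ler_pM.
    have n4 : `|f tau x * visc_flux t x| <= Nf * `|visc_flux t x|.
      by rewrite normrM; apply: ler_wpM2r.
    have rv : r t x * v x = psi x + visc_flux t x by exact: density_eff_vel.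
    have -> : stress tau x * vx x + r tau x * f tau x * v x =
        stress t x * vx x - (stress t x - stress tau x) * vx x +
        f tau x * (r t x * v x) - f tau x * (r t x - r tau x) * v x by ring.
    rewrite rv /k1 -subr_ge0.
    rewrite [leRHS](_ : _ = (k * X + (stress t x - stress tau x) * vx x) +
      (Nf * `|visc_flux t x| - f tau x * visc_flux t x) +
      (Nf * k * V + f tau x * (r t x - r tau x) * v x) +
      (Ng * k - g tau x * (mass_rate t x - mass_rate tau x))); last by ring.
    apply: addr_ge0; last exact: normr_le_subr.
    apply: addr_ge0; last exact: normr_le_addr.
    by apply: addr_ge0; [exact: normr_le_addr|exact: normr_le_subr].
  - apply: bmeasD; apply: bmeasM => //; try exact: bx; try exact: bj.
    by apply: bmeasM => //; exact: bj.
  - exact: bmeasD.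
(* The first-order terms add up to [production], whose integral is minus the
   dissipation; half of the dissipation pays for the force. *)
have step5 : \int[mu]_(x in torus) k1 x + (\int[mu]_(x in torus) Z x +
    k * (X + 2^-1 * (V * V) + 1)) <=
    - (2^-1 * \int[mu]_(x in torus) dissip t x) + force_cost + e.
  have cd : continuous (dissip t) := jcont_sect jd.
  have icst c : mu.-integrable torus (EFin \o (fun _ : R => c)).
    by apply: iT; exact: continuous_const.
  have cprod : continuous (production t) := jcont_sect jP.
  have ip := Rintegral_production t.
  pose c0 := Nf ^+ 2 * cmu / (2 * cp * ga).
  pose K := k * (X + Nf * V + Ng).
  have c1 : continuous (fun x => 1 + r t x).
    by apply: continuousD => //; exact: continuous_const.
  have c2 : continuous (fun x => c0 * (1 + r t x)).
    by apply: continuousM => //; exact: continuous_const.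
  have c3 : continuous (fun x => c0 * (1 + r t x) + K).
    by apply: continuousD => //; exact: continuous_const.
  have c4 : continuous (fun x => 2^-1 * dissip t x).
    by apply: continuousM => //; exact: continuous_const.
  have c5 : continuous (fun x => 2^-1 * dissip t x + (c0 * (1 + r t x) + K)).
    exact: continuousD.
  have eL : \int[mu]_(x in torus) (k1 x + Z x) =
      \int[mu]_(x in torus) k1 x + \int[mu]_(x in torus) Z x.
    by rewrite RintegralD//; exact: iT.
  have e1 : \int[mu]_(x in torus) (1 + r t x) = 1 + M.
    rewrite RintegralD//; [|exact: iT].
    by rewrite Rintegral_torus_cst HM ?t0.
  have e2 : \int[mu]_(x in torus) (c0 * (1 + r t x) + K) = force_cost + K.
    rewrite RintegralD//; [|exact: iT].
    by rewrite Rintegral_torus_cst RintegralZl ?e1//; exact: iT.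
  have e3 : \int[mu]_(x in torus) (2^-1 * dissip t x + (c0 * (1 + r t x) + K)) =
      2^-1 * \int[mu]_(x in torus) dissip t x + (force_cost + K).
    rewrite RintegralD//; [|exact: iT|exact: iT].
    by rewrite e2 RintegralZl//; exact: iT.
  have le1 : \int[mu]_(x in torus) (k1 x + Z x) <= \int[mu]_(x in torus)
      (production t x + (2^-1 * dissip t x + (c0 * (1 + r t x) + K))).
    apply: le_Rintegral => //.
    - by apply: iT; exact: continuousD.
    - by apply: iT; exact: continuousD.
    - move=> x _; have := force_visc_le t x Nf0; rewrite -/c0 => h.
      rewrite -subr_ge0; apply: le_trans (_ : 0 <= 2^-1 * dissip t x +
        c0 * (1 + r t x) - Nf * `|visc_flux t x|) _; first by rewrite subr_ge0.
      rewrite le_eqVlt; apply/orP; left; apply/eqP.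
      by rewrite /k1 /Z /production -/vx -/v /pot_t /K; ring.
  rewrite eL RintegralD// in le1; [|exact: iT|exact: iT].
  rewrite e3 ip in le1; rewrite addrA.
  apply: le_trans (lerD le1 (lexx _)) _.
  rewrite le_eqVlt; apply/orP; left; apply/eqP.
  by rewrite -kC /K /C; field.
have lem : (t - s) * (\int[mu]_(x in torus) k1 x + (\int[mu]_(x in torus) Z x +
    k * (X + 2^-1 * (V * V) + 1))) <= (t - s) *
    (- (2^-1 * \int[mu]_(x in torus) dissip t x) + force_cost + e).
  by rewrite ler_pM2l.
rewrite step2 in step1.
set A := dint s t _ in step1 step4; set G := dint s t _ in step4 *.
set I1 := \int[mu]_(x in torus) Y x in step1 step3.
set I2 := \int[mu]_(x in torus) _ in step1 step3.
rewrite mulrDr in lem.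
apply: le_trans step1 _; rewrite -addrA.
apply: le_trans (lerD step4 (_ : - I2 + I1 <= _)) _; first by rewrite addrC; exact: step3.
by rewrite addrAC lerD2r.
Qed.

Definition total_dissip (t : R) : R := \int[mu]_(x in torus) dissip t x.

(** Summing the increments of [energy_step]: the energy plus half of the
    accumulated dissipation, minus the cost and the work of the force, does not
    increase. *)
Lemma energy_decay (a b : R) : 0 < a -> a < b -> b < T ->
  energy b - energy a + 2^-1 * (prim total_dissip b - prim total_dissip a) <=
  force_cost * (b - a) + dint a b (fun t x => g t x * mass_rate t x).
Proof.
move=> a0 ab bT; have jrt := jcont_mass_rate.
have cD : continuous total_dissip := continuous_Rintegral_torus jcont_dissip.
pose q (t x : R) := g t x * mass_rate t x.
have bq c d : bmeas c d q.
  by apply: bmeasM; [split => //; exists Ng|exact: jcont_bmeas].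
pose Phi t := energy t + 2^-1 * prim total_dissip t - force_cost * t - dint a t q.
suff : Phi b <= Phi a.
  have -> : Phi a = energy a + 2^-1 * prim total_dissip a - force_cost * a.
    rewrite /Phi [dint a a q](_ : _ = 0) ?subr0//.
    by rewrite /dint set_itv_ge ?Rintegral_set0// bnd_simp ltxx.
  rewrite /Phi; move: (energy a) (energy b) (prim _ a) (prim _ b) (dint a b q).
  by move=> x1 x2 x3 x4 x5; lra.
apply: (nonincreasing_of_increments (W := id) (ltW ab)) => e e0.
have e2 : 0 < e / 2 by rewrite divr_gt0.
have [d1 d10 H1] := energy_step e2.
have dP (t x : R) : 0 < t < T -> is_derive t 1 (prim total_dissip) (total_dissip t).
  by move=> _; exact: is_derive_prim.
have [d2 d20 H2] := time_increment (F := fun t _ => prim total_dissip t)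
  (jcont_t cD) dP e2.
exists (Num.min d1 d2); first by rewrite lt_min d10.
move=> s t as_ st tb; rewrite lt_min => /andP[td1 td2].
have s0 : 0 < s := lt_le_trans a0 as_; have tT : t < T := le_lt_trans tb bT.
have ts0 : 0 < t - s by rewrite subr_gt0.
have := H1 s t s0 st tT td1; rewrite -/(total_dissip t) -/q => h1.
have := H2 s t 0 s0 st tT td2; rewrite lexx ler01 => /(_ isT).
rewrite ler_norml /= => /andP[_]; rewrite lerBlDl => h2.
have hq := dint_split as_ (ltW st) (bq a t).
have h3 : (t - s) * (e / 2) <= (t - s) * e.
  by rewrite ler_pM2l// ler_pdivrMr// ler_pMr// ler1n.
rewrite /Phi hq /=.
set E1 := energy t in h1 *; set E2 := energy s in h1 *.
set P1 := prim _ t in h2 *; set P2 := prim _ s in h2 *.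
set Q1 := dint s t q in h1 *; set Q2 := dint a s q.
set D1 := total_dissip t in h1 h2.
have {h1 h2 h3} : E1 - E2 + 2^-1 * (P1 - P2) <=
    ((t - s) * (- (2^-1 * D1) + force_cost + e / 2) + Q1) +
    2^-1 * ((t - s) * D1 + (t - s) * (e / 2)).
  by apply: lerD => //; rewrite ler_pM2l.
have h4 : 0 <= (t - s) * e by rewrite mulr_ge0// ltW.
by move: E1 E2 P1 P2 Q1 Q2 D1 h4 => x1 x2 x3 x4 x5 x6 x7 h4 {Phi hq}; lra.
Qed.

Lemma energy_ge (t : R) : - cp <= energy t.
Proof.
rewrite -[- cp]Rintegral_torus_cst; apply: le_Rintegral => //.
- exact/continuous_integrable_torus/continuous_const.
- exact/continuous_integrable_torus/(jcont_sect jcont_energy_density).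
move=> x _; rewrite -[- cp]add0r; apply: lerD.
  by apply: mulr_ge0 => //; apply: mulr_ge0; [exact: ltW|rewrite -expr2 sqr_ge0].
by apply: internal_energy_ge => //; exact: ltW.
Qed.

Context (W w : R) (Hwork : forall a b, 0 < a -> a < b -> b < T ->
  dint a b (fun t x => g t x * mass_rate t x) <= W + w * (b - a)).

(** The energy is bounded below, and the bounds on subintervals extend to the
    closed time interval by continuity. *)
Lemma total_dissip_le :
  2^-1 * prim total_dissip T <= energy 0 + cp + (force_cost + w) * T + W.
Proof.
have cD : continuous total_dissip := continuous_Rintegral_torus jcont_dissip.
have cE : continuous energy := continuous_Rintegral_torus jcont_energy_density.
have cP : continuous (prim total_dissip).
  by apply: continuous_is_derive => x; exact: is_derive_prim.
pose G a b := energy a + cp + (force_cost + w) * (b - a) + W -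
  2^-1 * (prim total_dissip b - prim total_dissip a).
have G0 a b : 0 < a -> a < b -> b < T -> 0 <= G a b.
  move=> a0 ab bT; have := energy_decay a0 ab bT; have := Hwork a0 ab bT.
  have := energy_ge b; rewrite /G.
  set d := dint _ _ _; move: (energy a) (energy b) (prim _ a) (prim _ b) d.
  by move=> x1 x2 x3 x4 x5; lra.
have cc (c : R) : continuous (fun _ : R => c) by exact: continuous_const.
have cid : continuous (fun x : R => x) by move=> x; exact: cvg_id.
have G1 b : 0 < b -> b < T -> 0 <= G 0 b.
  move=> b0 bT.
  apply: (@continuous_ge0_closure _ (fun a => G a b) 0 b _ b0 _ 0); last by rewrite lexx ltW.
  - apply: continuousD; last first.
      apply: continuousN; apply: continuousM => //; apply: continuousD => //.
      exact: continuousN.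
    apply: continuousD => //; apply: continuousD; first exact: continuousD.
    by apply: continuousM => //; apply: continuousD => //; exact: continuousN.
  - by move=> a /andP[a0 ab]; exact: G0.
have : 0 <= G 0 T.
  apply: (@continuous_ge0_closure _ (G 0) 0 T _ T0 _ T); last by rewrite lexx ltW.
  - apply: continuousD; last first.
      by apply: continuousN; apply: continuousM => //; exact: continuousD.
    apply: continuousD => //; apply: continuousD => //.
    by apply: continuousM => //; exact: continuousD.
  - by move=> b /andP[]; exact: G1.
rewrite /G [prim _ 0](_ : _ = 0); last first.
  by rewrite /prim set_itv_ge ?Rintegral_set0 ?subrr// bnd_simp ltxx.
by rewrite !subr0 subr_ge0.
Qed.

End Flow.

(** * The dissipation controls the maximum of the density *)


Section SupBound.
Context {R : realType}.
Notation mu := (@lebesgue_measure R).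

Lemma oscillation_le (f f' : R -> R) (x y : R) : (forall x : R, is_derive x 1 f (f' x)) ->
  continuous f' -> 0 <= x <= 1 -> 0 <= y <= 1 ->
  `|f x - f y| <= \int[mu]_(z in torus) `|f' z|.
Proof.
move=> df cf'; wlog yx : x y / y <= x.
  move=> H x01 y01; have [yx|/ltW xy] := leP y x; first exact: H.
  by rewrite distrC; exact: H.
move=> /andP[x0 x1] /andP[y0 y1].
have cn := continuous_norm cf'.
rewrite -(FTC_itv false false yx df cf').
apply: le_trans (le_normr_Rintegral _ _) _ => //; first exact: continuous_integrable_itv.
have i0 := @continuous_integrable_itv _ _ 0 1 false false cn.
have pos (D : set R) : 0 <= \int[mu]_(z in D) `|f' z| by exact: Rintegral_ge0.
rewrite /torus (@Rintegral_split_itv _ _ 0 y 1)//.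
rewrite (@Rintegral_split_itv _ _ y x 1)//.
- by rewrite addrCA lerDl addr_ge0.
- by apply: integrable_sub_torus.
Qed.

(** Expanding the variance of [|h|], which is nonnegative. *)
Lemma sqr_Rintegral_norm_le (h : R -> R) : continuous h ->
  (\int[mu]_(x in torus) `|h x|) ^+ 2 <= \int[mu]_(x in torus) (h x * h x).
Proof.
move=> ch; have cn := continuous_norm ch.
set m := Rintegral _ _ _.
have cc (c : R) : continuous (fun _ : R => c) by exact: continuous_const.
have : 0 <= \int[mu]_(x in torus) ((`|h x| - m) * (`|h x| - m)).
  by apply: Rintegral_ge0 => x _; rewrite -expr2 sqr_ge0.
have -> : (fun x => (`|h x| - m) * (`|h x| - m)) =
    fun x => h x * h x + (- (2 * m) * `|h x| + m * m).
  apply/funext => x; have : `|h x| * `|h x| = h x * h x.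
    by rewrite -normrM ger0_norm// -expr2 sqr_ge0.
  by move=> e; rewrite -e; ring.
have iT k : continuous k -> mu.-integrable torus (EFin \o k).
  exact: continuous_integrable_torus.
rewrite RintegralD//; last 2 first.
- by apply: iT; exact: continuousM.
- by apply: iT; apply: continuousD => //; exact: continuousM.
rewrite RintegralD//; last 2 first.
- by apply: iT; exact: continuousM.
- by apply: iT.
rewrite RintegralZl//; last exact: iT.
rewrite Rintegral_torus_cst -/m => h0.
by rewrite -subr_ge0; apply: le_trans h0 _; rewrite le_eqVlt; apply/orP; left; apply/eqP; ring.
Qed.

(** At its minimum the density is at most its mean [M]; from there its power
    [be] oscillates by at most the mean of the modulus of its derivative, and
    by the Cauchy-Schwarz inequality the square of this mean is at most the
    integral on the right. *)
Lemma density_sup_le (q qx : R -> R) (be M : R) :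
  (forall x : R, is_derive x 1 q (qx x)) -> continuous qx -> (forall x, 0 < q x) ->
  2^-1 <= be -> \int[mu]_(x in torus) q x = M -> forall x, 0 <= x <= 1 ->
  q x <= 1 + 2 * M `^ (2 * be) +
    2 * be ^+ 2 * \int[mu]_(x in torus) (q x `^ (2 * be - 2) * (qx x * qx x)).
Proof.
move=> dq cqx q0 be2 qM x x01; have cq := continuous_is_derive dq.
have be0 : 0 < be by lra.
have be1 : 1 <= 2 * be by lra.
have [y y01 ymin] := @EVT_min R q 0 1 ler01 (continuous_subspaceT cq).
have y01' : 0 <= y <= 1 by move: y01; rewrite in_itv.
have qyM : q y <= M.
  rewrite -[q y]Rintegral_torus_cst -qM; apply: le_Rintegral => //.
  - exact/continuous_integrable_torus/continuous_const.
  - exact: continuous_integrable_torus.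
  by move=> z; rewrite /torus /= in_itv /= => /andP[/ltW z0 z1]; apply: ymin; rewrite
    in_itv /= z0.
have M0 : 0 < M := lt_le_trans (q0 y) qyM.
pose h z := be * q z `^ (be - 1) * qx z.
have cpow a : continuous (fun z => q z `^ a).
  move=> z; apply: (@continuous_comp _ _ _ q (fun y : R => y `^ a)); first exact: cq.
  exact: continuous_powR_gt0.
have dpow' (z : R) : is_derive z 1 (fun z => q z `^ be) (h z).
  by apply: (@is_derive1c _ (fun y : R => y `^ be)); exact: is_derive1_powR.
have ch : continuous h.
  by apply: continuousM => //; apply: continuousM => //; exact: continuous_const.
have osc := oscillation_le dpow' ch x01 y01'.
have cs := sqr_Rintegral_norm_le ch.
set I := \int[mu]_(z in torus) `|h z| in osc cs.
have ehh : \int[mu]_(x in torus) (h x * h x) =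
    be ^+ 2 * \int[mu]_(x in torus) (q x `^ (2 * be - 2) * (qx x * qx x)).
  rewrite -RintegralZl//; last first.
    by apply: continuous_integrable_torus; apply: continuousM => //; exact: continuousM.
  apply: eq_Rintegral => z _; rewrite /h.
  rewrite (_ : 2 * be - 2 = (be - 1) + (be - 1)); last by ring.
  by rewrite (powR_add (be - 1) (be - 1) (q0 z)); ring.
have sq (z : R) : 0 < z -> z `^ (2 * be) = z `^ be * z `^ be.
  by move=> z0; rewrite -powR_add//; congr (_ `^ _); ring.
have le1 : q x `^ be <= M `^ be + I.
  have : q y `^ be <= M `^ be.
    by apply: ge0_ler_powR => //; rewrite ?nnegrE ltW.
  have := le_trans (ler_norm _) osc; rewrite lerBlDr => h1 h2.
  by apply: le_trans h1 _; rewrite addrC lerD2r.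
have le2 : q x <= 1 + q x `^ (2 * be) by exact: le_1D_powR.
apply: le_trans le2 _; rewrite sq// sq// -addrA lerD2l -mulrA -ehh.
have I0 : 0 <= I by exact: Rintegral_ge0.
apply: (@le_trans _ _ (2 * (M `^ be * M `^ be) + 2 * I ^+ 2)); last by rewrite lerD2l ler_pM2l.
apply: (@le_trans _ _ ((M `^ be + I) ^+ 2)); first by rewrite expr2; apply: ler_pM;
  rewrite ?powR_ge0.
rewrite -subr_ge0 (_ : _ - _ = (M `^ be - I) ^+ 2) ?sqr_ge0//; ring.
Qed.

End SupBound.

(** * Balance laws in the sense of distributions *)


Section Evolution.
Context {R : realType}.
Notation mu := (@lebesgue_measure R).

Lemma pairing_restrict (Tstar : \bar R) (T : R) (h k F : R -> R -> R) :
  0 < T -> (T%:E < Tstar)%E -> (forall t x, ~~ (0 < t < T) -> k t x = 0) ->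
  (forall t, 0 < t < T -> \int[mu]_(x in torus) (h t x * k t x) =
     \int[mu]_(x in torus) F t x) ->
  (forall x, F T x = 0) -> pairing Tstar h k = dint 0 T F.
Proof.
move=> T0 TT k0 hkF FT; rewrite /pairing /dint.
rewrite Rintegral_mkcond [RHS]Rintegral_mkcond; congr Rintegral.
apply/funext => t; rewrite !patchE.
have [/[dup] t0T /andP[t0 tT]|/[dup] nt /k0 kt0] := boolP (0 < t < T).
  have tTs : (t%:E < Tstar)%E by apply: lt_trans TT; rewrite lte_fin.
  rewrite mem_set/= ?lte_fin ?t0// mem_set/= ?in_itv/= ?t0 ?(ltW tT)//.
  exact: hkF.
rewrite [X in if _ then X else _](_ : _ = 0) ?if_same; last first.
  by apply: Rintegral_eq0 => x _; rewrite kt0 mulr0.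
case: ifPn => //; rewrite inE /= in_itv /= => /andP[t0 tT].
have -> : t = T by apply/eqP; rewrite eq_le tT leNgt; apply: contra nt => ->; rewrite t0.
by rewrite Rintegral_eq0// => x _; exact: FT.
Qed.

Lemma dtrap_out (h s t x : R) : 0 < h -> s <= t -> ~~ (s <= x <= t + h) ->
  dtrap h s t x = 0.
Proof.
move=> h0 st; rewrite negb_and -!ltNge /dtrap => /orP[xs|tx].
  by rewrite !dramp_eq0 ?mul0r ?subr0//; left; rewrite pmulr_lle0 ?invr_gt0//; lra.
by rewrite !dramp_eq0 ?mul0r ?subr0//; right; rewrite ler_pdivlMr//; lra.
Qed.

(** A function that is differentiable in time only inside the time interval
    becomes a test function after multiplication by a cut-off supported inside.
    *)
Lemma test_fun_trap (Tstar : \bar R) (T h a b : R) (K Kx Kt : R -> R -> R) :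
  (T%:E < Tstar)%E -> 0 < h -> 0 < a -> a + h <= b -> b + h < T ->
  jcont K -> jcont Kx -> jcont Kt -> (forall t, periodic1 (K t)) ->
  (forall t (x : R), is_derive x 1 (K t) (Kx t x)) ->
  (forall (t x : R), 0 < t < T -> is_derive t 1 (K ^~ x) (Kt t x)) ->
  let phi := fun t x => trap h a b t * K t x in
  [/\ test_fun Tstar phi, dx phi = (fun t x => trap h a b t * Kx t x) &
      dt phi = (fun t x => dtrap h a b t * K t x + trap h a b t * Kt t x)].
Proof.
move=> TT h0 a0 hab bhT jK jKx jKt pK dKx dKt phi.
have ab : a <= b by lra.
have dphix t (x : R) : is_derive x 1 (phi t) (trap h a b t * Kx t x).
  exact: is_derive1Zl.
have dphit (t x : R) : is_derive t 1 (phi ^~ x)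
    (dtrap h a b t * K t x + trap h a b t * Kt t x).
  have [tT|ntT] := boolP (0 < t < T).
    by apply: is_derive1M; [exact: is_derive_trap|exact: dKt].
  have out z : ~~ (a <= z <= b + h) -> phi z x = 0.
    by move=> nz; rewrite /phi trap_out ?mul0r.
  have tout : ~~ (a <= t <= b + h).
    by apply: contra ntT => /andP[at_ tb]; apply/andP; split; lra.
  rewrite (dtrap_out h0 ab tout) (trap_out h0 ab tout) !mul0r addr0.
  apply: is_derive_eps => e e0.
  have [k k0 Hk] : exists2 k, 0 < k & forall z, `|z| < k -> ~~ (a <= t + z <= b + h).
    move: tout; rewrite negb_and -!ltNge => /orP[ta|bt].
      exists (a - t); first by rewrite subr_gt0.
      move=> z; rewrite ltr_norml => /andP[_ z1].
      by rewrite negb_and -!ltNge; apply/orP; left; lra.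
    exists (t - (b + h)); first by rewrite subr_gt0.
    move=> z; rewrite ltr_norml => /andP[z1 _].
    by rewrite negb_and -!ltNge; apply/orP; right; lra.
  exists k => // z zk; rewrite !out//; last exact: Hk.
  by rewrite mulr0 !subr0 normr0 mulr_ge0// ltW.
have dxE : dx phi = fun t x => trap h a b t * Kx t x.
  by apply/funext => t; apply/funext => x; rewrite /dx derive1E; case: (dphix t x).
have dtE : dt phi = fun t x => dtrap h a b t * K t x + trap h a b t * Kt t x.
  by apply/funext => t; apply/funext => x; rewrite /dt derive1E; case: (dphit t x).
have j1 : jcont (fun t _ => dtrap h a b t) by exact/jcont_t/continuous_dtrap.
have j2 : jcont (fun t _ => trap h a b t) by exact/jcont_t/continuous_trap.
split => //; split.
- by move=> t x; rewrite /phi pK.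
- by move=> t x; split; [case: (dphix t x)|case: (dphit t x)].
- by rewrite dxE; exact: (jcontM j2 jKx).
- by rewrite dtE; exact: (jcontD (jcontM j1 jK) (jcontM j2 jKt)).
- exists a, (b + h); split => //; first by apply: lt_trans TT; rewrite lte_fin.
  by move=> t x tout; rewrite /phi trap_out ?mul0r.
Qed.

Lemma test_fun_trap_static (Tstar : \bar R) (T h a b : R) (psi : R -> R) :
  (T%:E < Tstar)%E -> 0 < h -> 0 < a -> a + h <= b -> b + h < T -> C1_torus psi ->
  let phi := fun t x => trap h a b t * psi x in
  [/\ test_fun Tstar phi, dx phi = (fun t x => trap h a b t * derive1 psi x) &
      dt phi = (fun t x => dtrap h a b t * psi x)].
Proof.
move=> TT h0 a0 hab bhT psiC1; have [ppsi dpsi cpsi] := psiC1.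
have j0 : jcont (fun _ _ : R => 0 : R) by exact: jcont_cst.
have [] := @test_fun_trap Tstar T h a b (fun _ => psi) (fun _ => derive1 psi)
  (fun _ _ => 0) TT h0 a0 hab bhT _ _ j0 (fun _ => ppsi).
- exact/jcont_x/C1_torus_continuous.
- exact: jcont_x.
- by move=> t x; apply: is_derive_C1_torus.
move=> h1 h2 h3; split => //; rewrite h3.
by apply/funext => t; apply/funext => x; rewrite mulr0 addr0.
Qed.

(** The trapezoids multiplied by a function of space are enough to recover the
    increments of the tested density, by [weak_time_deriv]. *)
Lemma weak_evolution (T : R) (Q F S : R -> R -> R) (psi : R -> R) : 0 < T ->
  jcont Q -> bmeas 0 T F -> bmeas 0 T S -> C1_torus psi ->
  (forall h a b, 0 < h -> 0 < a -> a + h <= b -> b + h < T ->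
     dint 0 T (fun t x => Q t x * (dtrap h a b t * psi x)) +
     dint 0 T (fun t x => F t x * (trap h a b t * derive1 psi x)) +
     dint 0 T (fun t x => S t x * (trap h a b t * psi x)) = 0) ->
  forall s t, 0 < s -> s < t -> t < T ->
    \int[mu]_(x in torus) (Q t x * psi x) - \int[mu]_(x in torus) (Q s x * psi x) =
    dint s t (fun tau x => F tau x * derive1 psi x + S tau x * psi x).
Proof.
move=> T0 jQ bF bS psiC1 H; have [ppsi dpsi cdpsi] := psiC1.
have jpsi := jcont_x (C1_torus_continuous psiC1); have jdpsi := jcont_x cdpsi.
have bj K : jcont K -> bmeas 0 T K by exact: jcont_bmeas.
pose B t x := F t x * derive1 psi x + S t x * psi x.
have bFp : bmeas 0 T (fun t x => F t x * derive1 psi x) by apply: bmeasM => //; exact: bj.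
have bSp : bmeas 0 T (fun t x => S t x * psi x) by apply: bmeasM => //; exact: bj.
have bB : bmeas 0 T B by exact: bmeasD.
have [mB [N BN]] := bB.
apply: (@weak_time_deriv _ (fun t => \int[mu]_(x in torus) (Q t x * psi x))
  (fun t => \int[mu]_(x in torus) B t x) T N).
- exact: (continuous_Rintegral_torus (jcontM jQ jpsi)).
- exact: measurable_Rintegral_torus.
- move=> t /andP[t0 tT]; apply: Rintegral_torus_bound.
    by apply: measurable_funTS; exact: (measurable_fun_pair2 t mB).
  by move=> x x01; apply: BN => //; rewrite tT ltW.
move=> h a b h0 a0 hab bhT; have := H h a b h0 a0 hab bhT.
have jtr : jcont (fun t _ => trap h a b t) by exact/jcont_t/continuous_trap.
have bQp : bmeas 0 T (fun t x => Q t x * psi x) by exact: bj (jcontM _ _).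
rewrite -(dint_mulr _ bQp) -(dint_mulr _ bB) => HH.
rewrite (eq_dint (G := fun t x => Q t x * (dtrap h a b t * psi x))); last first.
  by move=> t x _ _; ring.
rewrite [X in - X](eq_dint (G := fun t x => F t x * (trap h a b t * derive1 psi x) +
  S t x * (trap h a b t * psi x))); last by move=> t x _ _; rewrite /B; ring.
rewrite dintD; last 2 first.
- by apply: bmeasM => //; apply: bj; exact: jcontM.
- by apply: bmeasM => //; apply: bj; exact: jcontM.
by apply/eqP; rewrite -addr_eq0 addrA; exact/eqP.
Qed.

(** The difference between the increment of the density and its expected value
    pairs with a nonnegative test function to at most [e * (b - a)] times the
    mean of the latter, so it is pointwise bounded by [e * (b - a)]. *)
Lemma mass_is_derive (T : R) (r q : R -> R -> R) : jcont r -> jcont q ->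
  (forall t, periodic1 (r t)) -> (forall t, periodic1 (q t)) ->
  (forall psi s t, C1_torus psi -> 0 < s -> s < t -> t < T ->
    \int[mu]_(x in torus) (r t x * psi x) - \int[mu]_(x in torus) (r s x * psi x) =
    dint s t (fun tau x => q tau x * psi x)) ->
  forall (t x : R), 0 < t < T -> is_derive t 1 (fun s => r s x) (q t x).
Proof.
move=> jr jq pr pq H t x /andP[t0 tT].
have iT k : continuous k -> mu.-integrable torus (EFin \o k).
  exact: continuous_integrable_torus.
have key (z a b e : R) : 0 < a -> a < b -> b < T -> 0 <= e ->
    (forall s y, a <= s <= b -> 0 <= y <= 1 -> `|q s y - q z y| <= e) ->
    `|r b x - r a x - (b - a) * q z x| <= e * (b - a).
  move=> a0 ab bT e0 qe; have cs K s : jcont K -> continuous (K s).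
    by move=> jK; exact: jcont_sect jK.
  have ck : continuous (fun x => r b x - r a x - (b - a) * q z x).
    apply: continuousD; last first.
      apply: continuousN; apply: continuousM; [exact: continuous_const|exact: cs].
    by apply: continuousD; [|apply: continuousN]; exact: cs.
  apply: (norm_le_of_pairing (k := fun x => r b x - r a x - (b - a) * q z x)) => //.
    by move=> y; rewrite !pr pq.
  move=> psi psiC1 psi0; have cpsi := C1_torus_continuous psiC1.
  have bpsi : bmeas a b (fun _ => psi) by apply: jcont_bmeas; exact: jcont_x.
  have bq w : jcont w -> bmeas a b (fun t x => w t x * psi x).
    by move=> jw; apply: bmeasM => //; exact: jcont_bmeas.
  have jqz : jcont (fun _ => q z) by apply: jcont_x; exact: cs.
  have -> : \int[mu]_(x in torus) ((r b x - r a x - (b - a) * q z x) * psi x) =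
      dint a b (fun tau x => (q tau x - q z x) * psi x).
    have -> : (fun tau x => (q tau x - q z x) * psi x) =
        (fun tau x => q tau x * psi x + - (q z x * psi x)).
      by apply/funext => tau; apply/funext => y; ring.
    rewrite dintD; [|exact: bq|by apply: bmeasN; exact: bq].
    rewrite dintN; last exact: bq.
    rewrite dint_static ?ltW// -(H psi a b)//.
    have -> : (fun x => (r b x - r a x - (b - a) * q z x) * psi x) =
        (fun x => r b x * psi x - r a x * psi x - (b - a) * (q z x * psi x)).
      by apply/funext => y; ring.
    have c1 K s : jcont K -> continuous (fun x => K s x * psi x).
      by move=> jK; apply: continuousM => //; exact: cs.
    rewrite RintegralB//; last 2 first.
    - by apply: integrable_subr => //; apply: iT; exact: c1.
    - by apply: integrable_scalerl => //; apply: iT; exact: c1.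
    rewrite RintegralB//; [|by apply: iT; exact: c1|by apply: iT; exact: c1].
    by rewrite RintegralZl//; apply: iT; exact: c1.
  have -> : e * (b - a) * \int[mu]_(x in torus) psi x = dint a b (fun _ x => e * psi x).
    by rewrite dint_static ?ltW// RintegralZl//; [ring|exact: iT].
  have bd : bmeas a b (fun tau x => (q tau x - q z x) * psi x).
    by apply: bq; apply: jcontD => //; exact: jcontN.
  have be : bmeas a b (fun _ x => e * psi x).
    by apply: bmeasM => //; apply: jcont_bmeas; exact: jcont_cst.
  have pt s y : a <= s <= b -> 0 <= y <= 1 -> `|(q s y - q z y) * psi y| <= e * psi y.
    by move=> sab y01; rewrite normrM (ger0_norm (psi0 y)) ler_wpM2r//; exact: qe.
  rewrite ler_norml; apply/andP; split.
    rewrite -dintN//; apply: le_dint => //; first exact: bmeasN.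
    by move=> s y sab y01; have := pt s y sab y01; rewrite ler_norml => /andP[].
  apply: le_dint => // s y sab y01.
  by have := pt s y sab y01; rewrite ler_norml => /andP[].
apply: is_derive_eps => e e0; have [d d0 Hd] := jcont_unif 0 T jq e0.
exists (Num.min d (Num.min t (T - t))); first by rewrite !lt_min d0 t0 subr_gt0.
move=> k; rewrite !lt_min => /andP[kd /andP[kt kT]].
have qe s y : `|s - t| <= `|k| -> 0 <= y <= 1 -> `|q s y - q t y| <= e.
  move=> sk y01; rewrite distrC; apply: Hd => //; first by rewrite !ltW.
  by rewrite distrC; exact: le_lt_trans kd.
move: kt kT; rewrite !ltr_norml => /andP[kt _] /andP[_ kT].
have [k0|k0|->] := ltgtP k 0; last by rewrite addr0 subrr mul0r subr0 normr0 mulr0.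
- have -> : r (t + k) x - r t x - k * q t x =
    - (r t x - r (t + k) x - (t - (t + k)) * q t x) by ring.
  rewrite normrN (_ : `|k| = t - (t + k)); last by rewrite (ltr0_norm k0); ring.
  apply: key => //; [lra|lra|exact: ltW|].
  move=> s y /andP[s1 s2] y01; apply: qe => //.
  by rewrite (ltr0_norm k0) ler0_norm; lra.
- have -> : r (t + k) x - r t x - k * q t x =
    r (t + k) x - r t x - (t + k - t) * q t x by ring.
  rewrite (_ : `|k| = t + k - t); last by rewrite (gtr0_norm k0); ring.
  apply: key => //; [lra|lra|exact: ltW|].
  move=> s y /andP[s1 s2] y01; apply: qe => //.
  by rewrite (gtr0_norm k0) ger0_norm; lra.
Qed.

End Evolution.

(** * The initial data *)


Section InitialData.
Context {R : realType}.
Notation mu := (@lebesgue_measure R).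

(** An essential bound on a continuous function holds everywhere: truncation at
    the essential bound changes the function only on a null set, hence nowhere.
    *)
Lemma normr_le_torus_norm_inf (f : R -> R) : continuous f -> periodic1 f ->
  forall x, `|f x| <= fine (torus_norm +oo f).
Proof.
move=> cf pf.
have [N _ HN] := jcont_bound 0 0 (jcont_x cf).
have le_N : (torus_norm +oo f <= N%:E)%E.
  apply/torus_norm_infP; apply: (@filterE _ _ (ae_filter_ringOfSetsType mu)) => x.
  rewrite /torus /= in_itv /= => /andP[/ltW x0 x1].
  by rewrite lee_fin; apply: (HN 0); rewrite ?lexx ?x0.
have fin : torus_norm +oo f \is a fin_num.
  by rewrite ge0_fin_numE ?torus_norm_ge0// (le_lt_trans le_N)// ltry.
set m := fine _; have mE : torus_norm +oo f = m%:E by rewrite fineK.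
have /torus_norm_infP ae : (torus_norm +oo f <= m%:E)%E by rewrite mE.
have h : (fun x => `|f x|) = (fun x => clamp 0 m `|f x|).
  apply: torus_ae_eq.
  - by move=> x; rewrite pf.
  - by move=> x; rewrite pf.
  - exact: continuous_norm.
  - move=> x; apply: (@continuous_comp _ _ _ (fun x => `|f x|) (clamp 0 m)).
      exact: continuous_norm.
    exact: continuous_clamp.
  - apply: (@filterS _ _ (ae_filter_ringOfSetsType mu)) ae => x h tx.
    by rewrite clamp_id// normr_ge0 -lee_fin h.
move=> x; have := congr1 (fun k => k x) h => /= ->.
have m0 : 0 <= m by rewrite -lee_fin -mE torus_norm_ge0.
by have /andP[] := clamp_itv `|f x| m0.
Qed.

Lemma torus_norm1_pos (f : R -> R) : continuous f -> (forall x, 0 < f x) ->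
  \int[mu]_(x in torus) f x = fine (torus_norm 1 f).
Proof.
move=> cf f0; rewrite torus_norm1E; last exact: continuous_measurable_fun.
by congr fine; apply: eq_integral => x _; rewrite gtr0_norm.
Qed.

Lemma sqr_torus_norm2 (f : R -> R) : continuous f ->
  \int[mu]_(x in torus) (f x ^+ 2) = fine (torus_norm 2%:E f) ^+ 2.
Proof.
move=> cf; rewrite torus_norm2E; last exact: continuous_measurable_fun.
rewrite EFin_Rintegral//; last first.
  by apply: continuous_integrable_torus => x; apply: cvgM; exact: cf.
have I0 : 0 <= \int[mu]_(x in torus) (f x ^+ 2).
  by apply: Rintegral_ge0 => x _; exact: sqr_ge0.
by rewrite poweR_EFin /= powR12_sqrt// sqr_sqrtr.
Qed.

(** The factor of the gradient in the effective velocity is a power [al - 2] of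
    the density, possibly negative, so the bound [B] on the inverse of the
    density is used together with [A]. *)
Lemma energy_density_le (cp cmu al ga A B y z w : R) : 0 < cp -> 1 <= ga -> 0 <= al ->
  0 < y -> y <= A -> y^-1 <= B ->
  2^-1 * (y * ((w + cmu * (y `^ (al - 2) * z)) * (w + cmu * (y `^ (al - 2) * z)))) +
    internal_energy cp ga y <=
  A * w ^+ 2 + (cmu * A `^ al) ^+ 2 * B ^+ 3 * z ^+ 2 + energy_bound cp ga A.
Proof.
move=> cp0 ga1 al0 y0 yA yB; apply: lerD; last exact: internal_energy_le.
have e : y `^ (al - 2) = y `^ al * y^-1 ^+ 2.
  have := powR_addn (al - 2) 2 y0; rewrite subrK => ->.
  by rewrite -mulrA -exprMn divff ?gt_eqF// expr1n mulr1.
set c := cmu * _.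
apply: (@le_trans _ _ (y * w ^+ 2 + y * c ^+ 2)).
  rewrite -subr_ge0 (_ : _ - _ = 2^-1 * (y * (w - c) ^+ 2)); last by field.
  by rewrite mulr_ge0 // mulr_ge0 ?sqr_ge0// ltW.
apply: lerD; first by rewrite ler_wpM2r// sqr_ge0.
have -> : y * c ^+ 2 = (cmu * y `^ al) ^+ 2 * y^-1 ^+ 3 * z ^+ 2.
  by rewrite /c e; field; rewrite gt_eqF.
have yi0 : 0 <= y^-1 by rewrite invr_ge0 ltW.
apply: ler_wpM2r; first exact: sqr_ge0.
apply: ler_pM; [exact: sqr_ge0|exact: exprn_ge0| |].
  rewrite !exprMn ler_wpM2l ?sqr_ge0//; apply: lerXn2r; rewrite ?nnegrE ?powR_ge0//.
  by apply: ge0_ler_powR => //; rewrite nnegrE ltW// (lt_le_trans y0).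
by apply: lerXn2r => //; rewrite nnegrE (le_trans yi0).
Qed.

End InitialData.

(** * From distributional solutions to the energy inequality *)


(** The arguments [A], [B], [U] and [D] stand for the norms of the initial
    density, of its inverse, of the initial velocity and of the initial density
    gradient. *)
Definition initial_energy_bound {R : realType} (cp cmu al ga A B U D : R) : R :=
  A * U ^+ 2 + (cmu * A `^ al) ^+ 2 * B ^+ 3 * D ^+ 2 + energy_bound cp ga A.

Section Reduction.
Context {R : realType}.
Notation mu := (@lebesgue_measure R).
Context (cp cmu al ga : R) (Tstar : \bar R) (rho u f g gt : R -> R -> R) (rho0 u0 : R -> R).
Context (S : smooth_solution cp cmu al ga Tstar rho u f rho0 u0).
Context (T : R) (T0 : 0 < T) (TT : (T%:E < Tstar)%E).

(** Freezing the solution before time 0 and after time [T] makes all the fields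
    jointly continuous on the whole plane. *)
Definition frozen_time (t : R) : R := clamp 0 T t.
Definition rhoT (t x : R) : R := rho (frozen_time t) x.
Definition rhoT_x (t x : R) : R := derive1 (rho (frozen_time t)) x.
Definition rhoT_xx (t x : R) : R := derive1 (derive1 (rho (frozen_time t))) x.
Definition uT (t x : R) : R := u (frozen_time t) x.
Definition uT_x (t x : R) : R := derive1 (u (frozen_time t)) x.

Lemma frozen_time_itv t : 0 <= frozen_time t <= T.
Proof. by apply: clamp_itv; exact: ltW. Qed.

Lemma frozen_time_id t : 0 < t < T -> frozen_time t = t.
Proof. by move=> /andP[t0 tT]; apply: clamp_id; rewrite !ltW. Qed.

Lemma before_Tstar t : 0 <= t <= T -> (0 <= t%:E < Tstar)%E.
Proof.
by move=> /andP[t0 tT]; rewrite lee_fin t0 (le_lt_trans _ TT)// lee_fin.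
Qed.

Lemma rho_continuous t : 0 <= t <= T -> continuous (rho t).
Proof. by move=> /before_Tstar /(sol_continuous S) []. Qed.

Lemma u_continuous t : 0 <= t <= T -> continuous (u t).
Proof. by move=> /before_Tstar /(sol_continuous S) []. Qed.

Lemma rho_H3 t : 0 <= t <= T -> Hspace 3 (rho t).
Proof. by have [H _] := sol_rho_H3 S T0 TT => tT; apply: H; rewrite in_itv. Qed.

Lemma u_H3 t : 0 <= t <= T -> Hspace 3 (u t).
Proof. by have [H _] := sol_u_H3 S T0 TT => tT; apply: H; rewrite in_itv. Qed.

Lemma rho_x_H2 t : 0 <= t <= T ->
  [/\ continuous (derive1 (rho t)), is_weak_deriv (rho t) (derive1 (rho t)),
      Hspace 2 (derive1 (rho t)) & forall x : R, is_derive x 1 (rho t) (derive1 (rho t) x)].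
Proof. by move=> tT; apply: Hspace_derive1; [exact: rho_continuous|exact: rho_H3]. Qed.

Lemma u_x_H2 t : 0 <= t <= T ->
  [/\ continuous (derive1 (u t)), is_weak_deriv (u t) (derive1 (u t)),
      Hspace 2 (derive1 (u t)) & forall x : R, is_derive x 1 (u t) (derive1 (u t) x)].
Proof. by move=> tT; apply: Hspace_derive1; [exact: u_continuous|exact: u_H3]. Qed.

Lemma Hspace_periodic k (h : R -> R) : Hspace k h -> periodic1 h.
Proof. by move=> /Hspace_Lp2 []. Qed.

Lemma jcont_rhoT : jcont rhoT.
Proof.
apply: C_Hspace_jcont (sol_rho_H3 S T0 TT) _; first exact: ltW.
by move=> t; exact: rho_continuous.
Qed.

Lemma jcont_uT : jcont uT.
Proof.
apply: C_Hspace_jcont (sol_u_H3 S T0 TT) _; first exact: ltW.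
by move=> t; exact: u_continuous.
Qed.

Lemma rho_x_C : C_Hspace T 2 (fun t => derive1 (rho t)).
Proof. exact: C_Hspace_derive1 (sol_rho_H3 S T0 TT) rho_continuous. Qed.

Lemma jcont_rhoT_x : jcont rhoT_x.
Proof.
apply: (C_Hspace_jcont (ltW T0) rho_x_C) => t tT.
by have [] := rho_x_H2 tT.
Qed.

Lemma jcont_rhoT_xx : jcont rhoT_xx.
Proof.
have c t : 0 <= t <= T -> continuous (derive1 (rho t)) by move=> /rho_x_H2 [].
apply: (C_Hspace_jcont (ltW T0) (C_Hspace_derive1 rho_x_C c)) => t tT.
by have [_ _ h2 _] := rho_x_H2 tT; have [] := Hspace_derive1 (c t tT) h2.
Qed.

Lemma jcont_uT_x : jcont uT_x.
Proof.
apply: (C_Hspace_jcont (ltW T0) (C_Hspace_derive1 (sol_u_H3 S T0 TT) u_continuous)).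
by move=> t tT; have [] := u_x_H2 tT.
Qed.

Lemma periodic_rhoT t : periodic1 (rhoT t).
Proof. exact: Hspace_periodic (rho_H3 (frozen_time_itv t)). Qed.

Lemma periodic_uT t : periodic1 (uT t).
Proof. exact: Hspace_periodic (u_H3 (frozen_time_itv t)). Qed.

Lemma periodic_rhoT_x t : periodic1 (rhoT_x t).
Proof. by have [_ _ /Hspace_periodic] := rho_x_H2 (frozen_time_itv t). Qed.

Lemma periodic_uT_x t : periodic1 (uT_x t).
Proof. by have [_ _ /Hspace_periodic] := u_x_H2 (frozen_time_itv t). Qed.

Lemma is_derive_rhoT t (x : R) : is_derive x 1 (rhoT t) (rhoT_x t x).
Proof. by have [_ _ _ h] := rho_x_H2 (frozen_time_itv t); exact: h. Qed.

Lemma is_derive_uT t (x : R) : is_derive x 1 (uT t) (uT_x t x).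
Proof. by have [_ _ _ h] := u_x_H2 (frozen_time_itv t); exact: h. Qed.

Lemma is_derive_rhoT_x t (x : R) : is_derive x 1 (rhoT_x t) (rhoT_xx t x).
Proof.
have [c _ h2 _] := rho_x_H2 (frozen_time_itv t).
by have [_ _ _ h] := Hspace_derive1 c h2; exact: h.
Qed.

Lemma rhoT_gt0 t x : 0 < rhoT t x.
Proof. exact/(sol_rho_gt0 S)/before_Tstar/frozen_time_itv. Qed.

Notation rateT := (mass_rate rhoT rhoT_x uT uT_x).

Lemma jcont_rate : jcont rateT.
Proof. exact: jcont_mass_rate jcont_rhoT jcont_rhoT_x jcont_uT jcont_uT_x. Qed.

Lemma periodic_rate t : periodic1 (rateT t).
Proof. by move=> x; rewrite /mass_rate periodic_rhoT periodic_uT periodic_rhoT_x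
  periodic_uT_x. Qed.

Lemma pairing_cutoff (h F : R -> R -> R) (th psi : R -> R) :
  (forall t, ~~ (0 < t < T) -> th t = 0) ->
  (forall t, 0 < t < T -> \int[mu]_(x in torus) (h t x * (th t * psi x)) =
    \int[mu]_(x in torus) (F t x * (th t * psi x))) ->
  pairing Tstar h (fun t x => th t * psi x) = dint 0 T (fun t x => F t x * (th t * psi x)).
Proof.
move=> th0 hF; apply: (pairing_restrict T0 TT _ hF) => [t x /th0 ->|x].
  by rewrite mul0r.
by rewrite th0 ?mul0r ?mulr0// ltxx andbF.
Qed.

Lemma trap_dtrap_out (h a b t : R) : 0 < h -> 0 < a -> a + h <= b -> b + h < T ->
  ~~ (0 < t < T) -> trap h a b t = 0 /\ dtrap h a b t = 0.
Proof.
move=> h0 a0 hab bhT ntT; have ab : a <= b by lra.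
have o : ~~ (a <= t <= b + h).
  by apply: contra ntT => /andP[q1 q2]; apply/andP; split; lra.
by rewrite (trap_out h0 ab o) (dtrap_out h0 ab o).
Qed.

Lemma mass_weak psi s t : C1_torus psi -> 0 < s -> s < t -> t < T ->
  \int[mu]_(x in torus) (rhoT t x * psi x) - \int[mu]_(x in torus) (rhoT s x * psi x) =
  dint s t (fun tau x => rhoT tau x * uT tau x * derive1 psi x).
Proof.
move=> psiC1 s0 st tT; have [ppsi _ cdpsi] := psiC1.
have jrv : jcont (fun t x => rhoT t x * uT t x) := jcontM jcont_rhoT jcont_uT.
have j0 : jcont (fun _ _ : R => 0 : R) := @jcont_cst R 0.
rewrite (weak_evolution T0 jcont_rhoT (jcont_bmeas 0 T jrv) (jcont_bmeas 0 T j0) psiC1 _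
  s0 st tT).
  by apply: eq_dint => tau x _ _; rewrite mul0r addr0.
move=> h a b h0 a0 hab bhT.
have [tst dxE dtE] := test_fun_trap_static TT h0 a0 hab bhT psiC1.
have := sol_mass S tst; rewrite /dist_dt /dist_dx dxE dtE.
have o t' := @trap_dtrap_out h a b t' h0 a0 hab bhT.
rewrite (@pairing_cutoff rho rhoT _ psi (fun t' n => (o t' n).2)); last first.
  by move=> t' t'T; rewrite /rhoT frozen_time_id.
rewrite (@pairing_cutoff _ (fun t x => rhoT t x * uT t x) _ (derive1 psi)
  (fun t' n => (o t' n).1)); last first.
  by move=> t' t'T; apply: eq_Rintegral => x _; rewrite /rhoT /uT frozen_time_id//; ring.
move=> H; rewrite [X in _ + X](_ : _ = 0); last first.
  by apply: Rintegral_eq0 => y _; apply: Rintegral_eq0 => x _; rewrite mul0r.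
by rewrite addr0; apply/eqP; rewrite -oppr_eq0 opprD; exact/eqP.
Qed.

Lemma mass_classical (t x : R) : 0 < t < T -> is_derive t 1 (fun s => rhoT s x) (rateT t x).
Proof.
apply: (mass_is_derive jcont_rhoT jcont_rate periodic_rhoT periodic_rate) => psi s t'
  psiC1 s0 st tT.
rewrite (mass_weak psiC1 s0 st tT); have [ppsi dpsi cdpsi] := psiC1.
apply: eq_Rintegral => tau _.
have [mC1 dmE] := C1_torus_momentum jcont_rhoT jcont_rhoT_x jcont_uT jcont_uT_x
  periodic_rhoT periodic_uT is_derive_rhoT is_derive_uT tau.
have drv (y : R) : is_derive y 1 (fun y => rhoT tau y * uT tau y) (- rateT tau y).
  by have := is_derive_C1_torus mC1 y; rewrite dmE.
have prv : periodic1 (fun y => rhoT tau y * uT tau y) by move=> y; rewrite periodic_rhoT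
  periodic_uT.
have crt : continuous (fun x => - rateT tau x) := continuousN (jcont_sect jcont_rate).
have := IBP_torus prv ppsi drv (is_derive_C1_torus psiC1) crt cdpsi.
move=> /eqP; rewrite eq_sym eqr_oppLR => /eqP ->.
have ci : mu.-integrable torus (EFin \o (fun x => rateT tau x * psi x)).
  apply: continuous_integrable_torus; apply: continuousM; first exact: jcont_sect jcont_rate.
  exact: C1_torus_continuous.
rewrite -[in RHS](opprK (\int[mu]_(x in torus) _)); congr (- _).
rewrite -mulN1r -RintegralZl//; apply: eq_Rintegral => y _; by rewrite mulN1r mulNr.
Qed.

(** The constant 1 is a test function in space; the initial time is reached by
    continuity. *)
Lemma mass_const t : 0 < t < T ->
  \int[mu]_(x in torus) rhoT t x = \int[mu]_(x in torus) rho0 x.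
Proof.
move=> /andP[t0 tT]; pose A t := \int[mu]_(x in torus) rhoT t x.
have cA : continuous A := continuous_Rintegral_torus jcont_rhoT.
have [c1 dc1] := @C1_torus_cst R 1.
have A_cst s : 0 < s < t -> A t = A s.
  move=> /andP[s0 st]; apply/eqP; rewrite -subr_eq0; apply/eqP.
  have := mass_weak c1 s0 st tT; rewrite dc1 [RHS](_ : _ = 0); last first.
    by apply: Rintegral_eq0 => y _; apply: Rintegral_eq0 => x _; rewrite mulr0.
  by under eq_Rintegral do rewrite mulr1; under [X in _ - X]eq_Rintegral do rewrite mulr1.
have <- : A 0 = \int[mu]_(x in torus) rho0 x.
  apply: eq_Rintegral => x _; rewrite /rhoT /frozen_time clamp_id ?lexx ?ltW//.
  by case: (sol_init S) => ->.
have t00 : 0 <= (0 : R) <= t by rewrite lexx ltW.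
have cc (k : R) : continuous (fun _ : R => k) := @continuous_const R k.
apply/eqP; rewrite eq_le -subr_ge0 -[X in _ && X]subr_ge0; apply/andP; split.
- apply: (@continuous_ge0_closure _ (fun s => A s - A t) 0 t _ t0 _ 0 t00).
    exact: (continuousD cA (continuousN (cc (A t)))).
  by move=> s st; rewrite (A_cst s st) subrr.
- apply: (@continuous_ge0_closure _ (fun s => A t - A s) 0 t _ t0 _ 0 t00).
    exact: (continuousD (cc (A t)) (continuousN cA)).
  by move=> s st; rewrite (A_cst s st) subrr.
Qed.

Notation sigma := (stress cp cmu al ga rhoT uT uT_x).

(** Outside [0, T] the representative need not agree with [h], so only test
    functions supported inside are paired. *)
Definition represents (h hb : R -> R -> R) (N : R) : Prop :=
  [/\ measurable_fun setT (fun z : R * R => hb z.1 z.2),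
      (forall t x, `|hb t x| <= N) &
      forall phi a b, jcont phi -> 0 < a -> b < T ->
        (forall t x, ~~ (a <= t <= b) -> phi t x = 0) ->
        pairing Tstar h phi = dint 0 T (fun t x => hb t x * phi t x)].

Lemma momentum_weak fb N psi s t : represents f fb N ->
  C1_torus psi -> 0 < s -> s < t -> t < T ->
  \int[mu]_(x in torus) (rhoT t x * uT t x * psi x) -
  \int[mu]_(x in torus) (rhoT s x * uT s x * psi x) =
  dint s t (fun tau x => sigma tau x * derive1 psi x + rhoT tau x * fb tau x * psi x).
Proof.
move=> [mf fN Hf] psiC1 s0 st tT; have [ppsi _ cdpsi] := psiC1.
have cpsi := C1_torus_continuous psiC1.
have jrv : jcont (fun t x => rhoT t x * uT t x) := jcontM jcont_rhoT jcont_uT.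
have jp a : jcont (fun t x => rhoT t x `^ a) := jcont_density_powR jcont_rhoT rhoT_gt0 (a := a).
have j1 : jcont (fun t x => rhoT t x * (uT t x * uT t x)) := jcontM jcont_rhoT (jcontM
  jcont_uT jcont_uT).
have j2 : jcont (fun t x => cp * rhoT t x `^ ga) := jcontM (jcont_cst (c := cp)) (jp ga).
have j3 : jcont (fun t x => cmu * rhoT t x `^ al * uT_x t x) :=
  jcontM (jcontM (jcont_cst (c := cmu)) (jp al)) jcont_uT_x.
have js : jcont sigma := jcontD (jcontD j1 j2) (jcontN j3).
have bf : bmeas 0 T fb by split => //; exists N.
have brf : bmeas 0 T (fun t x => rhoT t x * fb t x) := bmeasM (jcont_bmeas 0 T jcont_rhoT) bf.
apply: (weak_evolution T0 jrv (jcont_bmeas 0 T js) brf psiC1 _ s0 st tT).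
move=> h a b h0 a0 hab bhT.
have [tst dxE dtE] := test_fun_trap_static TT h0 a0 hab bhT psiC1.
have o t' := @trap_dtrap_out h a b t' h0 a0 hab bhT.
have := sol_momentum S tst; rewrite /dist_dt /dist_dx dxE dtE.
rewrite (@pairing_cutoff _ (fun t x => rhoT t x * uT t x) _ psi (fun t' n => (o t'
  n).2)); last first.
  by move=> t' t'T; rewrite /rhoT /uT frozen_time_id.
rewrite (@pairing_cutoff _ (fun t x => rhoT t x * (uT t x * uT t x)) _ (derive1 psi)
  (fun t' n => (o t' n).1)); last first.
  by move=> t' t'T; apply: eq_Rintegral => x _; rewrite /rhoT /uT frozen_time_id//; ring.
rewrite (@pairing_cutoff _ (fun t x => cp * rhoT t x `^ ga) _ (derive1 psi)
  (fun t' n => (o t' n).1)); last first.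
  by move=> t' t'T; apply: eq_Rintegral => x _; rewrite /rhoT frozen_time_id.
rewrite (@pairing_cutoff _ (fun t x => cmu * rhoT t x `^ al * uT_x t x) _ (derive1 psi)
  (fun t' n => (o t' n).1)); last first.
  move=> t' t'T; have t'T' : 0 <= t' <= T by case/andP: t'T => q1 q2; rewrite !ltW.
  have [cux wux _ _] := u_x_H2 t'T'.
  have cr := rho_continuous t'T'.
  have mr : measurable_fun setT (fun x => viscosity cmu al (rho t' x)).
    apply: continuous_measurable_fun => x; apply: cvgM; first exact: cvg_cst.
    apply: (@continuous_comp _ _ _ (rho t') (fun y : R => y `^ al)); first exact: cr.
    by apply: continuous_powR_gt0; exact: (sol_rho_gt0 S _ (before_Tstar t'T')).
  have mpsi : measurable_fun setT (fun x => trap h a b t' * derive1 psi x).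
    by apply: continuous_measurable_fun => x; apply: cvgM; [exact: cvg_cst|exact: cdpsi].
  have ww := is_weak_deriv_weak_deriv wux.
  have mw k : is_weak_deriv (u t') k ->
      measurable_fun torus (fun x => viscosity cmu al (rho t' x) * k x *
        (trap h a b t' * derive1 psi x)).
    move=> [_ Lk _]; apply: measurable_funTS; apply: measurable_funM => //.
    by apply: measurable_funM => //; exact: Lp_measurable Lk.
  transitivity (\int[mu]_(x in torus) (viscosity cmu al (rho t' x) * derive1 (u t') x *
      (trap h a b t' * derive1 psi x))).
    apply: eq_Rintegral_torus_ae; [exact: mw|exact: mw|].
    have := weak_deriv_unique ww wux.
    by apply: (@filterS _ _ (ae_filter_ringOfSetsType mu)) => x wx tx; rewrite wx.
  by apply: eq_Rintegral => x _; rewrite /rhoT /uT_x frozen_time_id.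
have -> : pairing Tstar (fun t x => rho t x * f t x) (fun t x => trap h a b t * psi x) =
    dint 0 T (fun t x => rhoT t x * fb t x * (trap h a b t * psi x)).
  transitivity (pairing Tstar f (fun t x => rhoT t x * (trap h a b t * psi x))).
    apply: eq_Rintegral => t' _; apply: eq_Rintegral => x _.
    have [t'T|t'T] := boolP (0 < t' < T); first by rewrite /rhoT frozen_time_id//; ring.
    by rewrite (o t' t'T).1 !(mul0r, mulr0).
  have ab : a <= b by lra.
  have jt : jcont (fun t x => trap h a b t * psi x) :=
    jcontM (jcont_t (@continuous_trap R h a b)) (jcont_x cpsi).
  rewrite (Hf _ a (b + h) (jcontM jcont_rhoT jt) a0 bhT).
    by apply: eq_dint => t' x _ _; ring.
  by move=> t' x o'; rewrite (trap_out h0 ab o') mul0r mulr0.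
have jt : jcont (fun t x => trap h a b t * derive1 psi x) :=
  jcontM (jcont_t (@continuous_trap R h a b)) (jcont_x cdpsi).
have -> : dint 0 T (fun t x => sigma t x * (trap h a b t * derive1 psi x)) =
    dint 0 T (fun t x => rhoT t x * (uT t x * uT t x) * (trap h a b t * derive1 psi x)) +
    dint 0 T (fun t x => cp * rhoT t x `^ ga * (trap h a b t * derive1 psi x)) -
    dint 0 T (fun t x => cmu * rhoT t x `^ al * uT_x t x * (trap h a b t * derive1 psi x)).
  have b1 := jcont_bmeas 0 T (jcontM j1 jt); have b2 := jcont_bmeas 0 T (jcontM j2 jt).
  have b3 := jcont_bmeas 0 T (jcontM j3 jt).
  rewrite -(dintD b1 b2) -(dintN b3) -(dintD (bmeasD b1 b2) (bmeasN b3)).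
  by apply: eq_dint => t' x _ _; rewrite /stress; ring.
set P1 := dint _ _ _; set P2 := dint _ _ _; set P3 := dint _ _ _; set P4 := dint _ _ _.
set P5 := dint _ _ _; move: P1 P2 P3 P4 P5 => P1 P2 P3 P4 P5 H.
have -> : P1 + (P2 + P3 - P4) + P5 = - (- P1 - P2) + (P3 - P4 + P5) by ring.
rewrite H; ring.
Qed.

Lemma force_potential fb gb Nf Ng psi s t : represents f fb Nf -> represents g gb Ng ->
  (forall phi, test_fun Tstar phi -> pairing Tstar f phi = dist_dx Tstar g phi) ->
  C1_torus psi -> 0 < s -> s < t -> t < T ->
  dint s t (fun tau x => fb tau x * psi x + gb tau x * derive1 psi x) = 0.
Proof.
move=> [mf fN Hf] [mg gN Hg] Hfg psiC1 s0 st tT; have [ppsi _ cdpsi] := psiC1.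
have cpsi := C1_torus_continuous psiC1.
have bf : bmeas 0 T fb by split => //; exists Nf.
have bg : bmeas 0 T gb by split => //; exists Ng.
have j0 : jcont (fun _ _ : R => 0 : R) := @jcont_cst R 0.
have := weak_evolution T0 j0 bg bf psiC1 _ s0 st tT.
have z : \int[mu]_(x in torus) (0 * psi x) = 0.
  by apply: Rintegral_eq0 => x _; rewrite mul0r.
rewrite z subrr => H; rewrite H; first by apply: eq_dint => tau x _ _; rewrite addrC.
move=> h a b h0 a0 hab bhT; have ab : a <= b by lra.
have [tst dxE dtE] := test_fun_trap_static TT h0 a0 hab bhT psiC1.
have := Hfg _ tst; rewrite /dist_dx dxE.
have jt k : continuous k -> jcont (fun t x => trap h a b t * k x).
  by move=> ck; exact: (jcontM (jcont_t (@continuous_trap R h a b)) (jcont_x ck)).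
rewrite (Hf _ a (b + h) (jt _ cpsi) a0 bhT); last first.
  by move=> t' x o; rewrite (trap_out h0 ab o) mul0r.
rewrite (Hg _ a (b + h) (jt _ cdpsi) a0 bhT); last first.
  by move=> t' x o; rewrite (trap_out h0 ab o) mul0r.
move=> ->; rewrite [X in X + _ + _](_ : _ = 0); last first.
  by apply: Rintegral_eq0 => y _; apply: Rintegral_eq0 => x _; rewrite mul0r.
by rewrite add0r subrr.
Qed.

(** The density itself serves as a test function, after a cut-off in time: it
    is continuously differentiable because the continuity equation holds
    pointwise. *)
Lemma potential_time gb gtb Ng Ngt h a b : represents g gb Ng -> represents gt gtb Ngt ->
  (forall phi, test_fun Tstar phi -> pairing Tstar gt phi = dist_dt Tstar g phi) ->
  0 < h -> 0 < a -> a + h <= b -> b + h < T ->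
  dint 0 T (fun t x => gb t x * (rateT t x * trap h a b t + rhoT t x * dtrap h a b t)) =
  - dint 0 T (fun t x => gtb t x * (rhoT t x * trap h a b t)).
Proof.
move=> [mg gN Hg] [mgt gtN Hgt] H h0 a0 hab bhT; have ab : a <= b by lra.
have [tst dxE dtE] := test_fun_trap TT h0 a0 hab bhT jcont_rhoT jcont_rhoT_x jcont_rate
  periodic_rhoT is_derive_rhoT mass_classical.
have := H _ tst; rewrite /dist_dt dtE.
have j1 : jcont (fun t _ => trap h a b t) := jcont_t (@continuous_trap R h a b).
have j2 : jcont (fun t _ => dtrap h a b t) := jcont_t (@continuous_dtrap R h a b).
rewrite (Hgt _ a (b + h) (jcontM j1 jcont_rhoT) a0 bhT); last first.
  by move=> t x o; rewrite (trap_out h0 ab o) mul0r.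
rewrite (Hg _ a (b + h) (jcontD (jcontM j2 jcont_rhoT) (jcontM j1 jcont_rate)) a0 bhT);
  last first.
  by move=> t x o; rewrite (trap_out h0 ab o) (dtrap_out h0 ab o) !mul0r addr0.
move=> E; apply/eqP; rewrite -eqr_oppLR; apply/eqP.
transitivity (dint 0 T (fun t x => gtb t x * (trap h a b t * rhoT t x))).
  rewrite E; congr (- _); apply: eq_dint => t x _ _; ring.
by apply: eq_dint => t x _ _; ring.
Qed.

Lemma frozen_time0 : frozen_time 0 = 0.
Proof. by apply: clamp_id; rewrite lexx ltW. Qed.

Context (cp0 : 0 < cp) (cmu0 : 0 < cmu) (al_ge : 2^-1 <= al).
Context (ga_ge : 2 - al <= ga) (al_le_ga : al <= ga) (ga_le : ga <= al + 1).

Lemma initial_energy_le : energy cp cmu al ga rhoT rhoT_x uT 0 <=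
  initial_energy_bound cp cmu al ga (fine (torus_norm +oo rho0))
    (fine (torus_norm +oo (fun x => (rho0 x)^-1))) (fine (torus_norm 2%:E u0))
    (fine (torus_norm 2%:E (weak_deriv rho0))).
Proof.
have ga1 : 1 <= ga by have := al_ge; have := ga_ge; have := al_le_ga; lra.
have al0 : 0 <= al by have := al_ge; lra.
have T00 : 0 <= (0 : R) <= T by rewrite lexx ltW.
have [rho0E u0E] := sol_init S.
have c0 : continuous rho0 by rewrite -rho0E; exact: rho_continuous.
have cu0 : continuous u0 by rewrite -u0E; exact: u_continuous.
have p0 : periodic1 rho0 by rewrite -rho0E; exact: Hspace_periodic (rho_H3 T00).
have r0 x : 0 < rho0 x by rewrite -rho0E; exact: (sol_rho_gt0 S _ (before_Tstar T00)).
have [crx wrx _ _] := rho_x_H2 T00; rewrite rho0E in crx wrx.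
have ci : continuous (fun x => (rho0 x)^-1).
  by move=> x; apply: cvgV; [exact: lt0r_neq0|exact: c0].
have pi : periodic1 (fun x => (rho0 x)^-1) by move=> x; rewrite p0.
have bA := normr_le_torus_norm_inf c0 p0; have bB := normr_le_torus_norm_inf ci pi.
have -> : torus_norm 2%:E (weak_deriv rho0) = torus_norm 2%:E (derive1 rho0).
  have ww := is_weak_deriv_weak_deriv wrx; have [_ L1 _] := ww.
  apply: eq_torus_norm2; [exact: Lp_measurable L1|exact: continuous_measurable_fun|].
  exact: weak_deriv_unique ww wrx.
rewrite /initial_energy_bound -!sqr_torus_norm2//.
set A := fine _ in bA *; set B := fine _ in bB *.
have iT k : continuous k -> mu.-integrable torus (EFin \o k).
  exact: continuous_integrable_torus.
have cs (h : R -> R) : continuous h -> continuous (fun x : R => h x ^+ 2 : R).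
  by move=> ch x; apply: cvgM; exact: ch.
have cm (c : R) (h : R -> R) : continuous h -> continuous (fun x : R => c * h x : R).
  by move=> ch x; apply: cvgM; [exact: cvg_cst|exact: ch].
set c1 := (cmu * _) ^+ 2 * _.
have i1 := iT _ (cm A _ (cs _ cu0)); have i2 := iT _ (cm c1 _ (cs _ crx)).
have i3 := iT _ (@continuous_const R (energy_bound cp ga A)).
have <- : \int[mu]_(x in torus) (A * u0 x ^+ 2 + c1 * derive1 rho0 x ^+ 2 + energy_bound
  cp ga A) =
    A * \int[mu]_(x in torus) (u0 x ^+ 2) + c1 * \int[mu]_(x in torus) (derive1 rho0 x ^+ 2) +
    energy_bound cp ga A.
  rewrite RintegralD//; last exact: integrable_addr.
  rewrite RintegralD// Rintegral_torus_cst RintegralZl//; last exact/iT/cs.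
  by rewrite RintegralZl//; exact/iT/cs.
apply: le_Rintegral => //.
- exact/iT/(jcont_sect (@jcont_energy_density R cp cmu al ga rhoT rhoT_x uT jcont_rhoT
  jcont_rhoT_x jcont_uT rhoT_gt0)).
- by apply: integrable_addr => //; exact: integrable_addr.
move=> x _; rewrite /energy_density /eff_vel /rhoT /rhoT_x /uT frozen_time0 rho0E u0E.
apply: energy_density_le => //.
- by apply: le_trans (bA x); exact: ler_norm.
- by apply: le_trans (bB x); exact: ler_norm.
Qed.

(** Here [D] is the total dissipation. The pointwise bound comes from
    [density_sup_le] and holds at each time; the bound on the time integral is
    the energy inequality. *)
Lemma a_priori :
  Linfty_space Tstar f -> Linfty_space Tstar g -> Linfty_space Tstar gt ->
  (forall phi, test_fun Tstar phi -> pairing Tstar f phi = dist_dx Tstar g phi) ->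
  (forall phi, test_fun Tstar phi -> pairing Tstar gt phi = dist_dt Tstar g phi) ->
  let M := fine (torus_norm 1 rho0) in
  exists D : R -> R, [/\ continuous D,
    (forall t x, 0 < t < T -> 0 <= x <= 1 -> rho t x <=
       1 + 2 * M `^ (ga + al - 1) +
       (ga + al - 1) ^+ 2 / (2 * cp * cmu * ga) * D t) &
    2^-1 * \int[mu]_(t in `]0, T]) D t <=
      initial_energy_bound cp cmu al ga (fine (torus_norm +oo rho0))
        (fine (torus_norm +oo (fun x => (rho0 x)^-1))) (fine (torus_norm 2%:E u0))
        (fine (torus_norm 2%:E (weak_deriv rho0))) + cp +
      (force_cost cp cmu ga (fine (Linfty_norm T%:E f)) M +
       fine (Linfty_norm T%:E gt) * M) * T + 2 * fine (Linfty_norm T%:E g) * M].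
Proof.
move=> Lf Lg Lgt Hfg Hgt M.
have ga1 : 1 <= ga by have := al_ge; have := ga_ge; have := al_le_ga; lra.
have ga0 : 0 < ga := lt_le_trans ltr01 ga1.
have al0 : 0 < al by have := al_ge; lra.
have rep h : Linfty_space Tstar h -> exists hb, represents h hb (fine (Linfty_norm T%:E h)).
  move=> Lh; have [hb [N [NE mh hN Hh]]] := Linfty_representative T0 TT Lh.
  exists hb; rewrite NE /=; split; [exact: mh|exact: hN|] => phi a b jphi a0 bT sphi.
  exact: (Hh phi jphi a b a0 bT sphi).
have [fb rf] := rep _ Lf; have [gb rg] := rep _ Lg; have [gtb rgt] := rep _ Lgt.
have [mf fN _] := rf; have [mg gN _] := rg; have [mgt gtN _] := rgt.
have HM t : 0 < t < T -> \int[mu]_(x in torus) rhoT t x = M.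
  move=> tT; rewrite (mass_const tT); have [rho0E _] := sol_init S.
  have T00 : 0 <= (0 : R) <= T by rewrite lexx ltW.
  apply: torus_norm1_pos; first by rewrite -rho0E; exact: rho_continuous.
  by move=> x; rewrite -rho0E; exact: (sol_rho_gt0 S _ (before_Tstar T00)).
have Hw a b := work_le jcont_rhoT jcont_rate rhoT_gt0 HM mg gN mgt gtN
  (fun h a b => potential_time rg rgt Hgt) (a := a) (b := b).
have Hm psi s t := @momentum_weak fb _ psi s t rf.
have Hp psi s t := @force_potential fb gb _ _ psi s t rf rg Hfg.
have H := total_dissip_le cp0 cmu0 al0 T0 ga1 al_le_ga ga_le jcont_rhoT jcont_rhoT_x
  jcont_rhoT_xx jcont_uT jcont_uT_x
  periodic_rhoT periodic_rhoT_x periodic_uT is_derive_rhoT is_derive_rhoT_x is_derive_uT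
    rhoT_gt0 mass_classical mf mg fN gN Hm Hp HM Hw.
exists (total_dissip cp cmu al ga rhoT rhoT_x); split.
- exact: continuous_Rintegral_torus (@jcont_dissip R cp cmu al ga rhoT rhoT_x jcont_rhoT
  jcont_rhoT_x rhoT_gt0).
- move=> t x tT x01; pose be := (ga + al - 1) / 2.
  have be2 : 2^-1 <= be by rewrite /be; have := ga_ge; lra.
  have := density_sup_le (is_derive_rhoT t) (jcont_sect jcont_rhoT_x) (rhoT_gt0 t) be2
    (HM t tT) x01.
  have -> : 2 * be = ga + al - 1 by rewrite /be; field.
  rewrite {1}/rhoT frozen_time_id// => /le_trans; apply; rewrite lerD2l /total_dissip /dissip.
  rewrite RintegralZl//; last first.
    apply: continuous_integrable_torus.
    apply: (jcont_sect (H := fun t x => rhoT t x `^ (ga + al - 3) * (rhoT_x t x * rhoT_x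
      t x)) (t := t)).
    exact: (jcontM (jcont_density_powR jcont_rhoT rhoT_gt0 (a := ga + al - 3)) (jcontM
      jcont_rhoT_x jcont_rhoT_x)).
  rewrite (_ : ga + al - 1 - 2 = ga + al - 3); last by ring.
  rewrite le_eqVlt; apply/orP; left; apply/eqP; rewrite /be; field.
  by rewrite !gt_eqF.
- have -> : \int[mu]_(t in `]0, T]) total_dissip cp cmu al ga rhoT rhoT_x t =
      prim (total_dissip cp cmu al ga rhoT rhoT_x) T.
    by rewrite /prim (_ : `]T, 0]%classic = set0) ?Rintegral_set0 ?subr0// set_itv_ge//
      bnd_simp -leNgt ltW.
  apply: le_trans H _; rewrite lerD2r lerD2r lerD2r; exact: initial_energy_le.
Qed.

End Reduction.

(** * The time average of the maximum *)


Section Conclusion.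
Context {R : realType}.
Notation mu := (@lebesgue_measure R).

(** The integral of a nonnegative function is a supremum over the simple
    functions below it; this supremum is monotone even when the functions are
    not measurable. *)
Lemma le_integral_nonneg (D : set R) (f g : R -> \bar R) :
  (forall x, D x -> (0 <= f x)%E) -> (forall x, D x -> (f x <= g x)%E) ->
  (\int[mu]_(x in D) f x <= \int[mu]_(x in D) g x)%E.
Proof.
move=> f0 fg.
have g0 x : D x -> (0 <= g x)%E by move=> Dx; exact: le_trans (f0 x Dx) (fg x Dx).
rewrite !ge0_integralE//; apply: le_ereal_sup => _ [h hf <-]; exists h => // x.
apply: le_trans (hf x) _; rewrite !patchE; case: ifPn => //.
by rewrite inE; exact: fg.
Qed.

(** The contribution of the initial data is divided by the length of the time
    interval, so it disappears in the limit. *)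
Lemma limf_esup_le_decay (F : R -> \bar R) (c k : R) : 0 <= k ->
  (forall T, 0 < T -> (F T <= (c + T^-1 * k)%:E)%E) ->
  (limf_esup F (pinfty_nbhs R) <= c%:E)%E.
Proof.
move=> k0 HF; apply/lee_addgt0Pr => e e0.
pose V : set R := [set T | k / e < T].
have V0 T : V T -> 0 < T by apply: le_lt_trans; rewrite divr_ge0// ltW.
apply: (@le_trans _ _ (ereal_sup [set F T | T in V])).
  apply: ereal_inf_lbound; exists V => //.
  by exists (k / e); split => //; exact: num_real.
apply: ge_ereal_sup => _ [T VT <-]; apply: le_trans (HF T (V0 T VT)) _.
rewrite -EFinD lee_fin lerD2l mulrC ler_pdivrMr; last exact: V0.
by rewrite mulrC -ler_pdivrMr// ltW.
Qed.

Lemma force_cost_le (cp cmu ga N N' M : R) : 0 < cp -> 0 < cmu -> 0 <= ga -> 0 <= M ->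
  0 <= N -> N <= N' -> force_cost cp cmu ga N M <= force_cost cp cmu ga N' M.
Proof.
move=> cp0 cmu0 ga0 M0 N0 NN; rewrite /force_cost.
apply: ler_wpM2r; first by rewrite addr_ge0.
apply: ler_wpM2r; first by rewrite invr_ge0 !mulr_ge0// ltW.
apply: ler_wpM2r; first exact: ltW.
by apply: lerXn2r => //; rewrite nnegrE (le_trans N0).
Qed.

(** Twice the constant in front of the dissipation in the bound on the density;
    the factor 2 compensates for the half of the dissipation that is spent on
    the force. *)
Definition growth (cp cmu al ga : R) : R := (ga + al - 1) ^+ 2 / (cp * cmu * ga).

(** The arguments [m], [nf] and [ngt] stand for the L^1 norm of the initial
    density and the norms of the force and of the time derivative of its
    potential. *)
Definition mean_const (cmu cp al ga : R) (m nf ngt : \bar R) : R :=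
  1 + 2 * fine m `^ (ga + al - 1) + growth cp cmu al ga *
    (force_cost cp cmu ga (fine nf) (fine m) + fine ngt * fine m).

(** The arguments stand for the norms of the initial density, of its inverse,
    of the initial velocity, of the initial density gradient, and of the
    potential. The mass, which multiplies the norm of the potential in the
    energy inequality, is bounded here by the sup norm of the initial density.
    *)
Definition initial_const (cmu cp ga al : R) (A B U D ng : \bar R) : R :=
  growth cp cmu al ga *
    (initial_energy_bound cp cmu al ga (fine A) (fine B) (fine U) (fine D) + cp +
     2 * fine ng * fine A).

Context (cp cmu al ga : R) (Tstar : \bar R) (rho u f g gt : R -> R -> R) (rho0 u0 : R -> R).
Context (S : smooth_solution cp cmu al ga Tstar rho u f rho0 u0).
Context (cp0 : 0 < cp) (cmu0 : 0 < cmu) (al_ge : 2^-1 <= al).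
Context (ga_ge : 2 - al <= ga) (al_le_ga : al <= ga) (ga_le : ga <= al + 1).
Context (Lf : Linfty_space Tstar f) (Lg : Linfty_space Tstar g) (Lgt : Linfty_space Tstar gt).
Context (Hfg : forall phi, test_fun Tstar phi -> pairing Tstar f phi = dist_dx Tstar g phi).
Context (Hgt : forall phi, test_fun Tstar phi -> pairing Tstar gt phi = dist_dt Tstar g phi).

Let A := torus_norm +oo rho0.
Let B := torus_norm +oo (fun x => (rho0 x)^-1).
Let U := torus_norm 2%:E u0.
Let D0 := torus_norm 2%:E (weak_deriv rho0).
Let m := torus_norm 1 rho0.

Lemma growth_ge0 : 0 <= growth cp cmu al ga.
Proof.
rewrite /growth divr_ge0 ?sqr_ge0// ltW// mulr_gt0 ?mulr_gt0//.
by have := al_ge; have := al_le_ga; lra.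
Qed.

Lemma integral_sup_density_le (T : R) : 0 < T -> (T%:E < Tstar)%E ->
  (\int[mu]_(t in `]0%R, T[) torus_norm +oo (rho t) <=
   (T * mean_const cmu cp al ga m (Linfty_norm T%:E f) (Linfty_norm T%:E gt) +
    initial_const cmu cp ga al A B U D0 (Linfty_norm T%:E g))%:E)%E.
Proof.
move=> T0 TT.
have [D [cD rhoD intD]] := a_priori S T0 TT cp0 cmu0 al_ge ga_ge al_le_ga ga_le
  Lf Lg Lgt Hfg Hgt.
rewrite -/m -/A -/B -/U -/D0 in rhoD intD.
have ga0 : 0 < ga by have := al_ge; have := al_le_ga; lra.
have T00 : (0 <= (0 : R)%:E < Tstar)%E.
  by rewrite lexx (lt_trans _ TT)// lte_fin.
have mA : fine m <= fine A.
  have [rho0E _] := sol_init S; have [c _] := sol_continuous S T00.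
  have p : periodic1 (rho 0).
    have [H _] := sol_rho_H3 S T0 TT; apply: Hspace_periodic (H 0 _).
    by rewrite in_itv /= lexx ltW.
  rewrite rho0E in c p.
  rewrite /m -torus_norm1_pos//; last by move=> x; rewrite -rho0E; exact: (sol_rho_gt0 S).
  rewrite -[leRHS]Rintegral_torus_cst; apply: le_Rintegral => //.
  - exact: continuous_integrable_torus.
  - exact/continuous_integrable_torus/continuous_const.
  - by move=> x _; apply: le_trans (ler_norm _) _; exact: normr_le_torus_norm_inf.
set c1 := 1 + 2 * _ in rhoD; set k := (_ / _) in rhoD.
have k0 : 0 <= k by rewrite /k divr_ge0 ?sqr_ge0// ltW// !mulr_gt0.
have growthE : growth cp cmu al ga = 2 * k.
  by rewrite /growth /k; field; rewrite !gt_eqF.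
have cF : continuous (fun t => c1 + k * D t).
  apply: continuousD; first exact: continuous_const.
  by apply: continuousM => //; exact: continuous_const.
apply: (@le_trans _ _ (\int[mu]_(t in `]0%R, T[) (c1 + k * D t)%:E)%E).
  apply: le_integral_nonneg => t; first by move=> _; exact: torus_norm_ge0.
  rewrite /= in_itv /= => tT; apply/torus_norm_infP.
  apply: (@filterE _ _ (ae_filter_ringOfSetsType mu)) => x.
  rewrite /torus /= in_itv /= => /andP[/ltW x0 x1]; rewrite lee_fin gtr0_norm.
    by apply: rhoD => //; rewrite x0.
  apply: (sol_rho_gt0 S); case/andP: tT => t0 tT.
  by rewrite lee_fin ltW//= (lt_trans _ TT)// lte_fin.
rewrite EFin_Rintegral//; last exact: continuous_integrable_itv.
rewrite lee_fin.
have -> : \int[mu]_(t in `]0, T[) (c1 + k * D t) = \int[mu]_(t in `]0, T]) (c1 + k * D t).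
  have dP (x : R) : is_derive x 1 (prim (fun t => c1 + k * D t)) (c1 + k * D x).
    exact: is_derive_prim.
  by rewrite (FTC_itv false true (ltW T0) dP cF) (FTC_itv false false (ltW T0) dP cF).
have iT h : continuous h -> mu.-integrable `]0, T] (EFin \o h).
  exact: continuous_integrable_itv.
rewrite RintegralD//; last 2 first.
- exact/iT/continuous_const.
- apply: iT; apply: continuousM => //; exact: continuous_const.
rewrite Rintegral_cst// RintegralZl//; last exact: iT.
rewrite [X in fine X]lebesgue_measure_itv /= lte_fin T0 /= subr0.
have Ng0 : 0 <= fine (Linfty_norm T%:E g) by apply: fine_ge0; exact: Linfty_norm_ge0.
rewrite /mean_const /initial_const growthE -/c1.
have h : 2 * fine (Linfty_norm T%:E g) * fine m <= 2 * fine (Linfty_norm T%:E g) * fine A.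
  by apply: ler_wpM2l => //; exact: mulr_ge0.
have := le_trans intD (lerD (lexx _) h).
set E := initial_energy_bound _ _ _ _ _ _ _ _; set F := force_cost _ _ _ _ _ + _.
set I := Rintegral _ _ _; set q := _ * fine A => {}intD.
have hI : I <= 2 * (E + cp + F * T + q).
  by move: intD; rewrite mulrC ler_pdivrMr// [_ * 2]mulrC.
have := ler_wpM2l k0 hI; clearbody k c1 E F q I.
rewrite [leRHS](_ : _ = 2 * k * (E + cp + q) + T * (2 * k * F)); last by ring.
move=> hk; rewrite mulrDr [T * c1]mulrC -addrA lerD2l addrC; exact: hk.
Qed.

End Conclusion.

Theorem theorem1p8 (R : realType) :
  exists (C1 : R -> R -> R -> R -> \bar R -> \bar R -> \bar R -> R)
         (C2 : R -> R -> R -> R ->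
               \bar R -> \bar R -> \bar R -> \bar R -> \bar R -> R)
         (C3 : R -> R -> R -> R -> \bar R -> \bar R -> \bar R -> R),
  forall (cp cmu alpha gamma : R),
    0 < cp -> 0 < cmu -> 2^-1 <= alpha ->
    Num.max (2 - alpha) alpha <= gamma <= alpha + 1 ->
  forall (Tstar : \bar R) (rho u f g gt : R -> R -> R) (rho0 u0 : R -> R),
    (0 < Tstar)%E ->
    smooth_solution cp cmu alpha gamma Tstar rho u f rho0 u0 ->
    (* f and gt are the weak derivatives of g in space and time *)
    (forall phi, test_fun Tstar phi ->
       pairing Tstar f phi = dist_dx Tstar g phi) ->
    (forall phi, test_fun Tstar phi ->
       pairing Tstar gt phi = dist_dt Tstar g phi) ->
    Linfty_space Tstar g -> Linfty_space Tstar f -> Linfty_space Tstar gt ->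
  (forall T : R, 0 < T -> (T%:E < Tstar)%E ->
    ((T^-1)%:E *
       \int[lebesgue_measure]_(t in `]0%R, T[) torus_norm +oo (rho t)
     <= (C1 cmu cp alpha gamma (torus_norm 1 rho0)
            (Linfty_norm T%:E f) (Linfty_norm T%:E gt))%:E
        + (T^-1)%:E *
          (C2 cmu cp gamma alpha (torus_norm +oo rho0)
              (torus_norm +oo (fun x => (rho0 x)^-1)) (torus_norm 2%:E u0)
              (torus_norm 2%:E (weak_deriv rho0)) (Linfty_norm T%:E g))%:E)%E)
  /\
  (Tstar = +oo%E ->
    (limf_esup (fun T : R => (T^-1)%:E *
       \int[lebesgue_measure]_(t in `]0%R, T[) torus_norm +oo (rho t))
       (pinfty_nbhs R)
     <= (C3 cmu cp alpha gamma (torus_norm 1 rho0)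
            (Linfty_norm +oo f) (Linfty_norm +oo gt))%:E)%E).
Proof.
exists mean_const, initial_const, mean_const.
move=> cp cmu al ga cp0 cmu0 al_ge /andP[+ ga_le]; rewrite ge_max => /andP[ga_ge al_le_ga].
move=> Tstar rho u f g gt rho0 u0 Tstar0 S Hfg Hgt Lg Lf Lgt.
have bound T (T0 : 0 < T) (TT : (T%:E < Tstar)%E) := integral_sup_density_le S cp0 cmu0
  al_ge ga_ge al_le_ga ga_le Lf Lg Lgt Hfg Hgt T0 TT.
have mean T : 0 < T -> (T%:E < Tstar)%E -> ((T^-1)%:E *
       \int[lebesgue_measure]_(t in `]0%R, T[) torus_norm +oo (rho t)
     <= (mean_const cmu cp al ga (torus_norm 1 rho0)
            (Linfty_norm T%:E f) (Linfty_norm T%:E gt))%:E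
        + (T^-1)%:E *
          (initial_const cmu cp ga al (torus_norm +oo rho0)
              (torus_norm +oo (fun x => (rho0 x)^-1)) (torus_norm 2%:E u0)
              (torus_norm 2%:E (weak_deriv rho0)) (Linfty_norm T%:E g))%:E)%E.
  move=> T0 TT; have Ti : (0 <= (T^-1)%:E)%E by rewrite lee_fin invr_ge0 ltW.
  apply: le_trans (lee_wpmul2l Ti (bound T T0 TT)) _.
  by rewrite -!EFinM -EFinD lee_fin mulrDr mulrA mulVf ?gt_eqF// mul1r.
split=> // TE.
have k_ge0 := growth_ge0 cp0 cmu0 al_ge al_le_ga.
have mono h (T : R) : Linfty_space Tstar h -> 0 < T -> (T%:E < Tstar)%E ->
    0 <= fine (Linfty_norm T%:E h) <= fine (Linfty_norm +oo h).
  rewrite TE => -[_ _ hfin] T0 _; rewrite fine_ge0 ?Linfty_norm_ge0//=.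
  have le : (Linfty_norm T%:E h <= Linfty_norm +oo h)%E by exact: le_Linfty_norm (leey _).
  by apply: fine_le => //; rewrite ge0_fin_numE ?Linfty_norm_ge0// (le_lt_trans le).
pose c := initial_const cmu cp ga al (torus_norm +oo rho0)
  (torus_norm +oo (fun x => (rho0 x)^-1)) (torus_norm 2%:E u0)
  (torus_norm 2%:E (weak_deriv rho0)) (Linfty_norm +oo g).
apply: (limf_esup_le_decay (k := Num.max 0 c)); first by rewrite le_max lexx.
move=> T T0.
have TT : (T%:E < Tstar)%E by rewrite TE ltry.
apply: le_trans (mean T T0 TT) _.
rewrite -EFinM -EFinD lee_fin.
have m0 : 0 <= fine (torus_norm 1 rho0) by rewrite fine_ge0 ?torus_norm_ge0.
have A0 : 0 <= fine (torus_norm +oo rho0) by rewrite fine_ge0 ?torus_norm_ge0.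
have /andP[f0 fT] := mono _ _ Lf T0 TT; have /andP[_ gtT] := mono _ _ Lgt T0 TT.
have /andP[_ gT] := mono _ _ Lg T0 TT.
apply: lerD.
  rewrite /mean_const lerD2l; apply: ler_wpM2l => //; apply: lerD; last exact: ler_wpM2r.
  by apply: force_cost_le => //; apply: le_trans al_le_ga; exact: le_trans al_ge.
apply: ler_wpM2l; first by rewrite invr_ge0 ltW.
rewrite le_max; apply/orP; right; rewrite /c /initial_const.
apply: ler_wpM2l => //; rewrite lerD2l; apply: ler_wpM2r => //.
by apply: ler_wpM2l.
Qed.
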